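(* Let $\delta\in\mathbb C$ with $|\delta|>1$. There exists a dense $G_\delta$-subset (i.e. a dense countable intersection of open sets) $\mathcal U$ of $\mathcal H_\delta(\mathbb C^2)$ such that every map $F\in\mathcal U$ has a fixed saddle point whose stable manifold is dense in $\mathbb C^2$.
   Context: $\mathcal H_\delta(\mathbb C^2)$ denotes the space of all entire Hénon maps with Jacobian determinant $\delta$, i.e. maps $F\colon\mathbb C^2\to\mathbb C^2$, $F(z,w)=(f(z)-\delta w,z)$ with $f\colon\mathbb C\to\mathbb C$ entire, equipped with the compact-open topology. A fixed saddle point is a fixed point $p$ of $F$ such that $DF(p)$ has one eigenvalue of modulus $<1$ and one of modulus $>1$; its stable manifold is $\{q\in\mathbb C^2: F^n(q)\to p \text{ as } n\to\infty\}$. *)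

(* Defs.v *)
From mathcomp Require Import all_boot all_order all_algebra.
From mathcomp Require Import all_classical all_reals all_analysis.
Import Order.TTheory GRing.Theory Num.Theory.
Import numFieldNormedType.Exports.

Set Implicit Arguments.
Unset Strict Implicit.
Unset Printing Implicit Defensive.

Local Open Scope classical_set_scope.
Local Open Scope ring_scope.

(* Throughout, C is the field of complex numbers: it is instantiated by R[i],
   for R : realType, in the theorem. The library puts a normed module structure
   over C itself on C and C * C, so derivable and 'd are the complex-linear
   notions. *)

Definition entire (C : numClosedFieldType) (f : C -> C) : Prop :=
  forall z, derivable f z 1.

Definition henon (C : numClosedFieldType) (delta : C) (f : C -> C) :
    C * C -> C * C :=
  fun p => (f p.1 - delta * p.2, p.1).

(* Viewed as a type, a set of a topological space carries the subspace
   topology, here the one inherited from the compact-open topology. *)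
Definition henon_maps (C : numClosedFieldType) (delta : C) :
    set {compact-open, (C * C)%type -> (C * C)%type} :=
  [set F | exists2 f : C -> C, entire f & F = henon delta f].

Definition fixed_saddle (C : numClosedFieldType) (F : C * C -> C * C)
    (p : C * C) : Prop :=
  F p = p /\
  exists l m : C,
    [/\ passmx.leigenvalue (linfun ('d F p)) l, `|l| < 1,
        passmx.leigenvalue (linfun ('d F p)) m & 1 < `|m| ].

Definition stable_manifold (C : numClosedFieldType) (F : C * C -> C * C)
    (p : C * C) : set (C * C) :=
  [set q | (fun n => iter n F q) @ \oo --> p].

(* Main.v *)
Require Import Defs.
From mathcomp Require Import all_boot all_order all_algebra complex.
From mathcomp Require Import all_classical all_reals all_analysis.
From mathcomp Require Import borel_hierarchy.
From mathcomp Require Import ring lra zify.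
Import Order.TTheory GRing.Theory Num.Theory.
Import numFieldNormedType.Exports.

(** The Jacobian determinant of the [n]-th iterate of [F] is [delta ^ n], which is
    unbounded, so by Cauchy's estimates the orbit of some point of any given ball
    leaves any given disc. At a fixed point where [|f'| > 1 + |delta|] the map has a
    saddle; its local stable manifold is found by Picard iteration, depends
    Lipschitz-continuously on [f] for the sup norm on a disc, and, by Schwarz's
    lemma, has unbounded backward orbits. An escaping orbit from the ball and a
    backward stable orbit are joined by adding to [f] three small multiples of
    [(x / x0) ^ N]: these are negligible on discs [|x| <= r < |x0|] but prescribe
    the value at [x0]. Hence it is an open dense condition that the stable manifold
    meets a given ball, and Baire's theorem on a countable basis of balls concludes,
    once Zorn's lemma has split a dense open set of maps into disjoint open cells
    on each of which the saddle is chosen continuously. Cauchy's estimates are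
    obtained from mere complex differentiability by Goursat's argument, applied to
    midpoint Riemann sums along squares. *)

Set Implicit Arguments.
Unset Strict Implicit.
Unset Printing Implicit Defensive.

Local Open Scope classical_set_scope.
Local Open Scope ring_scope.
Local Open Scope complex_scope.

(** * Modulus and limits *)

(* The norm [`|x|] of the library takes its values in [R[i]], this one in [R]. *)
Local Notation "|[ x ]|" := (ComplexField.Normc.normc x)
  (at level 0, x at level 99, format "|[ x ]|") : ring_scope.

Section RealModulus.
Variable R : realType.
Local Notation C := (R[i]).
Local Notation Re := (@complex.Re R).
Local Notation Im := (@complex.Im R).
Implicit Types (x y z : C) (a b : R).

(** A perturbation by a high power is felt only at the outermost point that an orbit visits. This
    shapes the construction: the stable orbit is cut at its last exit from a disc, so that its
    outermost point comes first, and the escaping orbit is stopped at its first exit beyond that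
    modulus, so that its outermost point comes last; the remaining points of both lie in a strictly
    smaller disc. Encoding orbits by the scalar recurrence [z n.+2 = f (z n.+1) - delta * z n] turns
    the joining of two orbits into the prescription of two consecutive terms. Solving the recurrence
    for its middle term is a contraction near a saddle; solving it for [z n] divides by [delta],
    which has modulus above one.

    By itself the Baire argument would give, for each ball, some saddle whose stable manifold meets
    it. The saddle has to be the same for all balls, and this is what disjoint cells enforce: a map
    lies in at most one of them, and each cell fixes the disc in which the saddle is taken. *)

Lemma normcE x : `|x| = |[x]|%:C. Proof. by []. Qed.

Lemma cnormM x y : |[x * y]| = |[x]| * |[y]|.
Proof. exact: ComplexField.Normc.normcM. Qed.

Lemma cnormV x : |[x^-1]| = |[x]|^-1.
Proof. exact: ComplexField.Normc.normcV. Qed.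

Lemma cnorm0 : |[0 : C]| = 0.
Proof. exact: ComplexField.Normc.normc0. Qed.

Lemma cnorm1 : |[1 : C]| = 1.
Proof. exact: ComplexField.Normc.normc1. Qed.

Lemma cnormN x : |[- x]| = |[x]|.
Proof. exact: normcN. Qed.

Lemma cnorm_ge0 x : 0 <= |[x]|.
Proof. by case: x => a b; exact: sqrtr_ge0. Qed.

Lemma cnormD x y : |[x + y]| <= |[x]| + |[y]|.
Proof. exact: le_normcD. Qed.

Lemma cnormB x y : |[x - y]| <= |[x]| + |[y]|.
Proof. by rewrite -[|[y]|]cnormN; exact: cnormD. Qed.

Lemma cnormC x y : |[x - y]| = |[y - x]|.
Proof. by rewrite -cnormN opprB. Qed.

Lemma cnorm_tri z x y : |[x - y]| <= |[x - z]| + |[z - y]|.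
Proof. by rewrite -[x - y](_ : (x - z) + (z - y) = _); [exact: cnormD | ring]. Qed.

Lemma cnorm_le_sub x y : |[x]| <= |[y]| + |[x - y]|.
Proof. by rewrite -{1}[x](_ : y + (x - y) = _); [exact: cnormD | ring]. Qed.

Lemma cnorm_eq0 x : (|[x]| == 0) = (x == 0).
Proof.
apply/eqP/eqP => [|->]; last exact: cnorm0.
exact: ComplexField.Normc.eq0_normc.
Qed.

Lemma cnorm_gt0 x : (0 < |[x]|) = (x != 0).
Proof. by rewrite lt_def cnorm_eq0 cnorm_ge0 andbT. Qed.

Lemma cnormX x n : |[x ^+ n]| = |[x]| ^+ n.
Proof. by elim: n => [|n IH]; rewrite ?expr0 ?cnorm1// !exprS cnormM IH. Qed.

Lemma cnorm_real a : |[a%:C]| = `|a|.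
Proof. by rewrite /= expr0n /= addr0 sqrtr_sqr. Qed.

Lemma cnorm_nat n : |[n%:R : C]| = n%:R.
Proof. by rewrite -(rmorph_nat (real_complex R)) cnorm_real normr_nat. Qed.

Lemma cnorm_i : |['i%C : C]| = 1.
Proof. by rewrite /= expr0n expr1n add0r sqrtr1. Qed.

Lemma cnorm_sum (I : Type) (r : seq I) (P : pred I) (F : I -> C) :
  |[\sum_(i <- r | P i) F i]| <= \sum_(i <- r | P i) |[F i]|.
Proof.
elim/big_ind2: _ => // [|x a y b xa yb]; first by rewrite cnorm0.
exact: le_trans (cnormD _ _) (lerD xa yb).
Qed.

Lemma cnorm_Re x : `|Re x| <= |[x]|.
Proof.
case: x => a b /=; rewrite -[`|a|]sqrtr_sqr ler_sqrt ?addr_ge0 ?sqr_ge0//.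
by rewrite lerDl sqr_ge0.
Qed.

Lemma cnorm_Im x : `|Im x| <= |[x]|.
Proof.
case: x => a b /=; rewrite -[`|b|]sqrtr_sqr ler_sqrt ?addr_ge0 ?sqr_ge0//.
by rewrite lerDr sqr_ge0.
Qed.

Lemma cnorm_ReIm x : |[x]| <= `|Re x| + `|Im x|.
Proof.
rewrite {1}[x]complexE (le_trans (cnormD _ _))// cnorm_real lerD2l.
by rewrite cnormM cnorm_i mul1r cnorm_real.
Qed.

End RealModulus.

Section Limits.
Variable R : realType.
Local Notation C := (R[i]).
Local Notation Re := (@complex.Re R).
Local Notation Im := (@complex.Im R).

Lemma nested_intervals (a b : nat -> R) :
  (forall n, a n <= a n.+1) -> (forall n, b n.+1 <= b n) ->
  (forall n, a n <= b n) -> exists l, forall n, a n <= l <= b n.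
Proof.
move=> ha hb hab.
have am m n : (m <= n)%N -> a m <= a n.
  by move=> /subnK <-; elim: (n - m)%N => // k /le_trans; apply; rewrite addSn.
have bm m n : (m <= n)%N -> b n <= b m.
  by move=> /subnK <-; elim: (n - m)%N => // k IH; apply: le_trans IH; rewrite addSn.
have ab m n : a m <= b n.
  have [mn|/ltnW nm] := leqP m n; first exact: le_trans (am _ _ mn) _.
  exact: le_trans (hab _) (bm _ _ nm).
pose A : set R := fun x => exists n, x = a n.
have hA : has_sup A.
  by split; [exists (a 0%N), 0%N | exists (b 0%N) => _ [n ->]].
exists (sup A) => n; apply/andP; split; first by apply: ub_le_sup; [exact: hA.2 | exists n].
by apply: ge_sup; [exact: hA.1 | move=> _ [m ->]].
Qed.

Lemma bernoulli_ineq (h : R) n : 0 <= h -> 1 + n%:R * h <= (1 + h) ^+ n.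
Proof.
move=> h0; elim: n => [|n IH]; first by rewrite mul0r addr0 expr0.
rewrite exprS; apply: le_trans (ler_wpM2l _ IH); last by lra.
by rewrite -natr1; have : 0 <= n%:R :> R by []; nra.
Qed.

Lemma natr_unbounded (x : R) : exists n : nat, x <= n%:R.
Proof.
exists (Num.bound x); apply: ltW; apply: le_lt_trans (ler_norm _) _.
by have := archi_boundP (normr_ge0 x); rewrite /Num.bound normr_id.
Qed.

(** With [s = sqrt q], Bernoulli bounds [n * s ^ n], and the second factor [s ^ n] tends to zero.
    The factor [n] is there for the derivative of the powers [(x / x0) ^ N] used as
    perturbations. *)
Lemma natX_small (q e : R) : 0 <= q < 1 -> 0 < e ->
  exists N, forall n, (N <= n)%N -> n%:R * q ^+ n <= e.
Proof.
move=> /andP[q0 q1] e0; have [->|qn0] := eqVneq q 0.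
  by exists 1%N => -[//|n] _; rewrite expr0n mulr0 ltW.
have qp : 0 < q by rewrite lt_def qn0.
pose s := Num.sqrt q; have sp : 0 < s by rewrite sqrtr_gt0.
have ss : s * s = q by rewrite -expr2 sqr_sqrtr.
have s1 : s < 1 by nra.
pose h := s^-1 - 1; have hp : 0 < h by rewrite subr_gt0 invf_gt1.
have sh : s * (1 + h) = 1 by rewrite /h addrC subrK divff// gt_eqF.
have key n : n%:R * h * s ^+ n <= 1.
  have := ler_wpM2r (exprn_ge0 n (ltW sp)) (bernoulli_ineq n (ltW hp)).
  rewrite -exprMn [_ * s]mulrC sh expr1n; apply: le_trans.
  by rewrite ler_pM2r ?exprn_gt0// lerDr.
have [N hN] := natr_unbounded (1 / (h * (h * e))).
exists N => n Nn; have hk := key n.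
have hn : 1 <= n%:R * (h * (h * e)).
  rewrite -ler_pdivrMr ?mulr_gt0//; apply: le_trans hN _; by rewrite ler_nat.
rewrite -ss exprMn mulrA.
have sn0 : 0 <= s ^+ n by rewrite exprn_ge0// ltW.
have n0 : 0 <= n%:R :> R by [].
set S := s ^+ n in hk sn0 *; set m := n%:R in hk hn n0 *.
have h1 : S <= h * e.
  have : S * 1 <= S * (m * (h * (h * e))) by rewrite ler_wpM2l.
  have : (m * h * S) * (h * e) <= 1 * (h * e) by rewrite ler_wpM2r// mulr_ge0// ltW.
  lra.
have : (m * S) * S <= (m * S) * (h * e) by rewrite ler_wpM2l// mulr_ge0.
have : (m * h * S) * e <= 1 * e by rewrite ler_wpM2r// ltW.
lra.
Qed.

Lemma geo_small (K q e : R) : 0 <= q < 1 -> 0 < e ->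
  exists N, forall n, (N <= n)%N -> K * q ^+ n <= e.
Proof.
move=> q01 e0; have [M hM] := natr_unbounded K; have [N hN] := natX_small q01 e0.
exists (maxn N M) => n; rewrite geq_max => /andP[Nn Mn].
apply: le_trans (hN _ Nn); rewrite ler_wpM2r ?exprn_ge0//; first by case/andP: q01.
by rewrite (le_trans hM)// ler_nat.
Qed.

Lemma real_geo_lim (v : nat -> R) (K q : R) : 0 <= q < 1 ->
  (forall n, `|v n.+1 - v n| <= K * q ^+ n) ->
  exists l, forall n, `|v n - l| <= K / (1 - q) * q ^+ n.
Proof.
move=> /andP[q0 q1] hv; have q1' : 0 < 1 - q by lra.
(* Tail of the geometric series: the intervals of radius [r n] around [v n] are nested. *)
pose r n := K / (1 - q) * q ^+ n.
have rS n : r n - r n.+1 = K * q ^+ n.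
  by rewrite /r exprS; field; rewrite gt_eqF.
have K0 : 0 <= K by have := hv 0%N; rewrite expr0 mulr1; exact: le_trans.
have r0 n : 0 <= r n by rewrite /r mulr_ge0 ?exprn_ge0// divr_ge0// ltW.
have [||| l hl] := @nested_intervals (fun n => v n - r n) (fun n => v n + r n).
- by move=> n; have := hv n; rewrite -rS ler_norml; lra.
- by move=> n; have := hv n; rewrite -rS ler_norml; lra.
- by move=> n; have := r0 n; lra.
by exists l => n; rewrite -/(r n) ler_norml; have := hl n; lra.
Qed.

Lemma geo_lim (u : nat -> C) (K q : R) : 0 <= q < 1 ->
  (forall n, |[u n.+1 - u n]| <= K * q ^+ n) ->
  exists l, forall n, |[u n - l]| <= 2 * (K / (1 - q)) * q ^+ n.
Proof.
move=> q01 hu.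
have ReB x y : Re (x - y) = Re x - Re y :> R by case: x y => [? ?] [].
have ImB x y : Im (x - y) = Im x - Im y :> R by case: x y => [? ?] [].
have [|a ha] := @real_geo_lim (fun n => Re (u n)) K q q01.
  by move=> n; rewrite -ReB (le_trans (cnorm_Re _)).
have [|b hb] := @real_geo_lim (fun n => Im (u n)) K q q01.
  by move=> n; rewrite -ImB (le_trans (cnorm_Im _)).
exists (a +i* b) => n; rewrite (le_trans (cnorm_ReIm _))// ReB ImB /=.
by have := ha n; have := hb n; lra.
Qed.

End Limits.

(** * Complex derivatives *)

Section ComplexDerivative.
Variable R : realType.
Local Notation C := (R[i]).
Implicit Types (f g : C -> C) (z d : C).

(** Complex differentiability with real bounds, so that estimates become linear inequalities in [R];
    [entire_holo] relates it to [derivable]. *)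
Definition cdiff f z d := forall e : R, 0 < e -> exists2 r : R, 0 < r &
  forall h, |[h]| <= r -> |[f (z + h) - f z - d * h]| <= e * |[h]|.

Definition holo f := forall z, exists d, cdiff f z d.

Lemma cdiff_cst c z : cdiff (fun=> c) z 0.
Proof.
by move=> e e0; exists 1 => // h _; rewrite subrr mul0r subr0 cnorm0 mulr_ge0 ?cnorm_ge0 ?ltW.
Qed.

Lemma cdiff_id z : cdiff id z 1.
Proof.
move=> e e0; exists 1 => // h _.
by rewrite mul1r addrAC addrK subrr cnorm0 mulr_ge0 ?cnorm_ge0 ?ltW.
Qed.

Lemma cdiffD f g z d d' :
  cdiff f z d -> cdiff g z d' -> cdiff (fun x => f x + g x) z (d + d').
Proof.
move=> hf hg e e0; have e2 : 0 < e / 2 by lra.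
have [r r0 hr] := hf _ e2; have [s s0 hs] := hg _ e2.
exists (Num.min r s); first by rewrite lt_min r0.
move=> h; rewrite le_min => /andP[/hr h1 /hs h2].
rewrite (_ : _ - _ = (f (z + h) - f z - d * h) + (g (z + h) - g z - d' * h)); last by ring.
by apply: le_trans (cnormD _ _) _; lra.
Qed.

Lemma cdiff_lip f z d : cdiff f z d -> exists2 r : R, 0 < r &
  forall h, |[h]| <= r -> |[f (z + h) - f z]| <= (|[d]| + 1) * |[h]|.
Proof.
move=> /(_ 1 ltr01)[r r0 hr]; exists r => // h /hr hh.
have := cnorm_le_sub (f (z + h) - f z) (d * h); rewrite cnormM; lra.
Qed.

Lemma cdiff_cont f z d : cdiff f z d -> forall e : R, 0 < e ->
  exists2 r : R, 0 < r & forall h, |[h]| <= r -> |[f (z + h) - f z]| <= e.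
Proof.
move=> /cdiff_lip[r r0 hr] e e0; have d0 := cnorm_ge0 d.
have d1 : 0 < |[d]| + 1 by lra.
exists (Num.min r (e / (|[d]| + 1))); first by rewrite lt_min r0 divr_gt0.
move=> h; rewrite le_min => /andP[/hr h1]; rewrite ler_pdivlMr//; lra.
Qed.

Lemma cdiffM f g z d d' : cdiff f z d -> cdiff g z d' ->
  cdiff (fun x => f x * g x) z (d * g z + f z * d').
Proof.
move=> hf hg e e0.
set K := |[f z]| + |[g z]| + 1.
have K1 : 1 <= K by rewrite /K; have := cnorm_ge0 (f z); have := cnorm_ge0 (g z); lra.
have K0 : 0 < K by lra.
set L := |[d]| + 1; have L0 : 0 < L by rewrite /L; have := cnorm_ge0 d; lra.
set L' := |[d']| + 1; have L'0 : 0 < L' by rewrite /L'; have := cnorm_ge0 d'; lra.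
have e2 : 0 < e / (3 * K) by rewrite divr_gt0// mulr_gt0.
have [r r0 hr] := hf _ e2; have [s s0 hs] := hg _ e2.
have [r' r'0 hr'] := cdiff_lip hf; have [s' s'0 hs'] := cdiff_lip hg.
have q0 : 0 < e / (3 * (L * L')) by rewrite divr_gt0// !mulr_gt0.
exists (Num.min (Num.min r s) (Num.min (Num.min r' s') (e / (3 * (L * L'))))).
  by rewrite !lt_min r0 s0 r'0 s'0 q0.
move=> h; rewrite !le_min => /andP[/andP[/hr h1 /hs h2] /andP[/andP[/hr' h3 /hs' h4] h5]].
rewrite (_ : _ - _ = (f (z + h) - f z - d * h) * g z + f z * (g (z + h) - g z - d' * h)
   + (f (z + h) - f z) * (g (z + h) - g z)); last by ring.
have n0 := cnorm_ge0 h.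
have b1 : |[(f (z + h) - f z - d * h) * g z]| <= e / 3 * |[h]|.
  rewrite cnormM; apply: le_trans (ler_pM _ _ h1 (_ : |[g z]| <= K)) _; rewrite ?cnorm_ge0//.
    by rewrite /K; have := cnorm_ge0 (f z); lra.
  by rewrite le_eqVlt; apply/orP; left; apply/eqP; field; rewrite gt_eqF.
have b2 : |[f z * (g (z + h) - g z - d' * h)]| <= e / 3 * |[h]|.
  rewrite cnormM; apply: le_trans (ler_pM _ _ (_ : |[f z]| <= K) h2) _; rewrite ?cnorm_ge0//.
    by rewrite /K; have := cnorm_ge0 (g z); lra.
  by rewrite le_eqVlt; apply/orP; left; apply/eqP; field; rewrite gt_eqF.
have b3 : |[(f (z + h) - f z) * (g (z + h) - g z)]| <= e / 3 * |[h]|.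
  rewrite cnormM; apply: le_trans (ler_pM _ _ h3 h4) _; rewrite ?cnorm_ge0//.
  rewrite mulrACA -/L -/L' mulrA ler_wpM2r//.
  apply: le_trans (ler_wpM2l _ h5) _; first by rewrite mulr_ge0// ltW.
  by rewrite le_eqVlt; apply/orP; left; apply/eqP; field; rewrite !gt_eqF.
apply: le_trans (cnormD _ _) _; apply: le_trans (lerD (cnormD _ _) b3) _.
lra.
Qed.

Lemma cdiff_scale c f z d : cdiff f z d -> cdiff (fun x => c * f x) z (c * d).
Proof.
by move=> hf; have := cdiffM (cdiff_cst c z) hf; rewrite mul0r add0r.
Qed.

Lemma cdiffB f g z d d' :
  cdiff f z d -> cdiff g z d' -> cdiff (fun x => f x - g x) z (d - d').
Proof.
move=> hf hg; have := cdiffD hf (cdiff_scale (-1) hg).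
by rewrite mulN1r; congr cdiff; apply/funext => x; rewrite mulN1r.
Qed.

Lemma cdiff_comp f g z d d' : cdiff f z d -> cdiff g (f z) d' ->
  cdiff (fun x => g (f x)) z (d' * d).
Proof.
move=> hf hg e e0.
set L := |[d]| + 1; have L0 : 0 < L by rewrite /L; have := cnorm_ge0 d; lra.
set K := |[d']| + 1; have K0 : 0 < K by rewrite /K; have := cnorm_ge0 d'; lra.
have e1 : 0 < e / (2 * K) by rewrite divr_gt0// mulr_gt0.
have e2 : 0 < e / (2 * L) by rewrite divr_gt0// mulr_gt0.
have [r r0 hr] := hf _ e1; have [s s0 hs] := hg _ e2.
have [r' r'0 hr'] := cdiff_lip hf.
exists (Num.min (Num.min r r') (s / L)); first by rewrite !lt_min r0 r'0 divr_gt0.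
move=> h; rewrite !le_min => /andP[/andP[/hr h1 /hr' h2] h3].
set k := f (z + h) - f z in h2 *.
have ks : |[k]| <= s.
  by apply: le_trans h2 _; rewrite mulrC -/L -ler_pdivlMr.
have := hs _ ks; rewrite (_ : f z + k = f (z + h)) => [h4|]; last by rewrite /k addrC subrK.
rewrite (_ : _ - _ = (g (f (z + h)) - g (f z) - d' * k) + d' * (k - d * h)); last by ring.
apply: le_trans (cnormD _ _) _; rewrite cnormM.
have a1 : e / (2 * L) * |[k]| <= e / 2 * |[h]|.
  apply: le_trans (ler_wpM2l (ltW e2) h2) _; rewrite -/L.
  by rewrite le_eqVlt; apply/orP; left; apply/eqP; field; rewrite gt_eqF.
have a2 : |[d']| * |[k - d * h]| <= e / 2 * |[h]|.
  apply: le_trans (ler_pM _ _ (_ : _ <= K) h1) _; rewrite ?cnorm_ge0//; first by rewrite /K; lra.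
  by rewrite le_eqVlt; apply/orP; left; apply/eqP; field; rewrite gt_eqF.
lra.
Qed.

Lemma cdiff_inv z : z != 0 -> cdiff (fun x => x^-1) z (- z ^- 2).
Proof.
move=> z0 e e0; have nz : 0 < |[z]| by rewrite cnorm_gt0.
exists (Num.min (|[z]| / 2) (e * |[z]| ^+ 3 / 2)).
  by rewrite lt_min !divr_gt0// mulr_gt0// exprn_gt0.
move=> h; rewrite le_min => /andP[h1 h2].
have zh : |[z]| / 2 <= |[z + h]|.
  have := cnorm_le_sub z (z + h); rewrite opprD addNKr cnormN; lra.
have zh0 : z + h != 0 by rewrite -cnorm_gt0; lra.
rewrite (_ : _ - _ = h * (h / (z ^+ 2 * (z + h)))); last by field; rewrite z0 zh0.
rewrite cnormM mulrC ler_wpM2r ?cnorm_ge0// !cnormM cnormV cnormM cnormX.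
rewrite ler_pdivrMr ?mulr_gt0 ?exprn_gt0//; last by lra.
apply: le_trans h2 _; rewrite (_ : _ / 2 = e * (|[z]| ^+ 2 * (|[z]| / 2))); last by field.
by rewrite ler_pM2l// ler_pM2l ?exprn_gt0.
Qed.

Lemma cdiff_unique f z d d' : cdiff f z d -> cdiff f z d' -> d = d'.
Proof.
move=> hf hf'; apply/eqP; rewrite -subr_eq0 -cnorm_eq0 eq_le cnorm_ge0 andbT.
apply/ler_addgt0Pr => e e0; rewrite add0r.
have e2 : 0 < e / 2 by lra.
have [r r0 hr] := hf _ e2; have [s s0 hs] := hf' _ e2.
have m0 : 0 < Num.min r s by rewrite lt_min r0.
pose h : C := (Num.min r s)%:C.
have nh : |[h]| = Num.min r s by rewrite cnorm_real ger0_norm ?ltW.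
have hr' : |[h]| <= r by rewrite nh ge_min lexx.
have hs' : |[h]| <= s by rewrite nh ge_min lexx orbT.
rewrite -(ler_pM2r m0) -nh -cnormM.
rewrite (_ : _ * h = (f (z + h) - f z - d' * h) - (f (z + h) - f z - d * h)); last by ring.
by apply: le_trans (cnormB _ _) _; have := hr _ hr'; have := hs _ hs'; lra.
Qed.

Lemma holo_cst c : holo (fun=> c). Proof. by move=> z; exists 0; exact: cdiff_cst. Qed.

Lemma holo_id : holo id. Proof. by move=> z; exists 1; exact: cdiff_id. Qed.

Lemma holoD f g : holo f -> holo g -> holo (fun x => f x + g x).
Proof. by move=> hf hg z; have [d ?] := hf z; have [d' ?] := hg z; exists (d + d'); exact: cdiffD. Qed.

Lemma holoB f g : holo f -> holo g -> holo (fun x => f x - g x).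
Proof. by move=> hf hg z; have [d ?] := hf z; have [d' ?] := hg z; exists (d - d'); exact: cdiffB. Qed.

Lemma holoM f g : holo f -> holo g -> holo (fun x => f x * g x).
Proof.
move=> hf hg z; have [d ?] := hf z; have [d' ?] := hg z.
by exists (d * g z + f z * d'); exact: cdiffM.
Qed.

Lemma holo_comp f g : holo f -> holo g -> holo (fun x => g (f x)).
Proof.
move=> hf hg z; have [d ?] := hf z; have [d' ?] := hg (f z).
by exists (d' * d); exact: cdiff_comp.
Qed.

Lemma holoX f n : holo f -> holo (fun x => f x ^+ n).
Proof.
move=> hf; elim: n => [|n IH]; first exact: holo_cst.
by have := holoM hf IH; congr holo; apply/funext => x; rewrite exprS.
Qed.

End ComplexDerivative.

(** * Goursat's lemma *)

Section Goursat.
Variable R : realType.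
Local Notation C := (R[i]).
Local Notation Re := (@complex.Re R).
Local Notation Im := (@complex.Im R).
Definition ci : C := 'i%C.

Lemma ci2 : ci * ci = -1. Proof. exact: sqr_i. Qed.

Lemma cnorm_ci : |[ci]| = 1. Proof. exact: cnorm_i. Qed.

Implicit Types (G : C -> C) (z d L : C) (n k : nat).

(** Midpoint Riemann sum of the integral of [G] along the segment from [z] to [z + d]. *)
Definition seg n G z d : C :=
  \sum_(i < n) (d / n%:R) * G (z + d * ((2 * i + 1)%:R / (2 * n)%:R)).

(** Boundary of a square, run counterclockwise; the complex number [L] gives both the length and the
    direction of its first side. *)
Definition square n G z L : C :=
  seg n G z L + seg n G (z + L) (ci * L) - seg n G (z + ci * L) L - seg n G z (ci * L).

Definition on_seg z d (w : C) := exists2 s : R, 0 <= s <= 1 & w = z + s%:C * d.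

Definition on_square z L (w : C) :=
  [\/ on_seg z L w, on_seg (z + L) (ci * L) w, on_seg (z + ci * L) L w | on_seg z (ci * L) w].

(** Cutting into thirds, unlike halves, leaves a central square concentric with the original one, as
    [annulus_step] requires. *)
Lemma seg3 n G z d : (0 < n)%N -> seg (n + n + n) G z d =
  seg n G z (d / 3) + seg n G (z + d / 3) (d / 3) + seg n G (z + 2 * (d / 3)) (d / 3).
Proof.
move=> n0; have n0' : n%:R != 0 :> C by rewrite pnatr_eq0 -lt0n.
have E : (n + n + n)%:R = 3 * n%:R :> C by rewrite !natrD; ring.
rewrite /seg !big_split_ord /=; congr (_ + _ + _); apply: eq_bigr => i _;
  rewrite !natrM E !(natrD, natrM); (congr (_ * G _); first by field); by field.
Qed.

Lemma seg_bound n G A z d (M : R) : (0 < n)%N ->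
  (forall w, on_seg z d w -> |[G w - A w]| <= M) ->
  |[seg n G z d - seg n A z d]| <= |[d]| * M.
Proof.
move=> n0 h; rewrite /seg -sumrB.
apply: le_trans (cnorm_sum _ _ _) _.
have nR : 0 < n%:R :> R by rewrite ltr0n.
apply: (@le_trans _ _ (\sum_(i < n) (|[d]| * M / n%:R))).
  apply: ler_sum => i _; rewrite -mulrBr cnormM cnormM cnormV cnorm_nat.
  rewrite [leRHS]mulrAC ler_wpM2l ?mulr_ge0 ?cnorm_ge0 ?invr_ge0 ?ler0n//.
  apply: h; exists ((2 * i + 1)%:R / (2 * n)%:R).
    rewrite divr_ge0 ?ler0n//= ler_pdivrMr ?ltr0n ?muln_gt0// mul1r ler_nat.
    by have := ltn_ord i; lia.
  by rewrite rmorphM fmorphV !rmorph_nat mulrC.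
by rewrite sumr_const card_ord -[_ *+ n]mulr_natr mulfVK// gt_eqF.
Qed.

(** The midpoint rule is exact on affine functions, so their sums along a closed square vanish for
    every [n] and not just in the limit. The computation rests on the sum of the first [m] odd
    numbers. *)
Lemma seg_affine n (a b : C) z d : (0 < n)%N ->
  seg n (fun w => a + b * w) z d = d * (a + b * (z + d / 2)).
Proof.
move=> n0; have n0' : n%:R != 0 :> C by rewrite pnatr_eq0 -lt0n.
pose x : C := n%:R; pose c := d / x * (a + b * z); pose e := d / x * (b * (d / (2 * x))).
have S (m : nat) : \sum_(i < m) (c + e * (2 * i + 1)%:R) = m%:R * c + e * (m ^ 2)%:R.
  elim: m => [|m IH]; first by rewrite big_ord0 mul0r mulr0 addr0.
  rewrite big_ord_recr /= IH -natr1 !(natrM, natrX, natrD) -natr1; ring.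
rewrite /seg (eq_bigr (fun i : 'I_n => c + e * (2 * i + 1)%:R)) => [|i _].
  by rewrite S natrX /c /e /x; field.
by rewrite /c /e /x !(natrM, natrD); field.
Qed.

Lemma square_affine n (a b : C) z L : (0 < n)%N ->
  square n (fun w => a + b * w) z L = 0.
Proof.
move=> n0; rewrite /square !seg_affine//.
have i2 := ci2.
by field: i2.
Qed.

Lemma square_bound n G A z L (M : R) : (0 < n)%N ->
  (forall w, on_square z L w -> |[G w - A w]| <= M) ->
  |[square n G z L - square n A z L]| <= 4 * (|[L]| * M).
Proof.
move=> n0 h; have nL : |[ci * L]| = |[L]| by rewrite cnormM cnorm_ci mul1r.
have h1 : |[seg n G z L - seg n A z L]| <= |[L]| * M.
  by apply: seg_bound => // w hw; apply: h; constructor 1.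
have h2 : |[seg n G (z + L) (ci * L) - seg n A (z + L) (ci * L)]| <= |[L]| * M.
  by rewrite -nL; apply: seg_bound => // w hw; apply: h; constructor 2.
have h3 : |[seg n G (z + ci * L) L - seg n A (z + ci * L) L]| <= |[L]| * M.
  by apply: seg_bound => // w hw; apply: h; constructor 3.
have h4 : |[seg n G z (ci * L) - seg n A z (ci * L)]| <= |[L]| * M.
  by rewrite -nL; apply: seg_bound => // w hw; apply: h; constructor 4.
rewrite /square.
rewrite (_ : _ - _ - _ = (seg n G z L - seg n A z L)
  + (seg n G (z + L) (ci * L) - seg n A (z + L) (ci * L))
  - (seg n G (z + ci * L) L - seg n A (z + ci * L) L)
  - (seg n G z (ci * L) - seg n A z (ci * L))); last by ring.
apply: le_trans (cnormB _ _) _; apply: le_trans (lerD (cnormB _ _) h4) _.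
by have := cnormD (seg n G z L - seg n A z L) (seg n G (z + L) (ci * L) - seg n A (z + L) (ci * L)); lra.
Qed.

Definition corner (x y : nat) : C := x%:R + ci * y%:R.

(** Each inner edge of the grid is shared by two squares that run along it in opposite directions.
    [H] and [V] name the horizontal and vertical edges, after which the cancellation is formal. *)
Lemma square3 n G z L : (0 < n)%N -> square (n + n + n) G z L =
  \sum_(x < 3) \sum_(y < 3) square n G (z + corner x y * (L / 3)) (L / 3).
Proof.
move=> n0.
pose H (x y : nat) := seg n G (z + corner x y * (L / 3)) (L / 3).
pose V (x y : nat) := seg n G (z + corner x y * (L / 3)) (ci * (L / 3)).
have i2 := ci2.
have E x y : square n G (z + corner x y * (L / 3)) (L / 3) =
    H x y + V x.+1 y - H x y.+1 - V x y.
  rewrite /square /H /V /corner -!natr1.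
  by congr (_ + seg _ _ _ _ - seg _ _ _ _ - _); ring.
rewrite !big_ord_recr !big_ord0 /= !E.
rewrite /square !seg3//.
have e3 : ci * L / 3 = ci * (L / 3) by rewrite mulrA.
rewrite !e3.
rewrite (_ : seg n G z (L / 3) = H 0%N 0%N); last by rewrite /H /corner; congr seg; ring.
rewrite (_ : seg n G (z + L / 3) (L / 3) = H 1%N 0%N); last by rewrite /H /corner; congr seg; ring.
rewrite (_ : seg n G (z + 2 * (L / 3)) (L / 3) = H 2%N 0%N);
  last by rewrite /H /corner; congr seg; ring.
rewrite (_ : seg n G (z + L) (ci * (L / 3)) = V 3%N 0%N);
  last by rewrite /V /corner; congr seg; field.
rewrite (_ : seg n G (z + L + ci * (L / 3)) (ci * (L / 3)) = V 3%N 1%N);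
  last by rewrite /V /corner; congr seg; field.
rewrite (_ : seg n G (z + L + 2 * (ci * (L / 3))) (ci * (L / 3)) = V 3%N 2%N);
  last by rewrite /V /corner; congr seg; field.
rewrite (_ : seg n G (z + ci * L) (L / 3) = H 0%N 3%N);
  last by rewrite /H /corner; congr seg; field.
rewrite (_ : seg n G (z + ci * L + L / 3) (L / 3) = H 1%N 3%N);
  last by rewrite /H /corner; congr seg; field.
rewrite (_ : seg n G (z + ci * L + 2 * (L / 3)) (L / 3) = H 2%N 3%N);
  last by rewrite /H /corner; congr seg; field.
rewrite (_ : seg n G z (ci * (L / 3)) = V 0%N 0%N); last by rewrite /V /corner; congr seg; field.
rewrite (_ : seg n G (z + ci * (L / 3)) (ci * (L / 3)) = V 0%N 1%N);
  last by rewrite /V /corner; congr seg; field.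
rewrite (_ : seg n G (z + 2 * (ci * (L / 3))) (ci * (L / 3)) = V 0%N 2%N);
  last by rewrite /V /corner; congr seg; field.
ring.
Qed.

Section Bisection.
Variables (G : C -> C) (z L : C) (e : R).
Hypothesis e_gt0 : 0 < e.
Hypothesis diffG : forall s t : R, 0 <= s <= 1 -> 0 <= t <= 1 ->
  exists d, cdiff G (z + (s%:C + ci * t%:C) * L) d.

Let pt (p : R * R) : C := z + (p.1%:C + ci * p.2%:C) * L.

(** Fine sums along the subsquare of generation [k] are at most [e] times its area. As areas add up,
    a square whose nine parts are good is good. *)
Let good k (p : R * R) := exists K, forall m, (K <= m)%N ->
  |[square (3 ^ m) G (pt p) (L / (3 ^ k)%:R)]| <= e * (|[L]| / (3 ^ k)%:R) ^+ 2.

Let sub k (p : R * R) (x y : nat) : R * R :=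
  (p.1 + x%:R / (3 ^ k.+1)%:R, p.2 + y%:R / (3 ^ k.+1)%:R).

Let pow3_gt0 k : 0 < (3 ^ k)%:R :> R. Proof. by rewrite ltr0n expn_gt0. Qed.

Let pow3_neq0 k : (3 ^ k)%:R != 0 :> C.
Proof. by rewrite pnatr_eq0 -lt0n expn_gt0. Qed.

Let good_sub k p : (forall x y : 'I_3, good k.+1 (sub k p x y)) -> good k p.
Proof.
move=> /= H; have [/= K hK] := choice (fun xy : 'I_3 * 'I_3 => H xy.1 xy.2).
exists (\sum_xy K xy).+1 => -[//|m]; rewrite ltnS => hm.
have Km xy : (K xy <= m)%N.
  by apply: leq_trans hm; rewrite (bigD1 xy)//= leq_addr.
rewrite (_ : (3 ^ m.+1 = 3 ^ m + 3 ^ m + 3 ^ m)%N); last by rewrite expnS; lia.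
rewrite square3 ?expn_gt0//.
apply: (@le_trans _ _ (\sum_(x < 3) \sum_(y < 3) (e * (|[L]| / (3 ^ k.+1)%:R) ^+ 2))).
  apply: le_trans (cnorm_sum _ _ _) _; apply: ler_sum => x _.
  apply: le_trans (cnorm_sum _ _ _) _; apply: ler_sum => y _.
  have E3 : L / (3 ^ k)%:R / 3 = L / (3 ^ k.+1)%:R.
    by rewrite expnS natrM; field; exact: pow3_neq0.
  rewrite E3 (_ : pt p + _ = pt (sub k p x y)); first exact: (hK (x, y) m (Km _)).
  rewrite -E3 /pt /sub /corner /= !rmorphD !rmorphM !fmorphV !rmorph_nat expnS natrM.
  by field; exact: pow3_neq0.
rewrite !big_ord_recr !big_ord0 /= expnS natrM le_eqVlt; apply/orP; left; apply/eqP; field.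
by rewrite gt_eqF.
Qed.

Let bad_seq : ~ good 0 (0, 0) -> exists p : nat -> R * R, p 0%N = (0, 0) /\
  forall k, ~ good k (p k) /\ exists x y : 'I_3, p k.+1 = sub k (p k) x y.
Proof.
move=> bad0.
have step (kp : nat * (R * R)) : exists q, ~ good kp.1 kp.2 ->
    ~ good kp.1.+1 q /\ exists x y : 'I_3, q = sub kp.1 kp.2 x y.
  (* The value at a good square is arbitrary: only bad squares are followed. *)
  have [g|b] := pselect (good kp.1 kp.2); first by exists (0, 0).
  apply: contrapT => /forallNP H; apply: b; apply: good_sub => x y.
  apply: contrapT => gxy; apply: (H (sub kp.1 kp.2 x y)) => _; split => //.
  by exists x, y.
have [g hg] := choice step.
pose p := fix p k := if k is j.+1 then g (j, p j) else (0, 0).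
have badp k : ~ good k (p k) by elim: k => [//|k IH]; have [] := hg (k, p k) IH.
by exists p; split=> // k; split=> //; have [] := hg (k, p k) (badp k).
Qed.

Lemma goursat_aux : good 0 (0, 0).
Proof.
apply: contrapT => /bad_seq[p [p0 hp]].
have lim1 (v : nat -> R) : (forall k, exists x : 'I_3, v k.+1 = v k + x%:R / (3 ^ k.+1)%:R) ->
    exists l, forall k, v k <= l <= v k + (3 ^ k)%:R^-1.
  move=> hv; have [|||l hl] := @nested_intervals R v (fun k => v k + (3 ^ k)%:R^-1).
  - by move=> k; have [x ->] := hv k; rewrite lerDl divr_ge0 ?ler0n.
  - move=> k; have [x ->] := hv k; rewrite expnS natrM.
    have P := pow3_gt0 k; have x2 : x%:R <= 2 :> R by rewrite ler_nat -ltnS.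
    rewrite -addrA lerD2l.
    rewrite (_ : _ + _ = (x%:R + 1) / 3 * (3 ^ k)%:R^-1); last by field; rewrite gt_eqF.
    by rewrite -[leRHS]mul1r ler_wpM2r ?invr_ge0 ?ler0n//; lra.
  - by move=> k; rewrite lerDl invr_ge0 ler0n.
  by exists l.
have [s hs] : exists l, forall k, (p k).1 <= l <= (p k).1 + (3 ^ k)%:R^-1.
  by apply: lim1 => k; have [_ [x [y ->]]] := hp k; exists x.
have [t ht] : exists l, forall k, (p k).2 <= l <= (p k).2 + (3 ^ k)%:R^-1.
  by apply: lim1 => k; have [_ [x [y ->]]] := hp k; exists y.
have := hs 0%N; have := ht 0%N; rewrite p0 /= expn0 invr1 add0r => t01 s01.
have [d hd] := diffG s01 t01; rewrite -[z + _]/(pt (s, t)) in hd.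
(* On a small square near the limit point, [G] differs from an affine function by at most [e / 8 *
   (2 * |[l]|)]; four sides of length [|[l]|] then give [e] times the area. *)
have e8 : 0 < e / 8 by rewrite divr_gt0.
have [r r0 hr] := hd _ e8.
have third : 0 <= (3^-1 : R) < 1 by rewrite invr_ge0 ler0n invf_lt1 ?ltr1n ?ltr0n.
have [k hk] := geo_small (2 * |[L]|) third r0.
have {}hk := hk k (leqnn _).
apply: (hp k).1; exists 0%N => m _.
pose l := L / (3 ^ k)%:R.
have nl : |[l]| = |[L]| / (3 ^ k)%:R by rewrite cnormM cnormV cnorm_nat.
have near w : on_square (pt (p k)) l w -> |[w - pt (s, t)]| <= 2 * |[l]|.
  move=> hw; have [a [b [a01 b01 ->]]] : exists a b : R, [/\ 0 <= a <= 1, 0 <= b <= 1 &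
      w = pt (p k) + (a%:C + ci * b%:C) * l].
    have O : 0 <= (0:R) <= 1 by lra.
    have I : 0 <= (1:R) <= 1 by lra.
    case: hw => -[a a01 ->].
    - by exists a, 0; split=> //; rewrite rmorph0; ring.
    - by exists 1, a; split=> //; rewrite rmorph1; ring.
    - by exists a, 1; split=> //; rewrite rmorph1; ring.
    - by exists 0, a; split=> //; rewrite rmorph0; ring.
  (* Coordinates relative to the limit point in units of the side; both lie between -1 and 1. *)
  pose u := ((p k).1 - s) * (3 ^ k)%:R + a; pose v := ((p k).2 - t) * (3 ^ k)%:R + b.
  have -> : pt (p k) + (a%:C + ci * b%:C) * l - pt (s, t) = (u%:C + ci * v%:C) * l.
    rewrite /u /v /pt /l /= !(rmorphD, rmorphB, rmorphM) /= !rmorph_nat; field; exact: pow3_neq0.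
  have P := pow3_gt0 k.
  have bnd (x y c : R) : x <= y <= x + (3 ^ k)%:R^-1 -> 0 <= c <= 1 ->
      `|(x - y) * (3 ^ k)%:R + c| <= 1.
    move=> /andP[h1 h2] /andP[h3 h4].
    have h5 : (x - y) * (3 ^ k)%:R <= 0 by rewrite mulr_le0_ge0 ?ler0n// subr_le0.
    have h6 : -1 <= (x - y) * (3 ^ k)%:R by rewrite -ler_pdivrMr//; lra.
    by rewrite ler_norml; lra.
  rewrite cnormM ler_wpM2r ?cnorm_ge0//; apply: le_trans (cnormD _ _) _.
  rewrite cnormM cnorm_ci mul1r !cnorm_real.
  by have := bnd _ _ _ (hs k) a01; have := bnd _ _ _ (ht k) b01; rewrite -/u -/v; lra.
pose A w := (G (pt (s, t)) - d * pt (s, t)) + d * w.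
have n0 : (0 < 3 ^ m)%N by rewrite expn_gt0.
have := @square_bound (3 ^ m) G A (pt (p k)) l (e / 8 * (2 * |[l]|)) n0.
rewrite square_affine// subr0 => H; apply: le_trans (H _) _; last first.
  by rewrite -nl -/l; set x := |[l]|; rewrite le_eqVlt; apply/orP; left; apply/eqP; field.
move=> w /near hw.
have hwr : |[w - pt (s, t)]| <= r.
  apply: le_trans hw _; apply: le_trans hk; rewrite nl -[leRHS]mulrA.
  by rewrite exprVn -natrX ler_pM2l// lexx.
have := hr _ hwr; rewrite [pt _ + _]addrC subrK => h.
rewrite (_ : _ - A w = G w - G (pt (s, t)) - d * (w - pt (s, t))); last by rewrite /A; ring.
by apply: le_trans h _; rewrite ler_wpM2l// divr_ge0// ltW.
Qed.

End Bisection.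

Lemma goursat G z L :
  (forall s t : R, 0 <= s <= 1 -> 0 <= t <= 1 ->
    exists d, cdiff G (z + (s%:C + ci * t%:C) * L) d) ->
  forall e : R, 0 < e ->
  exists K, forall k, (K <= k)%N -> |[square (3 ^ k) G z L]| <= e.
Proof.
move=> hG e e0; have L0 := cnorm_ge0 L.
(* Adding one avoids a division by zero when [L = 0]. *)
have Q0 : 0 < |[L]| ^+ 2 + 1 by rewrite ltr_wpDl// sqr_ge0.
have [|K hK] := @goursat_aux G z L (e / (|[L]| ^+ 2 + 1)) _ hG; first exact: divr_gt0.
exists K => k /hK; rewrite /= rmorph0 mulr0 add0r mul0r addr0 expn0 !divr1.
move/le_trans; apply; rewrite mulrAC ler_pdivrMr// ler_pM2l//; lra.
Qed.

End Goursat.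

(** * Cauchy's estimates *)

Section CauchyEstimate.
Variable R : realType.
Local Notation C := (R[i]).
Local Notation Re := (@complex.Re R).
Local Notation Im := (@complex.Im R).
Local Notation ci := (@ci R).
Implicit Types (G h : C -> C) (a z d L : C) (n k : nat).

(** First corner of the square of side [L] centred at [a]. *)
Definition qcorner a L : C := a - (1 + ci) * (L / 2).

Lemma square_scale n c G z L : square n (fun w => c * G w) z L = c * square n G z L.
Proof.
have E z' d : seg n (fun w => c * G w) z' d = c * seg n G z' d.
  by rewrite /seg mulr_sumr; apply: eq_bigr => i _; rewrite mulrCA.
by rewrite /square !E; ring.
Qed.

Lemma on_square_dist a L w : on_square (qcorner a L) L w ->
  |[L]| / 2 <= |[w - a]| <= |[L]|.
Proof.
have key (s t : R) : `|s| <= 1/2 -> `|t| <= 1/2 -> (`|s| = 1/2 \/ `|t| = 1/2) ->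
   |[L]| / 2 <= |[(s%:C + ci * t%:C) * L]| <= |[L]|.
  move=> hs ht st; have L0 := cnorm_ge0 L.
  have E : s%:C + ci * t%:C = s +i* t by rewrite [RHS]complexE.
  have h1 := cnorm_Re (s +i* t); have h2 := cnorm_Im (s +i* t); have h3 := cnorm_ReIm (s +i* t).
  rewrite E cnormM; apply/andP; split.
    rewrite mulrC ler_wpM2r//.
    by case: st => st; [apply: le_trans h1 | apply: le_trans h2] => /=; rewrite st; lra.
  by rewrite -[leRHS]mul1r ler_wpM2r//; apply: le_trans h3 _ => /=; lra.
have nh (x : R) : 0 <= x <= 1 -> `|x - 1 / 2| <= 1 / 2 by rewrite ler_norml; lra.
have n1 : `|1 / 2 : R| = 1 / 2 by rewrite ger0_norm; lra.
have n2 : `|- (1 / 2) : R| = 1 / 2 by rewrite normrN.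
have i2 := ci2 R.
case=> -[s s01 ->].
- rewrite (_ : _ - a = ((s - 1/2)%:C + ci * (- (1/2))%:C) * L).
    by apply: key; rewrite ?n2//; [exact: nh | right].
  by rewrite /qcorner !(rmorphB, rmorphN, rmorphM, fmorphV, rmorph1, rmorph_nat); field.
- rewrite (_ : _ - a = ((1/2)%:C + ci * (s - 1/2)%:C) * L).
    by apply: key; rewrite ?n1//; [exact: nh | left].
  by rewrite /qcorner !(rmorphB, rmorphN, rmorphM, fmorphV, rmorph1, rmorph_nat); field.
- rewrite (_ : _ - a = ((s - 1/2)%:C + ci * (1/2)%:C) * L).
    by apply: key; rewrite ?n1//; [exact: nh | right].
  by rewrite /qcorner !(rmorphB, rmorphN, rmorphM, fmorphV, rmorph1, rmorph_nat); field.
- rewrite (_ : _ - a = ((- (1/2))%:C + ci * (s - 1/2)%:C) * L).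
    by apply: key; rewrite ?n2//; [exact: nh | left].
  by rewrite /qcorner !(rmorphB, rmorphN, rmorphM, fmorphV, rmorph1, rmorph_nat); field.
Qed.

Lemma ImD (x y : C) : Im (x + y) = Im x + Im y.
Proof. by case: x y => [? ?] []. Qed.

Lemma Im_sum (I : Type) (r : seq I) (P : pred I) (F : I -> C) :
  Im (\sum_(i <- r | P i) F i) = \sum_(i <- r | P i) Im (F i).
Proof. by apply: (big_morph Im ImD). Qed.

(** The sign [t] treats the four sides at once: it records on which side of the segment [a] lies,
    and the orientation. The integral over one side has imaginary part [pi / 2]; the cruder bound 1
    holds term by term, because the squared distance from a node to [a] is at most half of that of
    [d]. *)
Lemma Im_seg_inv n a z d (t : R) : (0 < n)%N -> d != 0 -> `|t| = 1 ->
  z - a = d * (- (1 / 2) - ci * t%:C / 2) ->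
  1 <= Im (t%:C * seg n (fun w => (w - a)^-1) z d).
Proof.
move=> n0 d0 t1 hz; have nR : 0 < n%:R :> R by rewrite ltr0n.
rewrite /seg mulr_sumr Im_sum.
apply: (@le_trans _ _ (\sum_(i < n) (n%:R^-1 : R))).
  by rewrite sumr_const card_ord -[_ *+ n]mulr_natr mulVf// gt_eqF.
apply: ler_sum => i _.
set x : R := (2 * i + 1)%:R / (2 * n)%:R.
have x01 : 0 <= x <= 1.
  rewrite divr_ge0 ?ler0n//= ler_pdivrMr ?ltr0n ?muln_gt0// mul1r ler_nat.
  by have := ltn_ord i; lia.
have tt : t * t = 1 by have := congr1 (fun u => u ^+ 2) t1; rewrite real_normK ?num_real// expr1n.
have xC : (2 * i + 1)%:R / (2 * n)%:R = x%:C by rewrite /x rmorphM fmorphV !rmorph_nat.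
rewrite xC (_ : z + d * x%:C - a = d * ((x - 1 / 2) +i* (- (t / 2)))); last first.
  rewrite addrAC hz [_ +i* _]complexE /= !(rmorphB, rmorphN, rmorphM, fmorphV, rmorph1, rmorph_nat).
  by rewrite -/(ci); ring.
have q0 : 0 < (x - 1 / 2) ^+ 2 + (- (t / 2)) ^+ 2.
  by rewrite sqrrN exprMn expr2 [t ^+ 2]expr2 tt; nra.
rewrite (_ : _ * _ = (t / n%:R)%:C * ((x - 1 / 2) +i* (- (t / 2)))^-1); last first.
  have c0 : (x - 1 / 2) +i* (- (t / 2)) != 0.
    by rewrite eq_complex /= negb_and oppr_eq0 mulf_eq0 negb_or orbC -normr_eq0 t1 oner_eq0 invr_eq0 pnatr_eq0.
  rewrite rmorphM fmorphV rmorph_nat; field.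
  by rewrite c0 d0 pnatr_eq0 -lt0n n0.
have q2 : (x - 1 / 2) ^+ 2 + (- (t / 2)) ^+ 2 <= 1 / 2.
  by rewrite sqrrN exprMn expr2 [t ^+ 2]expr2 tt; nra.
rewrite /=; set q := (x - 1 / 2) ^+ 2 + _ in q0 q2 *.
rewrite (_ : _ + _ = n%:R^-1 * ((t * t) / 2 / q)); last by field; rewrite (gt_eqF q0) (gt_eqF nR).
by rewrite tt -[leLHS]mulr1 ler_pM2l ?invr_gt0// ler_pdivlMr//; lra.
Qed.

(** Substitute for the value [2 * pi * i] of the integral of [1 / (w - a)]: a lower bound on its
    modulus is enough to isolate a derivative. *)
Lemma square_inv_ge n a L : (0 < n)%N -> L != 0 ->
  4 <= |[square n (fun w => (w - a)^-1) (qcorner a L) L]|.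
Proof.
move=> n0 L0; have i2 := ci2 R.
have iL0 : ci * L != 0 by rewrite mulf_neq0// -cnorm_gt0 cnorm_ci.
have N1 : `|1 : R| = 1 by rewrite normr1.
have N2 : `|-1 : R| = 1 by rewrite normrN1.
apply: le_trans (le_trans (ler_norm _) (cnorm_Im _)).
rewrite /square.
have := @Im_seg_inv n a (qcorner a L) L 1 n0 L0 N1.
have := @Im_seg_inv n a (qcorner a L + L) (ci * L) 1 n0 iL0 N1.
have := @Im_seg_inv n a (qcorner a L + ci * L) L (-1) n0 L0 N2.
have := @Im_seg_inv n a (qcorner a L) (ci * L) (-1) n0 iL0 N2.
rewrite rmorphN1 rmorph1 !mulN1r !mul1r !ImD /qcorner.
move=> h1 h2 h3 h4.
suff : [/\ 1 <= Im (- seg n (fun w => (w - a)^-1) (qcorner a L) (ci * L)),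
  1 <= Im (- seg n (fun w => (w - a)^-1) (qcorner a L + ci * L) L),
  1 <= Im (seg n (fun w => (w - a)^-1) (qcorner a L + L) (ci * L)) &
  1 <= Im (seg n (fun w => (w - a)^-1) (qcorner a L) L)].
  by case; rewrite /qcorner; lra.
split; [apply: h1|apply: h2|apply: h3|apply: h4]; by field: i2.
Qed.

(** Goursat's lemma applies to the eight outer squares, which avoid [a]; the central one is the
    concentric square of side [L / 3]. *)
Lemma annulus_step G a L : (forall w, w != a -> exists d, cdiff G w d) -> L != 0 ->
  forall e : R, 0 < e -> exists K, forall k, (K <= k)%N ->
  |[square (3 ^ k.+1) G (qcorner a L) L - square (3 ^ k) G (qcorner a (L / 3)) (L / 3)]| <= e.
Proof.
move=> hG L0 e e0; have i2 := ci2 R.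
have e9 : 0 < e / 9 by rewrite divr_gt0.
pose c : 'I_3 := Ordinal (isT : (1 < 3)%N).
(* In grid coordinates [a] is the point [(3 / 2, 3 / 2)], which lies in no closed cell but the
   central one. *)
have side (x : 'I_3) (s : R) : 0 <= s <= 1 -> x%:R + s = 3 / 2 -> x = c.
  move=> s01; case: x => [[ | [ | [ | m ] ] ] xlt] /= E.
  - by exfalso; lra.
  - exact/val_inj.
  - by exfalso; lra.
  - by [].
have H (xy : 'I_3 * 'I_3) : exists K, xy != (c, c) -> forall k, (K <= k)%N ->
    |[square (3 ^ k) G (qcorner a L + corner R xy.1 xy.2 * (L / 3)) (L / 3)]| <= e / 9.
  case: xy => x y /=; have [_|ne] := eqVneq (x, y) (c, c); first by exists 0%N.
  have [|K hK] := @goursat R G (qcorner a L + corner R x y * (L / 3)) (L / 3) _ _ e9.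
    move=> s t s01 t01; apply: hG; apply: contra_neq ne => E.
    have {}E : ((x%:R + s - 3 / 2) +i* (y%:R + t - 3 / 2)) * (L / 3) = 0.
      rewrite [_ +i* _]complexE /= !(rmorphB, rmorphD, rmorphN, rmorphM, fmorphV, rmorph1, rmorph_nat).
      rewrite -[RHS](subrr a) -{1}E /qcorner /corner -/(ci); by field.
    move: E => /eqP; rewrite mulf_eq0 orbC mulf_eq0 (negPf L0) invr_eq0 pnatr_eq0 /=.
    rewrite eq_complex /= => /andP[/eqP/(canRL (subrK _)) E1 /eqP/(canRL (subrK _)) E2].
    by rewrite add0r in E1 E2; rewrite (side _ _ s01 E1) (side _ _ t01 E2).
  by exists K.
have [K hK] := choice H.
exists (\sum_xy K xy) => k hk.
have Kk xy : (K xy <= k)%N by apply: leq_trans hk; rewrite (bigD1 xy)//= leq_addr.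
rewrite (_ : (3 ^ k.+1 = 3 ^ k + 3 ^ k + 3 ^ k)%N); last by rewrite expnS; lia.
rewrite square3 ?expn_gt0// pair_big /= (bigD1 (c, c))//=.
rewrite (_ : qcorner a L + _ = qcorner a (L / 3)); last by rewrite /qcorner /corner; field.
rewrite addrAC subrr add0r; apply: le_trans (cnorm_sum _ _ _) _.
apply: (@le_trans _ _ (\sum_(xy : 'I_3 * 'I_3 | xy != (c, c)) (e / 9))).
  by apply: ler_sum => xy ne; exact: hK.
rewrite sumr_const -[_ *+ _]mulr_natr.
rewrite mulrAC ler_pdivrMr// ler_pM2l// ler_nat.
by rewrite (leq_trans (max_card _))// card_prod card_ord.
Qed.

Lemma annulus G a L j : (forall w, w != a -> exists d, cdiff G w d) -> L != 0 ->
  forall e : R, 0 < e -> exists K, forall k, (K <= k)%N ->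
  |[square (3 ^ (k + j)) G (qcorner a L) L -
    square (3 ^ k) G (qcorner a (L / (3 ^ j)%:R)) (L / (3 ^ j)%:R)]| <= e.
Proof.
move=> hG L0; elim: j => [|j IH] e e0.
  by exists 0%N => k _; rewrite addn0 expn0 divr1 subrr cnorm0 ltW.
have e2 : 0 < e / 2 by rewrite divr_gt0.
have n3 : (3 ^ j)%:R != 0 :> C by rewrite pnatr_eq0 -lt0n expn_gt0.
have Lj : L / (3 ^ j)%:R != 0 by rewrite mulf_neq0// invr_neq0.
have [K hK] := IH _ e2; have [K' hK'] := annulus_step hG Lj e2.
exists (maxn K K') => k; rewrite geq_max => /andP[h1 h2].
have E : L / (3 ^ j.+1)%:R = L / (3 ^ j)%:R / 3.
  by rewrite expnS natrM; field.
rewrite addnS -addSn E.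
apply: le_trans (cnorm_tri (square (3 ^ k.+1) G (qcorner a (L / (3 ^ j)%:R)) (L / (3 ^ j)%:R)) _ _) _.
have := hK k.+1 (leq_trans h1 (leqnSn _)); have := hK' _ h2; lra.
Qed.

(* The midpoint sums of [(h w - h a) / (w - a) ^ 2] along concentric squares agree in
   the limit: on a small square they are close to [d] times those of [1 / (w - a)]. *)
Theorem cauchy_deriv h a d (L M : R) : holo h -> cdiff h a d -> 0 < L ->
  (forall w, |[w - a]| <= L -> |[h w]| <= M) -> |[d]| <= 8 * M / L.
Proof.
move=> hh hd L0 hM.
pose G w := (h w - h a) * (w - a) ^- 2.
have hG w : w != a -> exists d, cdiff G w d.
  move=> wa; have [d' hd'] := hh w.
  have wa0 : w - a != 0 by rewrite subr_eq0.
  have h1 := cdiffB hd' (cdiff_cst (h a) w).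
  have h2 := cdiffB (cdiff_id w) (cdiff_cst a w).
  have h3 := cdiff_comp h2 (cdiff_inv wa0).
  have := cdiffM h1 (cdiffM h3 h3); eexists.
  rewrite (_ : G = fun x => (h x - h a) * ((x - a)^-1 * (x - a)^-1)); first by exact: H.
  by apply/funext => x; rewrite /G expr2 invfM.
have nL : |[L%:C]| = L by rewrite cnorm_real ger0_norm// ltW.
have LC : L%:C != 0 :> C by rewrite -cnorm_gt0 nL.
have M0 : 0 <= M by apply: le_trans (cnorm_ge0 (h a)) (hM _ _); rewrite subrr cnorm0 ltW.
suff H (e : R) : 0 < e -> |[d]| <= 8 * M / L + e.
  by apply/ler_addgt0Pr => e e0; exact: H.
move=> e0; have e4 : 0 < e / 4 by rewrite divr_gt0.
have [r r0 hr] := hd _ e4.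
have third : 0 <= (3^-1 : R) < 1 by rewrite invr_ge0 ler0n invf_lt1 ?ltr1n ?ltr0n.
have [j /(_ j (leqnn _)) hj] := geo_small L third r0.
have n3 : (3 ^ j)%:R != 0 :> C by rewrite pnatr_eq0 -lt0n expn_gt0.
pose l := L%:C / (3 ^ j)%:R.
have nl : |[l]| = L * 3^-1 ^+ j by rewrite cnormM nL cnormV cnorm_nat natrX exprVn.
have l0 : l != 0 by rewrite mulf_neq0// invr_neq0.
have lp : 0 < |[l]| by rewrite cnorm_gt0.
have [K hK] := annulus j hG LC e0.
have n0 m : (0 < 3 ^ m)%N by rewrite expn_gt0.
have B0 := hK _ (leqnn _); rewrite -/l in B0.
set S0 := square (3 ^ (K + j)) _ _ _ in B0; set S1 := square _ _ _ l in B0.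
(* On the large square [G] is at most [2 * M / (L / 2) ^ 2], and there are four sides of length
   [L]. *)
have B1 : |[S0]| <= 32 * M / L.
  have := @square_bound R (3 ^ (K + j)) G (fun=> 0 + 0 * 0) (qcorner a L%:C) L%:C (2 * M * (4 / L ^+ 2)) (n0 _).
  have := @square_affine R (3 ^ (K + j)) 0 0 (qcorner a L%:C) L%:C (n0 _).
  rewrite (_ : (fun w : C => 0 + 0 * w) = (fun=> 0 + 0 * 0));
    last by apply/funext => w; rewrite !mul0r.
  move=> ->; rewrite subr0 nL => H; apply: le_trans (H _) _; last first.
    by rewrite le_eqVlt; apply/orP; left; apply/eqP; field; rewrite gt_eqF.
  move=> w /on_square_dist; rewrite nL => /andP[w1 w2].
  rewrite mul0r addr0 subr0 cnormM cnormV cnormX; apply: ler_pM; rewrite ?cnorm_ge0 ?invr_ge0 ?exprn_ge0 ?cnorm_ge0//.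
    have := cnormB (h w) (h a); have := hM _ w2; have := hM a.
    by rewrite subrr cnorm0 => /(_ (ltW L0)); lra.
  rewrite (_ : 4 / L ^+ 2 = (L / 2) ^- 2); last by field; rewrite gt_eqF.
  have L2 : 0 < L / 2 by rewrite divr_gt0.
  by rewrite lef_pV2 ?posrE ?exprn_gt0//; [rewrite lerXn2r// nnegrE ?cnorm_ge0// ltW | apply: lt_le_trans w1].
(* Here [G] is within [e / 4 / |[w - a]|] of [d / (w - a)], and [|[w - a]|] is at least [|[l]| /
   2]. *)
have B2 : |[S1 - d * square (3 ^ K) (fun w => (w - a)^-1) (qcorner a l) l]| <= 2 * e.
  rewrite -square_scale; apply: le_trans (@square_bound R (3 ^ K) G (fun w => d * (w - a)^-1)
    (qcorner a l) l (e / 2 / |[l]|) (n0 _) _) _; last first.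
    by rewrite le_eqVlt; apply/orP; left; apply/eqP; field; rewrite gt_eqF.
  move=> w /on_square_dist/andP[w1 w2].
  have wr : |[w - a]| <= r by apply: le_trans w2 _; rewrite nl.
  have wp : 0 < |[w - a]| by lra.
  have wa : w - a != 0 by rewrite -cnorm_gt0.
  have := hr _ wr; rewrite [a + _]addrC subrK => H.
  rewrite (_ : _ - _ = (h w - h a - d * (w - a)) / (w - a) ^+ 2); last by rewrite /G; field.
  rewrite cnormM cnormV cnormX ler_pdivrMr ?exprn_gt0//; apply: le_trans H _.
  rewrite expr2 mulrA ler_pM2r// mulrAC ler_pdivlMr//.
  by have := ler_wpM2l (ltW e0) w1; lra.
have B3 := square_inv_ge a (n0 K) l0.
set S2 := square _ _ _ l in B2 B3.
have : 4 * |[d]| <= 32 * M / L + 3 * e.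
  apply: (@le_trans _ _ |[d * S2]|); first by rewrite cnormM mulrC ler_wpM2l ?cnorm_ge0.
  have := cnorm_le_sub (d * S2) S1; have := cnorm_le_sub S1 S0.
  rewrite [|[S1 - S0]|]cnormC [|[d * S2 - S1]|]cnormC; lra.
rewrite (_ : 32 * M / L = 4 * (8 * M / L)); last by field; rewrite gt_eqF.
by lra.
Qed.

End CauchyEstimate.

(** * Mean value inequality and Lipschitz bounds on discs *)

Section MeanValue.
Variable R : realType.
Local Notation C := (R[i]).
Implicit Types (h : C -> C).

(** Compactness of [[0, 1]] in the form of Cousin's lemma: bisecting intervals on which [P] fails
    closes in on a point near which [P] holds. *)
Lemma interval_induction (P : R -> R -> Prop) :
  (forall a m b, a <= m <= b -> P a m -> P m b -> P a b) ->
  (forall s, 0 <= s <= 1 -> exists2 r : R, 0 < r &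
    forall a b, 0 <= a -> b <= 1 -> a <= s <= b -> b - a <= r -> P a b) ->
  P 0 1.
Proof.
move=> Pcat Ploc; apply: contrapT => nP.
pose mid (ab : R * R) := (ab.1 + ab.2) / 2.
have step (ab : R * R) : exists cd : R * R, ab.1 <= ab.2 -> ~ P ab.1 ab.2 ->
    [/\ ~ P cd.1 cd.2, ab.1 <= cd.1, cd.2 <= ab.2 & cd.2 - cd.1 = (ab.2 - ab.1) / 2].
  have [P1|nP1] := pselect (P ab.1 (mid ab)).
    exists (mid ab, ab.2) => le12 nP12; split; rewrite /mid /=; [|lra..].
    by move=> P2; apply: nP12; apply: Pcat P1 P2; rewrite /mid; lra.
  by exists (ab.1, mid ab) => le12 nP12; split; rewrite // /mid /=; lra.
have [g hg] := choice step.
pose u n := iter n g (0, 1).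
have hu n : [/\ (u n).1 <= (u n).2, ~ P (u n).1 (u n).2 & (u n).2 - (u n).1 = 2^-1 ^+ n].
  elim: n => [|n [IH1 IH2 IH3]]; first by split=> //=; rewrite ?subr0 ?expr0.
  have [h1 h2 h3 h4] := hg _ IH1 IH2; rewrite -[g _]/(u n.+1) in h1 h2 h3 h4.
  by split=> //; [lra | rewrite exprS h4 IH3 mulrC].
have mono n : (u n).1 <= (u n.+1).1 /\ (u n.+1).2 <= (u n).2.
  by have [h1 h2 _] := hu n; have [_ h3 h4 _] := hg _ h1 h2; split.
have [|||s hs] := @nested_intervals R (fun n => (u n).1) (fun n => (u n).2).
- by move=> n; case: (mono n).
- by move=> n; case: (mono n).
- by move=> n; case: (hu n).
have [r r0 hr] := Ploc s (hs 0%N).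
have q01 : 0 <= (2^-1 : R) < 1 by lra.
have [n /(_ n (leqnn _))] := geo_small 1 q01 r0; rewrite mul1r => hn.
have u01 m : 0 <= (u m).1 /\ (u m).2 <= 1.
  by elim: m => [|m [IH1 IH2]]; [split | have [? ?] := mono m; split; lra].
have [_ + E] := hu n; apply; apply: hr (hs n) _; by [case: (u01 n) | rewrite E].
Qed.

Lemma mean_value h (z w : C) (D : R) :
  (forall s : R, 0 <= s <= 1 -> exists2 d, cdiff h (w + s%:C * (z - w)) d & |[d]| <= D) ->
  |[h z - h w]| <= D * |[z - w]|.
Proof.
move=> hD; set v := z - w in hD *; have v0 := cnorm_ge0 v.
suff H (e : R) : 0 < e -> |[h z - h w]| <= (D + e) * |[v]|.
  apply/ler_addgt0Pr => e e0; have v1 : 0 < |[v]| + 1 by lra.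
  apply: le_trans (H (e / (|[v]| + 1)) _) _; first by rewrite divr_gt0.
  rewrite mulrDl lerD2l mulrAC ler_pdivrMr//.
  by rewrite ler_pM2l//; lra.
move=> e0; pose p (s : R) := h (w + s%:C * v).
pose P (a b : R) := |[p b - p a]| <= (D + e) * |[v]| * (b - a).
have : P 0 1.
  apply: (@interval_induction P) => [a m b _|s s01].
    by rewrite /P => h1 h2; have := cnorm_tri (p m) (p b) (p a); lra.
  have [d hd dD] := hD s s01; have [r r0 hr] := hd e e0.
  have v1 : 0 < |[v]| + 1 by lra.
  exists (r / (|[v]| + 1)) => [|a b _ _ sab]; first by rewrite divr_gt0.
  rewrite ler_pdivlMr// => ab.
  have near x : `|x - s| <= b - a -> |[p x - p s]| <= (D + e) * |[v]| * `|x - s|.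
    move=> xs; have nv : |[(x - s)%:C * v]| = `|x - s| * |[v]| by rewrite cnormM cnorm_real.
    have H : |[(x - s)%:C * v]| <= r.
      by rewrite nv; apply: le_trans (ler_wpM2r v0 xs) _; lra.
    have {}H := hr _ H; rewrite nv in H.
    rewrite (_ : w + s%:C * v + _ = w + x%:C * v) in H; last by rewrite rmorphB; ring.
    have := cnorm_le_sub (p x - p s) (d * ((x - s)%:C * v)).
    rewrite cnormM nv; rewrite -/(p x) -/(p s) in H.
    have := ler_wpM2r (mulr_ge0 (normr_ge0 (x - s)) v0) dD.
    by lra.
  have /andP[s1 s2] := sab.
  have h1 := near a; rewrite ler0_norm ?subr_le0// in h1.
  have h2 := near b; rewrite ger0_norm ?subr_ge0// in h2.
  have {}h1 := h1 ltac:(lra); have {}h2 := h2 ltac:(lra).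
  rewrite /P; have := cnorm_tri (p s) (p b) (p a); rewrite [|[p s - _]|]cnormC; lra.
rewrite /P /p rmorph0 rmorph1 mul0r mul1r addr0 subr0 mulr1.
by rewrite (_ : w + v = z)// /v addrC subrK.
Qed.

(** Interval induction in one coordinate inside the other gives compactness of a square containing
    the disc; [w] parametrizes it by the unit square. *)
Lemma bounded_disc h (r : R) : holo h -> exists2 M : R, 0 <= M &
  forall z : C, |[z]| <= r -> |[h z]| <= M.
Proof.
move=> hh.
pose w (s t : R) : C := ((2 * s - 1) * r) +i* ((2 * t - 1) * r).
pose bdd (a b c d : R) := exists M : R, forall s t : R, a <= s <= b -> c <= t <= d ->
    |[h (w s t)]| <= M.
have cat (a b c m d : R) : bdd a b c m -> bdd a b m d -> bdd a b c d.
  move=> [M hM] [M' hM']; exists (Num.max M M') => s t hs /andP[t1 t2]; rewrite le_max.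
  have [tm|mt] := leP t m; first by rewrite hM// t1.
  by rewrite hM' ?orbT// (ltW mt).
have cat' (a m b c d : R) : bdd a m c d -> bdd m b c d -> bdd a b c d.
  move=> [M hM] [M' hM']; exists (Num.max M M') => s t /andP[s1 s2] ht; rewrite le_max.
  have [sm|ms] := leP s m; first by rewrite hM// s1.
  by rewrite hM' ?orbT// (ltW ms).
have strip (s : R) : exists2 e : R, 0 < e & bdd (s - e) (s + e) 0 1.
  apply: (@interval_induction (fun c d => exists2 e, 0 < e & bdd (s - e) (s + e) c d)).
    move=> c m d _ [e e0 [M hM]] [e' e'0 [M' hM']].
    exists (Num.min e e'); first by rewrite lt_min e0.
    apply: (@cat _ _ _ m); [exists M | exists M'] => x y /andP[x1 x2] hy.
      by apply: hM => //; have : Num.min e e' <= e by [rewrite ge_min lexx]; lra.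
    by apply: hM' => //; have : Num.min e e' <= e' by [rewrite ge_min lexx orbT]; lra.
  move=> t t01; have [d hd] := hh (w s t); have [e e0 he] := cdiff_cont hd ltr01.
  have r1 : 0 < 4 * (`|r| + 1) by have := normr_ge0 r; lra.
  have q0 : 0 < e / (4 * (`|r| + 1)) by rewrite divr_gt0.
  exists (e / (4 * (`|r| + 1))) => // c d' _ _ ctd cd.
  exists (e / (4 * (`|r| + 1))) => //.
  exists (|[h (w s t)]| + 1) => x y hx hy.
  have dist : |[w x y - w s t]| <= e.
    apply: le_trans (cnorm_ReIm _) _ => /=.
    have -> : (2 * x - 1) * r - (2 * s - 1) * r = 2 * (x - s) * r by ring.
    have -> : (2 * y - 1) * r - (2 * t - 1) * r = 2 * (y - t) * r by ring.
    rewrite !normrM (ger0_norm (_ : 0 <= 2))//.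
    have xs : `|x - s| <= e / (4 * (`|r| + 1)) by rewrite ler_norml; lra.
    have yt : `|y - t| <= e / (4 * (`|r| + 1)) by rewrite ler_norml; lra.
    have R0 := normr_ge0 r.
    have := ler_wpM2r R0 xs; have := ler_wpM2r R0 yt.
    set q := e / _ in q0 xs yt *.
    have E : q * (4 * (`|r| + 1)) = e by rewrite /q divfK// gt_eqF.
    by lra.
  have := he _ dist; rewrite [w s t + _]addrC subrK.
  by have := cnorm_le_sub (h (w x y)) (h (w s t)); lra.
have [M hM] : bdd 0 1 0 1.
  apply: (@interval_induction (fun a b => bdd a b 0 1)) => [a m b _|s _]; first exact: cat'.
  have [e e0 [M hM]] := strip s; exists e => // a b _ _ sab ab.
  by exists M => x y hx hy; apply: hM => //; lra.
exists (Num.max M 0) => [|z zr]; first by rewrite le_max lexx orbT.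
have [r0|r0] := leP r 0.
  have z0 : z = 0 by apply/eqP; rewrite -cnorm_eq0 eq_le cnorm_ge0 (le_trans zr).
  have rr : r = 0 by apply/eqP; rewrite eq_le r0 (le_trans (cnorm_ge0 z)).
  have := hM 0 0 ltac:(lra) ltac:(lra); rewrite /w rr !mulr0 z0 le_max => h0.
  by rewrite h0.
rewrite le_max (_ : z = w ((complex.Re z / r + 1) / 2) ((complex.Im z / r + 1) / 2)).
  have cl (x : R) : `|x| <= r -> 0 <= (x / r + 1) / 2 <= 1.
    rewrite ler_norml => /andP[x1 x2].
    have : -1 <= x / r by rewrite ler_pdivlMr//; lra.
    have : x / r <= 1 by rewrite ler_pdivrMr//; lra.
    by lra.
  by rewrite hM//; apply: cl; [apply: le_trans (cnorm_Re z) _ | apply: le_trans (cnorm_Im z) _].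
case: z {zr} => x y; rewrite /w /=; congr (_ +i* _); field; exact: lt0r_neq0.
Qed.

(** Discs of radius [L / 2] around points of the segment stay in the disc of radius [L], whence the
    constant [8 * M / (L / 2)]. *)
Lemma cauchy_lip h (a z w : C) (L M : R) : holo h -> 0 < L ->
  (forall x, |[x - a]| <= L -> |[h x]| <= M) ->
  |[z - a]| <= L / 2 -> |[w - a]| <= L / 2 ->
  |[h z - h w]| <= 16 * M / L * |[z - w]|.
Proof.
move=> hh L0 hM za wa; apply: mean_value => s /andP[s0 s1].
have [d hd] := hh (w + s%:C * (z - w)); exists d => //.
rewrite (_ : 16 * M / L = 8 * M / (L / 2)); last by field; rewrite gt_eqF.
apply: cauchy_deriv hh hd _ _; first by rewrite divr_gt0.
move=> x hx; apply: hM.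
rewrite (_ : x - a = (x - (w + s%:C * (z - w))) + (s%:C * (z - a) + (1 - s)%:C * (w - a))); last first.
  by rewrite rmorphB rmorph1; ring.
apply: le_trans (cnormD _ _) _; apply: le_trans (lerD hx (cnormD _ _)) _.
rewrite !cnormM !cnorm_real !ger0_norm; [|lra..].
have s1' : 0 <= 1 - s by lra.
have := ler_wpM2l s0 za; have := ler_wpM2l s1' wa; lra.
Qed.

Lemma holo_lip h (r : R) : holo h -> exists2 K : R, 0 <= K &
  forall z w : C, |[z]| <= r -> |[w]| <= r -> |[h z - h w]| <= K * |[z - w]|.
Proof.
move=> hh; have [r0|r0] := ltP r 0.
  by exists 0 => // z w /(le_trans (cnorm_ge0 z))/le_lt_trans/(_ r0); rewrite ltxx.
have [M M0 hM] := bounded_disc (2 * (r + 1)) hh.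
have r1 : 0 < 2 * (r + 1) by lra.
exists (16 * M / (2 * (r + 1))) => [|z w zr wr].
  by rewrite divr_ge0 ?(ltW r1)// mulr_ge0.
have D x : |[x]| <= r -> |[x - 0]| <= 2 * (r + 1) / 2 by rewrite subr0; lra.
apply: (cauchy_lip hh r1 _ (D z zr)) (D w wr) => x.
by rewrite subr0; exact: hM.
Qed.

End MeanValue.

(** * Orbits and local stable manifolds *)

Section Orbits.
Variable R : realType.
Local Notation C := (R[i]).
Variable delta : C.
Implicit Types (f g : C -> C) (z y b : nat -> C) (a c t x w : C).

(* The sequence [z] encodes the orbit of the point [(z 1, z 0)]: its [n]-th
   iterate under the map [henon delta f] is [(z n.+1, z n)]. *)
Definition horbit f z := forall n, z n.+2 = f (z n.+1) - delta * z n.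

Definition tends z x := forall e : R, 0 < e ->
  exists N, forall n, (N <= n)%N -> |[z n - x]| <= e.

Definition prepend x z : nat -> C := fun n => if n is m.+1 then z m else x.

Definition back f z : nat -> C := prepend ((f (z 0%N) - z 1%N) / delta) z.

Definition gap t (kap : R) : R := |[t]| - 1 - |[delta]| - kap.

(* A map with a saddle fixed point near [c], of multipliers close to the roots of
   [X ^ 2 - t X + delta]; the condition [0 < gap t kap] below makes
   [z n = (z n.+1 + delta * z n.-1 - (f (z n) - t * z n)) / t] contracting. *)
Definition good c (eta : R) t (kap : R) f :=
  (forall x w, |[x - c]| <= eta -> |[w - c]| <= eta ->
     |[(f x - t * x) - (f w - t * w)]| <= kap * |[x - w]|) /\
  |[f c - (1 + delta) * c]| <= gap t kap * (eta / 4).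

Definition close (r e : R) f g := forall x, |[x]| <= r -> |[g x - f x]| <= e.

Hypothesis delta_gt1 : 1 < |[delta]|.

Lemma delta_neq0 : delta != 0. Proof. by rewrite -cnorm_gt0; have := delta_gt1; lra. Qed.

Lemma orbit_shift f z k : horbit f z -> horbit f (fun n => z (n + k)%N).
Proof. by move=> hz n; exact: hz. Qed.

Lemma orbit_back f z : horbit f z -> horbit f (back f z).
Proof.
move=> hz [|n] /=; last exact: hz.
by rewrite mulrCA divff ?delta_neq0// mulr1 subKr.
Qed.

(** Reads an orbit backwards from time 1: with [x0 = z 1] and [x1 = z 0], this is the term of index
    [1 - k]. *)
Fixpoint backward f x0 x1 k : C :=
  if k is k1.+1 then
    if k1 is k2.+1 then (f (backward f x0 x1 k1) - backward f x0 x1 k2) / delta else x1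
  else x0.

Lemma backwardS f x0 x1 k :
  backward f x0 x1 k.+2 = (f (backward f x0 x1 k.+1) - backward f x0 x1 k) / delta.
Proof. by []. Qed.

Lemma iter_back f z k :
  [/\ iter k (back f) z 0%N = backward f (z 1%N) (z 0%N) k.+1,
      iter k (back f) z 1%N = backward f (z 1%N) (z 0%N) k &
      forall n, iter k (back f) z (n + k)%N = z n].
Proof.
elim: k => [|k [IH0 IH1 IHn]]; first by split=> // n; rewrite addn0.
split=> [||n]; first by rewrite iterS /= IH0 IH1.
  by rewrite iterS /= IH0.
by rewrite iterS addnS /= IHn.
Qed.

Section LocalStableManifold.
Variables (c t : C) (eta kap : R).
Hypotheses (eta_gt0 : 0 < eta) (kap_ge0 : 0 <= kap) (gap_gt0 : 0 < gap t kap).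
Local Notation good := (good c eta t kap).
Local Notation in_disc x := (|[x - c]| <= eta).

Let t_gt : 1 + |[delta]| + kap < |[t]|.
Proof. by have := gap_gt0; rewrite /gap; lra. Qed.

Let t_gt0 : 0 < |[t]|. Proof. by have := t_gt; have := kap_ge0; have := cnorm_ge0 delta; lra. Qed.

Ltac slra := have := t_gt0; have := kap_ge0; have := t_gt; have := eta_gt0;
  have := cnorm_ge0 delta; lra.

Let t_neq0 : t != 0. Proof. by rewrite -cnorm_gt0. Qed.

(** Contraction factor of the recurrence when solved for its middle term. *)
Let q : R := (1 + |[delta]| + kap) / |[t]|.

Let q01 : 0 <= q < 1.
Proof.
rewrite divr_ge0 ?(ltW t_gt0)//=; last by have := cnorm_ge0 delta; slra.
by rewrite ltr_pdivrMr// mul1r.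
Qed.

(** Discrete maximum principle: each use of the recurrence shrinks the excess over [A] by the factor
    [q], so the a priori bound [B] disappears in the limit and only the initial value and the
    forcing term [e] remain. *)
Lemma contraction_bound (d : nat -> R) (A B e : R) :
  (forall n, |[t]| * d n.+1 <= d n.+2 + |[delta]| * d n + kap * d n.+1 + e) ->
  (forall n, d n <= B) -> 0 <= B -> d 0%N <= A -> e <= A * gap t kap -> 0 <= A ->
  forall n, d n <= A.
Proof.
move=> hd hB B0 dA eA A0 n.
have H m : forall k, d k <= A + B * q ^+ m.
  elim: m => [|m IH] [|k]; rewrite ?expr0 ?mulr1.
  - by slra.
  - by have := hB k.+1; slra.
  - by have : 0 <= B * q ^+ m.+1 by [rewrite mulr_ge0// exprn_ge0//; case/andP: q01]; slra.
  rewrite -(ler_pM2l t_gt0); apply: le_trans (hd k) _.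
  rewrite exprS mulrDr [|[t]| * (B * _)]mulrCA [|[t]| * (_ * _)]mulrA /q [|[t]| * (_ / _)]mulrC divfK ?gt_eqF//.
  move: eA; rewrite /gap; have := IH k; have := IH k.+1; have := IH k.+2.
  set S := A + _ => h2 h1 h0 eA.
  have := ler_wpM2l (cnorm_ge0 delta) h0; have := ler_wpM2l kap_ge0 h1.
  rewrite [B * (_ * _)]mulrCA (_ : B * _ = S - A); last by rewrite /S; ring.
  by slra.
apply/ler_addgt0Pr => e0 e00.
have [m /(_ m (leqnn _)) hm] := geo_small B q01 e00.
by have := H m n; slra.
Qed.

(** The estimate at [n.+1] uses the one at [n], so one index is lost for each factor [q] gained. *)
Lemma contraction_decay (d : nat -> R) (B : R) :
  (forall n, |[t]| * d n.+1 <= d n.+2 + |[delta]| * d n + kap * d n.+1) ->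
  (forall n, d n <= B) -> forall m n, (m <= n)%N -> d n <= B * q ^+ m.
Proof.
move=> hd hB; elim=> [|m IH] [|n]; rewrite ?expr0 ?mulr1// => mn.
rewrite -(ler_pM2l t_gt0); apply: le_trans (hd n) _.
rewrite exprS mulrCA [|[t]| * (_ * _)]mulrA /q [|[t]| * (_ / _)]mulrC divfK ?gt_eqF//.
have h0 := IH n mn; have h1 := IH n.+1 (leqW mn); have h2 := IH n.+2 (leqW (leqW mn)).
have := ler_wpM2l (cnorm_ge0 delta) h0; have := ler_wpM2l kap_ge0 h1.
rewrite ?[B * (_ * _)]mulrCA; set S := B * _ in h0 h1 h2 *; slra.
Qed.

Lemma orbit_diff f g z y (e : R) : good g -> horbit f z -> horbit g y ->
  (forall n, in_disc (z n)) -> (forall n, in_disc (y n)) ->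
  (forall x, in_disc x -> |[g x - f x]| <= e) ->
  forall n, |[t]| * |[y n.+1 - z n.+1]| <=
    |[y n.+2 - z n.+2]| + |[delta]| * |[y n - z n]| + kap * |[y n.+1 - z n.+1]| + e.
Proof.
move=> [hg _] hz hy zc yc fg n; rewrite -!cnormM.
set G := fun x => g x - t * x.
have -> : t * (y n.+1 - z n.+1) = (y n.+2 - z n.+2) + delta * (y n - z n)
   - (G (y n.+1) - G (z n.+1)) - (g (z n.+1) - f (z n.+1)).
  by rewrite hz hy /G; ring.
apply: le_trans (cnormB _ _) _; apply: lerD; last exact: fg.
apply: le_trans (cnormB _ _) _; apply: lerD; last exact: hg.
exact: cnormD.
Qed.

(** No error accumulates with time: an orbit confined to the disc solves a boundary value problem
    determined by its first term, and this problem is stable under perturbation. *)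
Lemma orbit_close f g z y (e : R) : good g -> horbit f z -> horbit g y ->
  (forall n, in_disc (z n)) -> (forall n, in_disc (y n)) ->
  (forall x, in_disc x -> |[g x - f x]| <= e) -> y 0%N = z 0%N ->
  forall n, |[y n - z n]| <= e / gap t kap.
Proof.
move=> hg hz hy zc yc fg yz0.
have e0 : 0 <= e by apply: le_trans (cnorm_ge0 _) (fg c _); rewrite subrr cnorm0 ltW.
apply: (@contraction_bound (fun n => |[y n - z n]|) _ (2 * eta) e).
- exact: orbit_diff fg.
- by move=> n; have := cnorm_tri c (y n) (z n); rewrite [|[c - _]|]cnormC; have := zc n;
  have := yc n; slra.
- by rewrite mulr_ge0// ltW.
- by rewrite yz0 subrr cnorm0 divr_ge0// ltW.
- by rewrite divfK ?gt_eqF.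
- by rewrite divr_ge0// ltW.
Qed.

(** Each round solves the recurrence for its middle term, which puts the large multiplier [t] in the
    denominator, under the boundary condition that the term at 0 is [a]. The initial guess is the
    constant [c] elsewhere. *)
Fixpoint picard f a m : nat -> C :=
  if m is m'.+1 then fun n => if n is n'.+1 then
    (picard f a m' n'.+2 + delta * picard f a m' n' - (f (picard f a m' n'.+1) - t * picard f a m' n'.+1)) / t
    else a
  else fun n => if n is 0%N then a else c.

Lemma picard_disc f a m n : good f -> in_disc a -> in_disc (picard f a m n).
Proof.
move=> [hf hc] ha; elim: m n => [|m IH] [|n] //=; first by rewrite subrr cnorm0 ltW.
have cc : in_disc c by rewrite subrr cnorm0 ltW.
set u := picard f a m in IH *.
rewrite -(ler_pM2l t_gt0) -cnormM mulrBr [t * (_ / _)]mulrC divfK//.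
have -> : u n.+2 + delta * u n - (f (u n.+1) - t * u n.+1) - t * c =
   (u n.+2 - c) + delta * (u n - c) - ((f (u n.+1) - t * u n.+1) - (f c - t * c)) - (f c - (1 +
       delta) * c) by ring.
apply: le_trans (cnormB _ _) _; apply: le_trans (lerD (cnormB _ _) hc) _.
have := hf (u n.+1) c (IH _) cc; have := ler_wpM2l kap_ge0 (IH n.+1).
have := cnormD (u n.+2 - c) (delta * (u n - c)); rewrite cnormM.
have := ler_wpM2l (cnorm_ge0 delta) (IH n); have := IH n.+2.
have := mulr_ge0 (ltW gap_gt0) (ltW eta_gt0); rewrite /gap; slra.
Qed.

Lemma picard_step f a m n : good f -> in_disc a ->
  |[picard f a m.+1 n - picard f a m n]| <= 2 * eta * q ^+ m.
Proof.
move=> gf ha; elim: m n => [|m IH] n.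
  rewrite expr0 mulr1; have := picard_disc 0 n gf ha; have := picard_disc 1 n gf ha.
  by have := cnorm_tri c (picard f a 1 n) (picard f a 0 n); rewrite [|[c - _]|]cnormC; slra.
have [hf _] := gf.
case: n => [|n].
  rewrite /= subrr cnorm0 !mulr_ge0 ?exprn_ge0// ?(ltW eta_gt0)//; by case/andP: q01.
have hv k := picard_disc m.+1 k gf ha; have hu k := picard_disc m k gf ha.
rewrite -[picard f a m.+2 n.+1]/((picard f a m.+1 n.+2 + delta * picard f a m.+1 n
  - (f (picard f a m.+1 n.+1) - t * picard f a m.+1 n.+1)) / t).
rewrite -[picard f a m.+1 n.+1 in X in _ - X]/((picard f a m n.+2 + delta * picard f a m n
  - (f (picard f a m n.+1) - t * picard f a m n.+1)) / t).
set v := picard f a m.+1 in IH hv *; set u := picard f a m in IH hu *.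
rewrite -mulrBl cnormM cnormV ler_pdivrMr//.
have -> : v n.+2 + delta * v n - (f (v n.+1) - t * v n.+1) - (u n.+2 + delta * u n - (f (u n.+1) - t * u n.+1))
  = (v n.+2 - u n.+2) + delta * (v n - u n) - ((f (v n.+1) - t * v n.+1) - (f (u n.+1) - t * u n.+1)) by ring.
have -> : 2 * eta * q ^+ m.+1 * |[t]| = (1 + |[delta]| + kap) * (2 * eta * q ^+ m).
  by rewrite exprS; set Q := q ^+ m; rewrite /q; field; rewrite gt_eqF.
have := hf _ _ (hv n.+1) (hu n.+1).
have := cnormB ((v n.+2 - u n.+2) + delta * (v n - u n)) ((f (v n.+1) - t * v n.+1) - (f (u n.+1) - t * u n.+1)).
have := cnormD (v n.+2 - u n.+2) (delta * (v n - u n)); rewrite cnormM.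
have := ler_wpM2l (cnorm_ge0 delta) (IH n); have := ler_wpM2l kap_ge0 (IH n.+1); have := IH n.+2.
by slra.
Qed.

(** The approximation clause is exported because [picard f a m n] is holomorphic in [a]: uniform
    approximation stands in for holomorphic dependence of [u a] on [a]. *)
Lemma local_stable f : holo f -> good f -> exists u : C -> nat -> C, forall a, in_disc a ->
  [/\ u a 0%N = a, horbit f (u a), forall n, in_disc (u a n) &
      forall m n, |[picard f a m n - u a n]| <= 2 * (2 * eta / (1 - q)) * q ^+ m].
Proof.
move=> hf gf.
have H (an : C * nat) : exists l, in_disc an.1 ->
    forall m, |[picard f an.1 m an.2 - l]| <= 2 * (2 * eta / (1 - q)) * q ^+ m.
  case: an => a n /=; have [ha|nha] := pselect (in_disc a); last by exists 0.
  have [l hl] := geo_lim q01 (fun m => @picard_step f a m n gf ha).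
  by exists l.
have [u hu] := choice H; exists (fun a n => u (a, n)) => a ha.
have lim m n := hu (a, n) ha m; rewrite /= in lim.
set K := 2 * (2 * eta / (1 - q)) in lim.
have small (e : R) : 0 < e ->
    exists m, forall n, |[picard f a m.+1 n - u (a, n)]| <= e /\ |[picard f a m n - u (a, n)]| <= e.
  move=> e0; have [m hm] := geo_small K q01 e0; exists m => n.
  by split; [apply: le_trans (lim _ _) (hm _ (leqnSn _)) | apply: le_trans (lim _ _) (hm _ (leqnn _))].
have disc n : in_disc (u (a, n)).
  apply/ler_addgt0Pr => e e0; have [m /(_ n)[_ hm]] := small e e0.
  by have := picard_disc m n gf ha;
    have := cnorm_tri (picard f a m n) (u (a, n)) c; rewrite [|[u _ - picard _ _ _ _]|]cnormC; slra.
split=> //.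
- apply/eqP; rewrite -subr_eq0 -cnorm_eq0 eq_le cnorm_ge0 andbT.
  apply/ler_addgt0Pr => e e0; rewrite add0r; have [m /(_ 0%N)[hm _]] := small e e0.
  by rewrite cnormC.
- move=> n; apply/eqP; rewrite -subr_eq0 -cnorm_eq0 eq_le cnorm_ge0 andbT.
  apply/ler_addgt0Pr => e e0; rewrite add0r.
  set S := |[t]| + 1 + |[delta]| + kap.
  have S0 : 0 < S by rewrite /S; have := t_gt; have := cnorm_ge0 delta; slra.
  have [m hm] := small _ (divr_gt0 e0 S0).
  have E : t * picard f a m.+1 n.+1 = picard f a m n.+2 +
      delta * picard f a m n - (f (picard f a m n.+1) - t * picard f a m n.+1).
    by rewrite /= mulrC divfK.
  have [h1 _] := hm n.+1; have [_ h1'] := hm n.+1; have [_ h2] := hm n.+2; have [_ h0] := hm n.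
  set v := picard f a m.+1 in E h1; set p := picard f a m in E h0 h1' h2.
  have -> : u (a, n.+2) - (f (u (a, n.+1)) - delta * u (a, n)) =
    t * (v n.+1 - u (a, n.+1)) - (p n.+2 - u (a, n.+2)) - delta * (p n - u (a, n))
     + ((f (p n.+1) - t * p n.+1) - (f (u (a, n.+1)) - t * u (a, n.+1))).
    by rewrite mulrBr E; ring.
  have := gf.1 _ _ (picard_disc m n.+1 gf ha) (disc n.+1) => hk.
  apply: le_trans (cnormD _ _) _; apply: le_trans (lerD (cnormB _ _) hk) _.
  have := cnormB (t * (v n.+1 - u (a, n.+1))) (p n.+2 - u (a, n.+2)); rewrite !cnormM.
  have := ler_wpM2l (cnorm_ge0 delta) h0; have := ler_wpM2l kap_ge0 h1';
    have := ler_wpM2l (ltW t_gt0) h1.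
  have : e / S * S = e by rewrite divfK ?gt_eqF.
  by rewrite -/(p n.+1); set eS := e / S in h0 h1 h1' h2 *; rewrite /S; slra.
Qed.

(** The stable orbit of [c] has geometrically decreasing increments, so it converges, and its limit
    is fixed. The radius [eta / 4] comes from the second clause of [good] and leaves room around the
    fixed point for Cauchy's estimates. *)
Lemma fixed_point f : holo f -> good f ->
  exists2 p, p = f p - delta * p & |[p - c]| <= eta / 4.
Proof.
move=> hf gf; have cc : in_disc c by rewrite subrr cnorm0 ltW.
have [u hu] := local_stable hf gf; have [_ zo zc _] := hu c cc; set z := u c in zo zc.
have hd n : |[t]| * |[z n.+2 - z n.+1]| <=
    |[z n.+3 - z n.+2]| + |[delta]| * |[z n.+1 - z n]| + kap * |[z n.+2 - z n.+1]|.
  rewrite -[leRHS]addr0.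
  have zo' : horbit f (fun n => z n.+1) by move=> k; exact: zo.
  apply: (@orbit_diff f f z (fun n => z n.+1) 0 gf zo zo') => //.
  by move=> x _; rewrite subrr cnorm0.
have hB n : |[z n.+1 - z n]| <= 2 * eta.
  by have := cnorm_tri c (z n.+1) (z n); rewrite [|[c - _]|]cnormC; have := zc n;
    have := zc n.+1; slra.
have [p hp] := geo_lim q01 (fun n => contraction_decay hd hB (leqnn n)).
set K := 2 * _ in hp.
have pc : in_disc p.
  apply/ler_addgt0Pr => e e0; have [m /(_ m (leqnn _)) hm] := geo_small K q01 e0.
  by have := hp m; have := cnorm_tri (z m) p c; rewrite [|[p - z _]|]cnormC; have := zc m; slra.
have fp : p = f p - delta * p.
  apply/eqP; rewrite -subr_eq0 -cnorm_eq0 eq_le cnorm_ge0 andbT.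
  apply/ler_addgt0Pr => e e0; rewrite add0r.
  set S := |[t]| + 1 + |[delta]| + kap.
  have S0 : 0 < S by rewrite /S; slra.
  have [m hm] := geo_small K q01 (divr_gt0 e0 S0).
  have h0 := le_trans (hp m) (hm _ (leqnn _)).
  have h1 := le_trans (hp m.+1) (hm _ (leqnSn _)).
  have h2 := le_trans (hp m.+2) (hm _ (leqW (leqnSn _))).
  have hk := gf.1 _ _ (zc m.+1) pc.
  have -> : p - (f p - delta * p) = - (z m.+2 - p) - delta * (z m - p) +
     t * (z m.+1 - p) + ((f (z m.+1) - t * z m.+1) - (f p - t * p)) by rewrite zo; ring.
  apply: le_trans (cnormD _ _) _; apply: le_trans (lerD (cnormD _ _) hk) _.
  have := cnormB (- (z m.+2 - p)) (delta * (z m - p)); rewrite cnormN !cnormM.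
  have := ler_wpM2l (cnorm_ge0 delta) h0; have := ler_wpM2l kap_ge0 h1;
    have := ler_wpM2l (ltW t_gt0) h1.
  have : e / S * S = e by rewrite divfK ?gt_eqF.
  by set eS := e / S in h0 h1 h2 *; rewrite {1}/S; slra.
exists p => //; rewrite -(ler_pM2l gap_gt0); apply: le_trans gf.2.
have := gf.1 _ _ pc cc.
have : |[t * (p - c)]| <= |[(1 + delta) * (p - c)]| + |[(f p - t * p) - (f c - t * c)]| +
    |[f c - (1 + delta) * c]|.
  have -> : t * (p - c) = (1 + delta) * (p - c) - ((f p - t * p) - (f c - t * c)) - (f c - (1 + delta) * c).
    have fp' : f p = p + delta * p by rewrite [X in X + _]fp subrK.
    by rewrite fp'; ring.
  by apply: le_trans (cnormB _ _) _; rewrite lerD2r; exact: cnormB.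
rewrite !cnormM; have := ler_wpM2r (cnorm_ge0 (p - c)) (cnormD 1 delta); rewrite cnorm1.
by rewrite /gap; slra.
Qed.

Section FixedPoint.
Variables (f : C -> C) (p : C) (z : nat -> C).
Hypotheses (gf : good f) (fp : p = f p - delta * p) (pc : in_disc p).
Hypotheses (zo : horbit f z) (zc : forall n, in_disc (z n)).

Let orbit_fixed_diff n : |[t]| * |[z n.+1 - p]| <=
  |[z n.+2 - p]| + |[delta]| * |[z n - p]| + kap * |[z n.+1 - p]|.
Proof.
rewrite -[leRHS]addr0; apply: (@orbit_diff f f (fun=> p) z 0 gf) => //.
by move=> x _; rewrite subrr cnorm0.
Qed.

Let orbit_fixed_bound n : |[z n - p]| <= 2 * eta.
Proof.
have := cnorm_tri c (z n) p; rewrite [|[c - _]|]cnormC; have := zc n; have := pc; slra.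
Qed.

Lemma orbit_fixed_le n : |[z n - p]| <= |[z 0%N - p]|.
Proof.
apply: (@contraction_bound (fun n => |[z n - p]|) _ (2 * eta) 0) => //.
- by move=> k; rewrite addr0.
- by rewrite mulr_ge0// ltW.
- by rewrite mulr_ge0 ?cnorm_ge0// ltW.
- exact: cnorm_ge0.
Qed.

Lemma orbit_tends : tends z p.
Proof.
move=> e e0; have [N hN] := geo_small (2 * eta) q01 e0.
exists N => n Nn; apply: le_trans (hN _ Nn).
exact: (contraction_decay orbit_fixed_diff orbit_fixed_bound).
Qed.

End FixedPoint.

Lemma backward_fixed f p k : p = f p - delta * p -> backward f p p k = p.
Proof.
move=> fp; suff H : backward f p p k = p /\ backward f p p k.+1 = p by case: H.
elim: k => [//|k [IH0 IH1]]; split=> //; rewrite backwardS IH0 IH1.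
have -> : f p - p = p * delta by rewrite [X in _ - X]fp subKr mulrC.
by rewrite mulfK// delta_neq0.
Qed.

Lemma holo_picard f m n : holo f -> holo (fun a => picard f a m n).
Proof.
move=> hf; elim: m n => [|m IH] [|n]; [exact: holo_id|exact: holo_cst|exact: holo_id|].
apply: holoM (holo_cst _); apply: holoB.
  by apply: holoD (IH _) (holoM (holo_cst _) (IH _)).
by apply: holoB (holo_comp (IH _) hf) (holoM (holo_cst _) (IH _)).
Qed.

Lemma holo_backward f (x0 : C -> C) k : holo f -> holo x0 -> holo (fun a => backward f (x0 a) a k).
Proof.
move=> hf hx; suff [] : holo (fun a => backward f (x0 a) a k) /\ holo (fun a =>
    backward f (x0 a) a k.+1) by [].
elim: k => [|k [IH0 IH1]]; first by split=> //; exact: holo_id.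
split=> //; apply: holoM (holo_cst _); apply: holoB IH0.
exact: holo_comp IH1 hf.
Qed.

(** Provides holomorphic functions of [a] that are uniformly near the [k]-th backward term, so that
    Cauchy's estimates can be applied to it. *)
Lemma backward_picard f (u : C -> nat -> C) (M : R) : holo f -> good f ->
  (forall a, in_disc a ->
  [/\ u a 0%N = a, horbit f (u a), forall n, in_disc (u a n) &
      forall m n, |[picard f a m n - u a n]| <= 2 * (2 * eta / (1 - q)) * q ^+ m]) ->
  (forall a k, in_disc a -> |[backward f (u a 1%N) a k.+1]| <= M) ->
  forall k (e : R), 0 < e -> exists N, forall m, (N <= m)%N -> forall a, in_disc a ->
    |[backward f (picard f a m 1%N) a k - backward f (u a 1%N) a k]| <= e.
Proof.
move=> hf gf hu hM k.
pose P k := forall (e : R), 0 < e -> exists N, forall m, (N <= m)%N -> forall a, in_disc a ->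
    |[backward f (picard f a m 1%N) a k - backward f (u a 1%N) a k]| <= e.
suff [] : P k /\ P k.+1 by [].
elim: k => [|k [IH0 IH1]].
  split=> e e0; last by exists 0%N => m _ a _ /=; rewrite subrr cnorm0 ltW.
  have [N hN] := geo_small (2 * (2 * eta / (1 - q))) q01 e0.
  exists N => m Nm a ha; have [_ _ _ H] := hu a ha.
  exact: le_trans (H m 1%N) (hN _ Nm).
split=> // e e0.
have [K K0 hK] := holo_lip (M + 1) hf.
have K1 : 0 < K + 1 by slra.
(* The minimum with 1 keeps the approximations in the disc of radius [M + 1], where [hK] applies. *)
have e1 : 0 < Num.min 1 (e / (K + 1)) by rewrite lt_min ltr01 divr_gt0.
have [N hN] := IH0 _ e1; have [N' hN'] := IH1 _ e1.
exists (maxn N N') => m; rewrite geq_max => /andP[/hN h0 /hN' h1] a ha.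
have {}h0 := h0 a ha; have {}h1 := h1 a ha; have hMa := hM a k ha.
rewrite !backwardS -mulrBl cnormM cnormV ler_pdivrMr; last by have := delta_gt1; slra.
set v1 := backward f _ a k.+1 in h1 *; set w1 := backward f (u a 1%N) a k.+1 in h1 hMa *.
set v0 := backward f _ a k in h0 *; set w0 := backward f (u a 1%N) a k in h0 *.
move: h0 h1; rewrite !le_min => /andP[_ h0] /andP[h11 h1].
have v1M : |[v1]| <= M + 1 by have := cnorm_le_sub v1 w1; slra.
have w1M : |[w1]| <= M + 1 by slra.
have -> : f v1 - v0 - (f w1 - w0) = (f v1 - f w1) - (v0 - w0) by ring.
apply: le_trans (cnormB _ _) _; have := hK _ _ v1M w1M.
have : e * 1 <= e * |[delta]| by rewrite ler_pM2l// ltW.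
have := ler_wpM2l K0 h1; have : e / (K + 1) * (K + 1) = e by rewrite divfK ?gt_eqF.
by set eK := e / (K + 1) in h0 h1 *; slra.
Qed.

(* By the Schwarz lemma, the distance from [p] of the backward orbit of a point at
   distance [s] from [p] is O(s) uniformly in time as long as the local stable
   manifold has bounded backward orbits; but near [p] it grows geometrically. *)
Lemma stable_unbounded f (M : R) : holo f -> good f ->
  exists z L, [/\ horbit f z, forall n, (L <= n)%N -> in_disc (z n) & M < |[z 0%N]|].
Proof.
move=> hf gf; apply: contrapT => nex.
have [u hu] := local_stable hf gf; have [p fp pc4] := fixed_point hf gf.
have pc : in_disc p by slra.
(* Prepending [k] preimages to a local stable orbit yields an orbit that is still eventually in the
   disc, so its first term is bounded by [M]. *)
have hM a k : in_disc a -> |[backward f (u a 1%N) a k.+1]| <= M.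
  move=> ha; have [ua0 uo uc _] := hu a ha; rewrite leNgt; apply/negP => hlt; apply: nex.
  have [h0 h1 hn] := iter_back f (u a) k.
  exists (iter k (back f) (u a)), k; split.
  - by elim: (k) => [//|j]; exact: orbit_back.
  - by move=> n /subnK <-; rewrite hn.
  - by rewrite h0 ua0.
have M0 : 0 <= M := le_trans (cnorm_ge0 _) (hM p 0%N pc).
have up n : u p n = p.
  have [up0 uo uc _] := hu p pc; apply/eqP; rewrite -subr_eq0 -cnorm_eq0 eq_le cnorm_ge0 andbT.
  by have := orbit_fixed_le gf fp pc uo uc n; rewrite up0 subrr cnorm0.
pose D := 16 * (M + 1) / eta.
have D0 : 0 < D by rewrite divr_gt0// mulr_gt0// ltr_wpDl.
have schwarz a k : |[a - c]| <= eta / 2 ->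
    |[backward f (u a 1%N) a k.+1 - p]| <= D * |[a - p]|.
  move=> ha2; have ha : in_disc a by slra.
  apply/ler_addgt0Pr => e e0.
  have e1 : 0 < Num.min 1 (e / 2) by rewrite lt_min ltr01 divr_gt0.
  have [m /(_ m (leqnn _)) hm] := backward_picard hf gf hu hM k.+1 e1.
  pose h x := backward f (picard f x m 1%N) x k.+1.
  have hh : holo h by apply: holo_backward => //; exact: holo_picard.
  have hb x : in_disc x -> |[h x]| <= M + 1.
    move=> hx; have := hm x hx; rewrite le_min => /andP[h1 _].
    by have := hM x k hx; have := cnorm_le_sub (h x) (backward f (u x 1%N) x k.+1); slra.
  have p2 : |[p - c]| <= eta / 2 by slra.
  have := cauchy_lip hh eta_gt0 hb ha2 p2; rewrite -/D.
  have := hm a ha; have := hm p pc; rewrite !le_min => /andP[_ hp'] /andP[_ ha'].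
  rewrite up backward_fixed// in hp'; rewrite -/(h p) in hp'; rewrite -/(h a) in ha'.
  have := cnorm_tri (h a) (backward f (u a 1%N) a k.+1) p; have := cnorm_tri (h p) (h a) p.
  by rewrite [|[_ - h a]|]cnormC; slra.
(* The bound [eta / 4] puts [p + s] in the half disc where [schwarz] applies; the bound on [D * s]
   keeps its whole backward orbit in the disc where [good] controls [f]. *)
have [s [s0 s4 sD]] : exists s : R, [/\ 0 < s, s <= eta / 4 & D * s <= eta / 2].
  exists (Num.min (eta / 4) (eta / (2 * D))); split.
  - by rewrite lt_min !divr_gt0// mulr_gt0.
  - by rewrite ge_min lexx.
  - apply: (@le_trans _ _ (D * (eta / (2 * D)))).
      by rewrite ler_pM2l// ge_min lexx orbT.
    by rewrite le_eqVlt; apply/orP; left; apply/eqP; field; rewrite gt_eqF.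
pose a := p + s%:C.
have aps : |[a - p]| = s by rewrite /a addrC addKr cnorm_real ger0_norm ?ltW.
have a2 : |[a - c]| <= eta / 2 by have := cnorm_tri p a c; slra.
have ac : in_disc a by slra.
have [ua0 uo uc _] := hu a ac.
pose x k := |[backward f (u a 1%N) a k - p]|.
have x0 : x 0%N <= x 1%N.
  by have := orbit_fixed_le gf fp pc uo uc 1%N; rewrite ua0.
have xs k : x k.+1 <= D * s by rewrite /x -aps; exact: schwarz.
have bc k : in_disc (backward f (u a 1%N) a k.+1).
  by have := cnorm_tri p (backward f (u a 1%N) a k.+1) c; have := xs k; rewrite /x; slra.
(* Growth factor of the distance to [p] per backward step, as long as this distance does not
   decrease. It does not decrease at first by [orbit_fixed_le]: [x 0] is the distance at time 1 and
   [x 1] at time 0. *)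
pose sg := (|[t]| - kap - 1) / |[delta]|.
have dl0 : 0 < |[delta]| by have := delta_gt1; slra.
have sg1 : 1 < sg by rewrite /sg ltr_pdivlMr// mul1r; slra.
have grow k : |[t]| * x k.+1 - kap * x k.+1 - x k <= |[delta]| * x k.+2.
  have fp' : f p = p + delta * p by rewrite [X in X + _]fp subrK.
  have := gf.1 _ _ (bc k) pc; rewrite /x backwardS.
  set b1 := backward f _ a k.+1; set b0 := backward f _ a k.
  move=> hk; rewrite -!cnormM (_ : delta * _ = (f b1 - f p) - (b0 - p)); last first.
    by rewrite fp' mulrBr mulrC divfK ?delta_neq0//; ring.
  have := cnorm_le_sub (f b1 - f p) (f b1 - f p - (b0 - p)).
  have := cnorm_le_sub (t * (b1 - p)) (f b1 - f p).
  rewrite (_ : t * (b1 - p) - (f b1 - f p) = - (f b1 - t * b1 - (f p - t * p))); last by ring.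
  rewrite cnormN (_ : f b1 - f p - (f b1 - f p - (b0 - p)) = b0 - p); last by ring.
  slra.
have xm k : x k <= x k.+1 /\ sg ^+ k * s <= x k.+1.
  elim: k => [|k [IH1 IH2]]; first by rewrite expr0 mul1r -aps; split.
  have x1 : 0 <= x k.+1 := cnorm_ge0 _.
  have h : sg * x k.+1 <= x k.+2.
    rewrite /sg mulrAC ler_pdivrMr//; have := grow k; slra.
  have h' : 1 * x k.+1 <= sg * x k.+1 by rewrite ler_wpM2r// ltW.
  split; first by rewrite mul1r in h'; exact: le_trans h' h.
  rewrite exprS -mulrA; apply: le_trans h.
  by rewrite ler_wpM2l// (le_trans _ (ltW sg1)).
have hg : 0 < sg - 1 by rewrite subr_gt0.
have [n hn] := natr_unbounded (D / (sg - 1)).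
have := bernoulli_ineq n (ltW hg); rewrite [1 + (sg - 1)]addrC subrK.
have := xs n; have [_] := xm n; move: hn; rewrite ler_pdivrMr// => h1 h2 h3 h4.
have h5 : (1 + n%:R * (sg - 1)) * s <= D * s.
  by apply: le_trans h3; apply: le_trans h2; rewrite ler_pM2r.
by move: h5; rewrite ler_pM2r//; slra.
Qed.

End LocalStableManifold.
End Orbits.

(** * Escaping orbits *)

Section Perturbation.
Variable R : realType.
Local Notation C := (R[i]).
Variable delta : C.
Hypothesis delta_gt1 : 1 < |[delta]|.
Local Notation horbit := (horbit delta).
Local Notation back := (back delta).
Implicit Types (f g : C -> C) (z y : nat -> C) (a b c t x w : C).

Lemma close_le (r r' e e' : R) f g : r' <= r -> e <= e' -> close r e f g -> close r' e' f g.
Proof. by move=> rr ee h x xr; apply: le_trans ee; apply: h; exact: le_trans rr. Qed.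

(** One step back costs a factor at most [2 + K]. The map is evaluated only near [b 1], ..., [b n],
    so the endpoints [b 0] and [b n.+1] may lie outside the disc on which [g] is close to [f]; in
    the applications one of them is an outermost point. *)
Lemma pullback f (b : nat -> C) (r' r : R) n : holo f -> r' < r ->
  (forall j, (j < n)%N -> b j.+2 = f (b j.+1) - delta * b j) ->
  (forall j, (0 < j <= n)%N -> |[b j]| <= r') ->
  exists K e0 : R, [/\ 1 <= K, 0 < e0 & forall (e : R) g y, e <= e0 -> horbit g y ->
    close r e f g -> |[y 0%N - b n]| <= e -> |[y 1%N - b n.+1]| <= e ->
    exists y', [/\ horbit g y', forall k, y' (k + n)%N = y k &
      forall j, (j <= n.+1)%N -> |[y' j - b j]| <= K * e]].
Proof.
move=> hf rr; have [K K0 hK] := holo_lip r hf.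
elim: n => [_ _|n IH bo br].
  exists 1, 1; split=> // e g y _ yo _ h0 h1; exists y; split=> // [k|]; first by rewrite addn0.
  by move=> [ | [ | ] ] //; rewrite mul1r.
have [||K' [e0 [K'1 e00 H]]] := IH.
- by move=> j jn; apply: bo; rewrite ltnS ltnW.
- by move=> j /andP[j0 jn]; apply: br; rewrite j0 ltnW.
have K2 : 0 < 2 + K by lra.
exists (K' * (2 + K)), (Num.min (e0 / (2 + K)) (r - r')); split.
- by rewrite (le_trans K'1)// ler_peMr//; lra.
- by rewrite lt_min divr_gt0//= subr_gt0.
move=> e g y; rewrite le_min => /andP[]; rewrite ler_pdivlMr// => ee0 er yo cl h0 h1.
have e_ge0 : 0 <= e := le_trans (cnorm_ge0 _) h0.
have yn : |[y 0%N]| <= r.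
  have := cnorm_le_sub (y 0%N) (b n.+1); have := br n.+1; rewrite ltnSn => /(_ isT); lra.
have bn : |[b n.+1]| <= r by have := br n.+1; rewrite ltnSn => /(_ isT); lra.
have d0 := delta_neq0 delta_gt1.
have K'0 : 0 <= K' by lra.
have Y0 : |[back g y 0%N - b n]| <= (2 + K) * e.
  have dd : 0 < |[delta]| by rewrite cnorm_gt0.
  apply: (@le_trans _ _ (|[delta]| * |[back g y 0%N - b n]|)).
    by rewrite -[leLHS]mul1r ler_wpM2r ?cnorm_ge0// ltW.
  rewrite -cnormM (_ : _ * _ = (g (y 0%N) - f (y 0%N)) + (f (y 0%N) - f (b n.+1)) - (y 1%N - b n.+2)); last first.
    by rewrite bo ?ltnSn// /= mulrBr mulrC divfK//; ring.
  have := cnormB ((g (y 0%N) - f (y 0%N)) + (f (y 0%N) - f (b n.+1))) (y 1%N - b n.+2).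
  have := cnormD (g (y 0%N) - f (y 0%N)) (f (y 0%N) - f (b n.+1)).
  have := cl _ yn; have := hK _ _ yn bn; have := ler_wpM2l K0 h0; lra.
have Y1 : |[back g y 1%N - b n.+1]| <= (2 + K) * e.
  by apply: le_trans h0 _; have := mulr_ge0 K0 e_ge0; lra.
have cl' : close r ((2 + K) * e) f g.
  by apply: close_le cl => //; have := mulr_ge0 K0 e_ge0; lra.
have [|y' [y'o y'k y'b]] := H _ g (back g y) _ (orbit_back delta_gt1 yo) cl' Y0 Y1.
- by rewrite mulrC.
exists y'; split=> //.
- by move=> k; rewrite addnS -addSn y'k.
- move=> j; rewrite leq_eqVlt => /orP[/eqP ->|jn]; last by rewrite -mulrA; exact: y'b.
  have -> : y' n.+2 = y 1%N by exact: (y'k 2%N).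
  apply: le_trans h1 _; rewrite -[leLHS]mul1r ler_wpM2r//.
  by rewrite (le_trans K'1)// ler_peMr//; lra.
Qed.
Lemma exp_sub1_le (x : C) n : n%:R * |[x - 1]| <= 1 / 2 -> |[x ^+ n - 1]| <= 2 * n%:R * |[x - 1]|.
Proof.
move=> hn; set h := |[x - 1]| in hn *; have h0 : 0 <= h := cnorm_ge0 _.
suff H m : (m <= n)%N -> |[x ^+ m - 1]| <= 2 * m%:R * h by exact: H.
elim: m => [_|m IH mn]; first by rewrite expr0 subrr cnorm0 mulr0 mul0r.
have {}IH := IH (ltnW mn).
have mh : m%:R * h <= 1 / 2.
  by apply: le_trans hn; rewrite ler_wpM2r// ler_nat ltnW.
have -> : x ^+ m.+1 - 1 = (x - 1) * (x ^+ m - 1) + (x ^+ m - 1) + (x - 1) by rewrite exprS; ring.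
apply: le_trans (cnormD _ _) _; rewrite -/h.
have := cnormD ((x - 1) * (x ^+ m - 1)) (x ^+ m - 1); rewrite cnormM -/h.
have := ler_wpM2l h0 IH; have := ler_wpM2l h0 mh.
by rewrite -[m.+1%:R]natr1; lra.
Qed.

Lemma first_exit (P : pred nat) n : P n -> exists2 m, P m & forall j, (j < m)%N -> ~~ P j.
Proof.
move=> Pn; have [m Pm mmin] := ex_minnP (ex_intro (fun n => P n) n Pn).
by exists m => // j; rewrite ltnNge; apply: contra; exact: mmin.
Qed.

Fixpoint forward f a b n : C :=
  if n is n1.+1 then
    if n1 is n2.+1 then f (forward f a b n1) - delta * forward f a b n2 else b
  else a.

Lemma forwardS f a b n : forward f a b n.+2 = f (forward f a b n.+1) - delta * forward f a b n.
Proof. by []. Qed.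

Lemma forward_cont f a b n (e : R) : holo f -> 0 < e -> exists2 r : R, 0 < r &
  forall a' b', |[a' - a]| <= r -> |[b' - b]| <= r ->
    forall j, (j <= n)%N -> |[forward f a' b' j - forward f a b j]| <= e.
Proof.
move=> hf e0.
pose P n := forall e : R, 0 < e -> exists2 r : R, 0 < r &
  forall a' b', |[a' - a]| <= r -> |[b' - b]| <= r -> |[forward f a' b' n - forward f a b n]| <= e.
have HP k : P k.
  suff [] : P k /\ P k.+1 by [].
  elim: k => [|k [IH0 IH1]]; first by split=> d d0; exists d.
  split=> // d d0; have [f' hf'] := hf (forward f a b k.+1).
  have d2 : 0 < d / 2 by lra.
  have [r r0 hr] := cdiff_cont hf' d2; have [r1 r10 h1] := IH1 _ r0.
  have q0 : 0 < d / (2 * |[delta]|) by rewrite divr_gt0// mulr_gt0//; have := delta_gt1; lra.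
  have [r2 r20 h2] := IH0 _ q0.
  exists (Num.min r1 r2) => [|a' b']; first by rewrite lt_min r10.
  rewrite !le_min => /andP[a1 a2] /andP[b1 b2].
  have := hr _ (h1 _ _ a1 b1); rewrite [forward _ _ _ _ + _]addrC subrK => hh.
  rewrite !forwardS; set u' := forward f a' b' k in h2 *; set u := forward f a b k in h2 *.
  have -> : f (forward f a' b' k.+1) - delta * u' - (f (forward f a b k.+1) - delta * u) =
    (f (forward f a' b' k.+1) - f (forward f a b k.+1)) - delta * (u' - u) by ring.
  apply: le_trans (cnormB _ _) _; rewrite cnormM.
  have := ler_wpM2l (cnorm_ge0 delta) (h2 _ _ a2 b2).
  have -> : |[delta]| * (d / (2 * |[delta]|)) = d / 2.
    by field; have := delta_gt1; move=> ?; apply: lt0r_neq0; lra.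
  lra.
elim: n => [|n [r r0 hr]].
  have [r r0 hr] := HP 0%N e e0; exists r => // a' b' ha hb j; rewrite leqn0 => /eqP ->; exact: hr.
have [r' r'0 hr'] := HP n.+1 e e0.
exists (Num.min r r') => [|a' b']; first by rewrite lt_min r0.
rewrite !le_min => /andP[a1 a2] /andP[b1 b2] j; rewrite leq_eqVlt =>
    /orP[/eqP ->|]; first exact: hr'.
by rewrite ltnS; exact: hr.
Qed.

Lemma holo_forward f (u v : C -> C) n : holo f -> holo u -> holo v ->
  holo (fun x => forward f (u x) (v x) n).
Proof.
move=> hf hu hv.
suff [] : holo (fun x => forward f (u x) (v x) n) /\ holo (fun x =>
    forward f (u x) (v x) n.+1) by [].
elim: n => [//|n [IH0 IH1]]; split=> //; apply: holoB (holo_comp IH1 hf) _.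
exact: holoM (holo_cst _) IH0.
Qed.

(* [A n * B n.+1 - A n.+1 * B n] is the Jacobian determinant of the [n]-th iterate. *)
Lemma forward_deriv f a b : holo f -> exists A B : nat -> C,
  [/\ forall n, cdiff (fun x => forward f x b n) a (A n),
      forall n, cdiff (fun x => forward f a x n) b (B n) &
      forall n, A n * B n.+1 - A n.+1 * B n = delta ^+ n].
Proof.
move=> hf; have [f' hf'] := choice hf.
have [A hA] := choice (fun n => holo_forward n hf (@holo_id R) (@holo_cst R b) a).
have [B hB] := choice (fun n => holo_forward n hf (@holo_cst R a) (@holo_id R) b).
exists A, B; split=> //.
have hA2 n : A n.+2 = f' (forward f a b n.+1) * A n.+1 - delta * A n.
  apply: cdiff_unique (hA n.+2) _ => /=.
  exact: cdiffB (cdiff_comp (hA n.+1) (hf' _)) (cdiff_scale _ (hA n)).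
have hB2 n : B n.+2 = f' (forward f a b n.+1) * B n.+1 - delta * B n.
  apply: cdiff_unique (hB n.+2) _ => /=.
  exact: cdiffB (cdiff_comp (hB n.+1) (hf' _)) (cdiff_scale _ (hB n)).
have A0 : A 0%N = 1 by apply: cdiff_unique (hA 0%N) (cdiff_id _).
have A1 : A 1%N = 0 by apply: cdiff_unique (hA 1%N) (cdiff_cst _ _).
have B0 : B 0%N = 0 by apply: cdiff_unique (hB 0%N) (cdiff_cst _ _).
have B1 : B 1%N = 1 by apply: cdiff_unique (hB 1%N) (cdiff_id _).
elim=> [|n IH]; first by rewrite A0 A1 B0 B1 mulr1 mulr0 subr0 expr0.
by rewrite hA2 hB2 exprS -IH; ring.
Qed.

Lemma escape f a b (r M : R) : holo f -> 0 < r ->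
  exists a' b' n, [/\ |[a' - a]| <= r, |[b' - b]| <= r & M < |[forward f a' b' n]|].
Proof.
move=> hf r0; apply: contrapT => nex.
have bnd a' b' n : |[a' - a]| <= r -> |[b' - b]| <= r -> |[forward f a' b' n]| <= M.
  by move=> ha hb; rewrite leNgt; apply/negP => h; apply: nex; exists a', b', n.
have [A [B [hA hB W]]] := forward_deriv a b hf.
have ra : |[a - a]| <= r by rewrite subrr cnorm0 ltW.
have rb : |[b - b]| <= r by rewrite subrr cnorm0 ltW.
have hA' n : |[A n]| <= 8 * M / r.
  apply: cauchy_deriv (hA n) r0 _; first exact: holo_forward hf (@holo_id R) (@holo_cst R b).
  by move=> w wr; exact: bnd.
have hB' n : |[B n]| <= 8 * M / r.
  apply: cauchy_deriv (hB n) r0 _; first exact: holo_forward hf (@holo_cst R a) (@holo_id R).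
  by move=> w wr; exact: bnd.
set D := 8 * M / r in hA' hB'.
have D0 : 0 <= D := le_trans (cnorm_ge0 _) (hA' 0%N).
have dn n : |[delta]| ^+ n <= 2 * (D * D).
  rewrite -cnormX -W; apply: le_trans (cnormB _ _) _; rewrite !cnormM.
  have := ler_pM (cnorm_ge0 _) (cnorm_ge0 _) (hA' n) (hB' n.+1).
  have := ler_pM (cnorm_ge0 _) (cnorm_ge0 _) (hA' n.+1) (hB' n); lra.
have d1 : 0 < |[delta]| - 1 by have := delta_gt1; lra.
have [n] := natr_unbounded (2 * (D * D) / (|[delta]| - 1)); rewrite ler_pdivrMr// => h1.
have := bernoulli_ineq n (ltW d1); rewrite [1 + (_ - _)]addrC subrK; have := dn n; lra.
Qed.

(** Since the Jacobian determinant is nonzero, some partial derivative of the [n]-th term is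
    nonzero; moving in that variable changes the modulus, while the conditions on earlier terms
    survive small moves. *)
Lemma avoid_modulus f a b (r X : R) n : holo f -> 0 < r -> 0 < X -> exists a' b',
  [/\ |[a' - a]| <= r, |[b' - b]| <= r & forall j, (j < n)%N -> |[forward f a' b' j]| != X].
Proof.
move=> hf r0 X0; elim: n => [|n IH] in a b r r0 *.
  by exists a, b; split=> //; rewrite subrr cnorm0 ltW.
have r2 : 0 < r / 2 by lra.
have [a1 [b1 [ha hb h]]] := IH a b _ r2.
suff [a2 [b2 [ha2 hb2 h2]]] : exists a2 b2, [/\ |[a2 - a1]| <= r / 2, |[b2 - b1]| <= r / 2 &
    forall j, (j <= n)%N -> |[forward f a2 b2 j]| != X].
  exists a2, b2; split=> //.
    by have := cnorm_tri a1 a2 a; lra.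
  by have := cnorm_tri b1 b2 b; lra.
have [E|ne] := eqVneq |[forward f a1 b1 n]| X; last first.
  exists a1, b1; rewrite !subrr cnorm0 ltW//; split=> // j; rewrite leq_eqVlt =>
      /orP[/eqP ->//|]; exact: h.
have [e e0 he] : exists2 e : R, 0 < e & forall j, (j < n)%N ->
    forall w, |[w - forward f a1 b1 j]| <= e -> |[w]| != X.
  elim: (n) h => [|k IHk] h; first by exists 1.
  have [e e0 he] := IHk (fun j jk => h j (ltnW jk)).
  have := h k (ltnSn k); rewrite -subr_eq0 -normr_gt0 => d0.
  exists (Num.min e (`||[forward f a1 b1 k]| - X| / 2)) => [|j];
    first by rewrite lt_min e0 divr_gt0.
  rewrite ltnS leq_eqVlt => /orP[/eqP ->|jk] w; rewrite le_min =>
      /andP[h1 h2]; last exact: he jk _ h1.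
  apply/eqP => wX; move: h2 d0.
  have := cnorm_le_sub w (forward f a1 b1 k); have := cnorm_le_sub (forward f a1 b1 k) w.
  rewrite [|[_ - w]|]cnormC wX; set y := |[forward _ _ _ _]|; set d := |[_ - _]| => h3 h4 h5 h6.
  have : `|y - X| <= d by rewrite ler_norml; apply/andP; split; lra.
  lra.
have [s s0 hs] := forward_cont a1 b1 n hf e0.
have [A [B [hA hB W]]] := forward_deriv a1 b1 hf.
set u := forward f a1 b1 n in E.
have u0 : u != 0 by rewrite -cnorm_gt0 E.
(* The increment is chosen to make the first-order change radial: the linear approximation has
   modulus [X + |[d]| * m], and the error is at most half of [|[d]| * m]. *)
have move1 (h' : C -> C) x0 d : cdiff h' x0 d -> d != 0 -> h' x0 = u -> forall r1 : R, 0 < r1 ->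
    exists2 x, |[x - x0]| <= r1 & |[h' x]| != X.
  move=> hd d0 hu r1 r10.
  have dp : 0 < |[d]| by rewrite cnorm_gt0.
  have dp2 : 0 < |[d]| / 2 by rewrite divr_gt0.
  have [r3 r30 h3] := hd _ dp2.
  pose m := Num.min r1 r3; have m0 : 0 < m by rewrite lt_min r10.
  have [y hy] : exists y : R, y = m * |[d]| / X by exists (m * |[d]| / X).
  pose k : C := y%:C * (u / d).
  have nk : |[k]| = m.
    rewrite cnormM cnorm_real cnormM cnormV E hy ger0_norm;
      last by rewrite divr_ge0 ?mulr_ge0// ltW.
    by field; rewrite !gt_eqF.
  exists (x0 + k); first by rewrite addrC addKr nk ge_min lexx.
  have kr3 : |[k]| <= r3 by rewrite nk ge_min lexx orbT.
  have := h3 k kr3; rewrite hu nk => h4.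
  have dk : |[u + d * k]| = X + |[d]| * m.
    have -> : u + d * k = (1 + y)%:C * u.
      by rewrite /k rmorphD rmorph1; field; exact: d0.
    rewrite cnormM cnorm_real E hy ger0_norm; last by rewrite addr_ge0// divr_ge0 ?mulr_ge0// ltW.
    by field; rewrite gt_eqF.
  have := cnorm_le_sub (u + d * k) (h' (x0 + k)); rewrite dk cnormC.
  rewrite (_ : h' (x0 + k) - (u + d * k) = h' (x0 + k) - u - d * k); last by ring.
  move=> h5; apply/eqP => h6; rewrite h6 in h5.
  have := mulr_gt0 dp m0; lra.
have rs0 : 0 < Num.min s (r / 2) by rewrite lt_min s0.
have fin a2 b2 : |[a2 - a1]| <= s -> |[b2 - b1]| <= s -> |[forward f a2 b2 n]| != X ->
    forall j, (j <= n)%N -> |[forward f a2 b2 j]| != X.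
  move=> ha2 hb2 hn j; rewrite leq_eqVlt => /orP[/eqP ->//|jn].
  by apply: (he j jn); apply: hs => //; exact: ltnW.
have [An0|An] := eqVneq (A n) 0.
  have Bn : B n != 0.
    apply/eqP => Bn0; have := W n; rewrite An0 Bn0 mul0r mulr0 subrr => /esym/eqP.
    by rewrite expf_eq0 (negPf (delta_neq0 delta_gt1)) andbF.
  have [x] := move1 (fun x => forward f a1 x n) b1 (B n) (hB n) Bn erefl _ rs0; rewrite le_min =>
      /andP[x1 x2] hx.
  exists a1, x; split=> //; [by rewrite subrr cnorm0 ltW | apply: fin => //].
  by rewrite subrr cnorm0 ltW.
have [x] := move1 (fun x => forward f x b1 n) a1 (A n) (hA n) An erefl _ rs0; rewrite le_min =>
    /andP[x1 x2] hx.
exists x, b1; split=> //; [by rewrite subrr cnorm0 ltW | apply: fin => //].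
by rewrite subrr cnorm0 ltW.
Qed.

(** Avoiding the modulus [X] makes the inequalities before the exit strict, so that a disc of radius
    below [X] contains all earlier points. *)
Lemma generic_escape f a b (r X : R) : holo f -> 0 < r -> 0 < X -> exists a' b' n,
  [/\ |[a' - a]| <= r, |[b' - b]| <= r, X < |[forward f a' b' n]| &
      forall j, (j < n)%N -> |[forward f a' b' j]| < X].
Proof.
move=> hf r0 X0; have r2 : 0 < r / 2 by lra.
have [a1 [b1 [n [ha hb hn]]]] := escape a b X hf r2.
have e0 : 0 < (|[forward f a1 b1 n]| - X) / 2 by rewrite divr_gt0// subr_gt0.
have [s s0 hs] := forward_cont a1 b1 n hf e0.
have m0 : 0 < Num.min s (r / 2) by rewrite lt_min s0.
have [a2 [b2 [ha2 hb2 h2]]] := avoid_modulus a1 b1 n.+1 hf m0 X0.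
move: ha2 hb2; rewrite !le_min => /andP[as2 ar2] /andP[bs2 br2].
have hX : X < |[forward f a2 b2 n]|.
  have := hs _ _ as2 bs2 n (leqnn n); rewrite cnormC.
  by have := cnorm_le_sub (forward f a1 b1 n) (forward f a2 b2 n); lra.
have Pn : (n <= n)%N && (X < |[forward f a2 b2 n]|) by rewrite leqnn hX.
have [m /andP[mn Xm] mmin] := @first_exit (fun j => (j <= n)%N && (X < |[forward f a2 b2 j]|)) n Pn.
exists a2, b2, m; split=> //.
- by have := cnorm_tri a1 a2 a; lra.
- by have := cnorm_tri b1 b2 b; lra.
move=> j jm; have jn : (j <= n)%N by apply: leq_trans mn; exact: ltnW.
by have := mmin j jm; rewrite jn /= -leNgt lt_neqAle => ->; rewrite andbT; exact: h2.
Qed.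

End Perturbation.

(** * Steering a stable orbit *)

Section Steering.
Variable R : realType.
Local Notation C := (R[i]).
Variable delta : C.
Hypothesis delta_gt1 : 1 < |[delta]|.
Local Notation horbit := (horbit delta).
Local Notation forward := (forward delta).
Implicit Types (f g h : C -> C) (z y : nat -> C) (a b c t x w : C).

Section Saddle.
Variables (c t : C) (eta kap : R).
Hypotheses (eta_gt0 : 0 < eta) (kap_ge0 : 0 <= kap) (gap_gt0 : 0 < gap delta t kap).
Local Notation good := (good delta c eta t kap).
Local Notation in_disc x := (|[x - c]| <= eta).

Let c_in_disc : in_disc c. Proof. by rewrite subrr cnorm0 ltW. Qed.

(** [orbit_close] continues the local part with the same starting value [z L], and [pullback]
    follows it back to time 0. The point [z 0] may lie far outside, because no term of the orbit is
    computed by evaluating [f] there. *)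
Lemma stable_continuity f z L (r' r : R) : holo f -> horbit f z ->
  (forall n, (L <= n)%N -> in_disc (z n)) -> (forall n, (0 < n)%N -> |[z n]| <= r') ->
  r' < r -> (forall x, in_disc x -> |[x]| <= r) ->
  exists K e0 : R, [/\ 0 <= K, 0 < e0 & forall (e : R) g, e <= e0 -> holo g -> good g ->
    close r e f g -> exists y, [/\ horbit g y, forall n, (L <= n)%N -> in_disc (y n) &
      forall n, |[y n - z n]| <= K * e]].
Proof.
move=> hf zo zL zr rr cr.
have [||K [e0 [K1 e00 H]]] := @pullback R delta delta_gt1 f z r' r L hf rr.
- by move=> j _; exact: zo.
- by move=> j /andP[j0 _]; exact: zr.
pose k1 := 1 + (gap delta t kap)^-1.
have i0 : 0 < (gap delta t kap)^-1 by rewrite invr_gt0.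
have k0 : 0 < k1 by rewrite /k1; lra.
exists (K * k1), (e0 / k1); split; [by rewrite mulr_ge0//; lra | exact: divr_gt0 |].
move=> e g; rewrite ler_pdivlMr// => ee hg gg cl.
have e_ge0 : 0 <= e := le_trans (cnorm_ge0 _) (cl c (cr c c_in_disc)).
have [u hu] := local_stable eta_gt0 kap_ge0 gap_gt0 hg gg.
have [u0 uo uc _] := hu _ (zL L (leqnn L)).
have zo' := orbit_shift L zo.
have zc' n : in_disc (z (n + L)%N) by apply: zL; rewrite leq_addl.
have cl' x : in_disc x -> |[g x - f x]| <= e by move=> xc; apply: cl; exact: cr.
have uz n : |[u (z L) n - z (n + L)%N]| <= e / gap delta t kap.
  exact: (orbit_close eta_gt0 kap_ge0 gap_gt0 gg zo' uo zc' uc cl' u0).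
have ek : e / gap delta t kap <= k1 * e by rewrite /k1 mulrDl mul1r mulrC; lra.
have ek1 : e <= k1 * e by have := mulr_ge0 (ltW i0) e_ge0; rewrite /k1; lra.
have [||||y [yo yL yz]] := H (k1 * e) g (u (z L)) _ uo.
- by rewrite mulrC.
- exact: close_le cl.
- exact: le_trans (uz 0%N) ek.
- exact: le_trans (uz 1%N) ek.
exists y; split=> // n.
- by move=> /subnK <-; rewrite yL.
- have [nL|Ln] := leqP n L.+1; first by rewrite -mulrA; exact: yz.
  have {}Ln : (L <= n)%N by rewrite ltnW// ltnW.
  rewrite -(subnK Ln) yL; apply: le_trans (uz _) _; apply: le_trans ek _.
  by rewrite -mulrA -[leLHS]mul1r ler_wpM2r// mulr_ge0// ltW.
Qed.

(* Adding to [f] a small multiple of a high power of [x / z 0] barely moves the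
   stable orbit [z] but moves at will the preimage of its starting point. *)
Lemma steer f z L (r' r e : R) v : holo f -> 0 < e ->
  (forall g, holo g -> close r e f g -> good g) -> horbit f z ->
  (forall n, (L <= n)%N -> in_disc (z n)) -> (forall n, (0 < n)%N -> |[z n]| <= r') ->
  r' < r -> (forall x, in_disc x -> |[x]| <= r) -> r < |[z 0%N]| ->
  exists g y, [/\ holo g, close r e f g, horbit g y,
    forall n, (L < n)%N -> in_disc (y n) &
    |[y 0%N - v]| <= e /\ forall n, |[y n.+1 - z n]| <= e].
Proof.
move=> hf e_gt0 fgood zo zL zr rr cr rz0.
have r_ge0 : 0 <= r := le_trans (cnorm_ge0 _) (cr c c_in_disc).
have Z0 : 0 < |[z 0%N]| by lra.
have z0 : z 0%N != 0 by rewrite -cnorm_gt0.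
have dl0 := delta_neq0 delta_gt1.
have [Kz [e0 [Kz0 e00 H]]] := stable_continuity hf zo zL zr rr cr.
have [Kf Kf0 hKf] := holo_lip (|[z 0%N]| + 1) hf.
(* With this coefficient, [(f (z 0) + c0 - z 1) / delta = v]. *)
set c0 := delta * v + z 1%N - f (z 0%N).
pose th := r / |[z 0%N]|.
have th01 : 0 <= th < 1 by rewrite /th divr_ge0 ?(ltW Z0)//= ltr_pdivrMr// mul1r.
pose m := Num.min (Num.min e0 e) 1.
have m0 : 0 < m by rewrite !lt_min e00 e_gt0 ltr01.
have me0 : m <= e0 by rewrite !ge_min lexx.
have me : m <= e by rewrite !ge_min lexx !orbT.
have m1 : m <= 1 by rewrite !ge_min lexx !orbT.
pose A1 := 2 * Kz / |[z 0%N]|; pose A2 := Kf * Kz; pose A3 := |[c0]| * A1.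
have A10 : 0 <= A1 by rewrite /A1 divr_ge0 ?mulr_ge0// ltW.
have A20 : 0 <= A2 by rewrite mulr_ge0.
have A30 : 0 <= A3 by rewrite mulr_ge0// cnorm_ge0.
(* Five errors, all proportional to [s], share the budget [m]: the change of [f], the displacement
   of the orbit, and the effects of the latter on the power, on [f], and on the power times [c0]. *)
pose T := 1 + Kz + A1 + A2 + A3.
have T0 : 0 < T by rewrite /T; lra.
pose s := m / T; have s0 : 0 < s by rewrite divr_gt0.
have sT : s + s * Kz + s * A1 + s * A2 + s * A3 = m.
  by rewrite -[m](divfK (_ : T != 0)) ?gt_eqF// -/s /T; ring.
have S0 : 0 < |[c0]| + 1 by have := cnorm_ge0 c0; lra.
(* Smallness of [N * th ^ N] is required, since the relative displacement of [y 0] is multiplied by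
   [N] in the power. *)
have [N0 hN0] := natX_small th01 (divr_gt0 s0 S0).
pose N := N0.+1.
pose eps := |[c0]| * th ^+ N.
have thN : 0 <= th ^+ N by rewrite exprn_ge0//; case/andP: th01.
have eps_ge0 : 0 <= eps by rewrite mulr_ge0// cnorm_ge0.
have Neps : N%:R * eps <= s.
  have := hN0 N (leqnSn _); rewrite ler_pdivlMr// -/N /eps => hN.
  have : 0 <= N%:R * th ^+ N by rewrite mulr_ge0.
  by lra.
have epss : eps <= s.
  apply: le_trans Neps; rewrite -[leLHS]mul1r ler_wpM2r//.
  by rewrite ler1n.
pose A x := (x / z 0%N) ^+ N.
pose g x := f x + c0 * A x.
have hg : holo g.
  apply: holoD hf (holoM (holo_cst _) _); apply: holoX.
  exact: holoM (@holo_id R) (holo_cst _).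
have cl : close r eps f g.
  move=> x xr; rewrite /g addrC addKr cnormM cnormX ler_wpM2l ?cnorm_ge0//.
  rewrite lerXn2r ?nnegrE ?cnorm_ge0//; first by case/andP: th01.
  by rewrite cnormM cnormV ler_wpM2r// invr_ge0 ltW.
have sK : 0 <= s * Kz by rewrite mulr_ge0// ltW.
have sA1 : 0 <= s * A1 by rewrite mulr_ge0// ltW.
have sA2 : 0 <= s * A2 by rewrite mulr_ge0// ltW.
have sA3 : 0 <= s * A3 by rewrite mulr_ge0// ltW.
have cle : close r e f g by apply: close_le cl => //; lra.
have [|y [yo yL yz]] := H eps g _ hg (fgood g hg cle) cl; first by lra.
have Ke : Kz * eps <= s * Kz by rewrite mulrC ler_wpM2r.
have yzs n : |[y n - z n]| <= s * Kz by exact: le_trans (yz n) Ke.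
exists g, (back delta g y); split=> //.
- exact: orbit_back.
- by case=> [//|n]; exact: yL.
split; last by move=> n /=; have := yzs n; lra.
have dd : 0 < |[delta]| by rewrite cnorm_gt0.
apply: (@le_trans _ _ (|[delta]| * |[back delta g y 0%N - v]|)).
  by rewrite -[leLHS]mul1r ler_wpM2r ?cnorm_ge0// ltW.
have -> : |[delta]| * |[back delta g y 0%N - v]| =
    |[(f (y 0%N) - f (z 0%N)) + c0 * (A (y 0%N) - 1) - (y 1%N - z 1%N)]|.
  rewrite -cnormM; congr (|[_]|); rewrite /= mulrBr mulrC divfK// /g /c0; ring.
have b1 : |[f (y 0%N) - f (z 0%N)]| <= s * A2.
  have y0 : |[y 0%N]| <= |[z 0%N]| + 1 by have := cnorm_le_sub (y 0%N) (z 0%N);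
    have := yzs 0%N; lra.
  have z0' : |[z 0%N]| <= |[z 0%N]| + 1 by lra.
  apply: le_trans (hKf _ _ y0 z0') _.
  by have := ler_wpM2l Kf0 (yzs 0%N); rewrite /A2; lra.
have b2 : |[c0 * (A (y 0%N) - 1)]| <= s * A3.
  have x1 : |[y 0%N / z 0%N - 1]| <= Kz * eps / |[z 0%N]|.
    rewrite (_ : _ - 1 = (y 0%N - z 0%N) / z 0%N); last by rewrite mulrBl divff.
    by rewrite cnormM cnormV ler_wpM2r// invr_ge0 ltW.
  have Nx : 2 * N%:R * |[y 0%N / z 0%N - 1]| <= s * A1.
    apply: (@le_trans _ _ (2 * N%:R * (Kz * eps / |[z 0%N]|)));
      first by rewrite ler_wpM2l// mulr_ge0.
    rewrite (_ : _ * _ = A1 * (N%:R * eps)); last by rewrite /A1; field; rewrite gt_eqF.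
    by rewrite [leRHS]mulrC ler_wpM2l.
  have := @exp_sub1_le R (y 0%N / z 0%N) N ltac:(lra); rewrite -/(A _) => h.
  rewrite cnormM (_ : s * A3 = |[c0]| * (s * A1)); last by rewrite /A3; ring.
  by rewrite ler_wpM2l ?cnorm_ge0//; exact: le_trans h Nx.
have := cnormB ((f (y 0%N) - f (z 0%N)) + c0 * (A (y 0%N) - 1)) (y 1%N - z 1%N).
have := cnormD (f (y 0%N) - f (z 0%N)) (c0 * (A (y 0%N) - 1)).
by have := yzs 1%N; lra.
Qed.

End Saddle.
End Steering.

(** * Joining an escaping orbit to a stable one *)

Section Density.
Variable R : realType.
Local Notation C := (R[i]).
Variable delta : C.
Hypothesis delta_gt1 : 1 < |[delta]|.
Local Notation horbit := (horbit delta).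
Local Notation forward := (forward delta).
Implicit Types (f g h : C -> C) (z y : nat -> C) (a b c t x w : C).

Lemma orbit_forward f a b : horbit f (forward f a b).
Proof. by []. Qed.

Lemma last_exit (P : pred nat) n L : P n -> (forall k, (L <= k)%N -> ~~ P k) ->
  exists2 m, P m & forall k, (m < k)%N -> ~~ P k.
Proof.
move=> Pn PL.
have bnd k : P k -> (k <= L)%N by rewrite leqNgt; apply: contraL => /ltnW; exact: PL.
have [m Pm mmax] := ex_maxnP (ex_intro (fun n => P n) n Pn) bnd.
by exists m => // k; rewrite ltnNge; apply: contra; exact: mmax.
Qed.

Lemma finite_bound (u : nat -> R) (M X : R) n : M < X -> (forall j, (j < n)%N -> u j < X) ->
  exists m, [/\ M <= m, m < X & forall j, (j < n)%N -> u j <= m].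
Proof.
move=> MX; elim: n => [|n IH] h; first by exists M.
have [m [Mm mX hm]] := IH (fun j jn => h j (ltnW jn)).
exists (Num.max m (u n)); split; first by rewrite le_max Mm.
  by rewrite gt_max mX h.
move=> j; rewrite ltnS leq_eqVlt => /orP[/eqP ->|/hm jm]; rewrite le_max ?lexx ?orbT//.
by rewrite jm.
Qed.

Section Saddle.
Variables (c t : C) (eta kap : R).
Hypotheses (eta_gt0 : 0 < eta) (kap_ge0 : 0 <= kap) (gap_gt0 : 0 < gap delta t kap).
Local Notation good := (good delta c eta t kap).
Local Notation in_disc x := (|[x - c]| <= eta).

Lemma close_trans (s s' e1 e2 : R) f1 f2 f3 : s <= s' ->
  close s e1 f1 f2 -> close s' e2 f2 f3 -> close s (e1 + e2) f1 f3.
Proof.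
move=> ss h1 h2 x xs; have := h1 x xs; have := h2 x (le_trans xs ss).
by have := cnorm_tri (f2 x) (f3 x) (f1 x); lra.
Qed.

Lemma steer_thrice f z L (r' r D tau : R) w1 w2 : holo f -> 0 < tau -> tau <= D ->
  (forall g, holo g -> close r (3 * tau) f g -> good g) -> horbit f z ->
  (forall n, (L <= n)%N -> in_disc (z n)) -> (forall n, (0 < n)%N -> |[z n]| <= r') ->
  r' < r -> (forall x, in_disc x -> |[x]| <= r) -> r < |[z 0%N]| ->
  |[w2]| = |[z 0%N]| + 8 * D ->
  exists g y, [/\ holo g, close r (3 * tau) f g, horbit g y,
    forall n, (L.+2 < n)%N -> in_disc (y n) &
    |[y 0%N - w1]| <= tau /\ |[y 1%N - w2]| <= 2 * tau].
Proof.
move=> hf tau0 tauD fgood zo zL zr rr cr rz0; move EX : |[z 0%N]| rz0 => X rz0 w2X.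
have D0 : 0 < D by lra.
have X0 : 0 <= X by rewrite -EX cnorm_ge0.
have [U nU] : exists U : C, |[U]| = X + 4 * D.
  by exists (X + 4 * D)%:C; rewrite cnorm_real ger0_norm//; lra.
have zX j : |[z j]| <= X by case: j => [|j]; [rewrite EX | have := zr j.+1 isT; lra].
have cr1 (s : R) : X <= s -> forall x, in_disc x -> |[x]| <= s.
  by move=> Xs x /cr xr; lra.
have [||g1 [y1 [hg1 cl1 y1o y1L [y10 y1z]]]] :=
    @steer R delta delta_gt1 c t eta kap eta_gt0 kap_ge0 gap_gt0 f z L r' r tau U hf tau0 _ zo zL zr
    rr cr.
- by move=> g hg cl; apply: fgood => //; apply: close_le cl => //; lra.
- by rewrite EX.
have {zo zL zr} y1r j : (0 < j)%N -> |[y1 j]| <= X + D.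
  by case: j => [//|j] _; have := cnorm_le_sub (y1 j.+1) (z j); have := y1z j; have := zX j; lra.
have y1U : X + 3 * D <= |[y1 0%N]| by have := cnorm_le_sub U (y1 0%N); rewrite cnormC; lra.
have y1X j : |[y1 j]| <= X + 5 * D.
  case: j => [|j]; last by have := y1r j.+1 isT; lra.
  by have := cnorm_le_sub (y1 0%N) U; lra.
have [||||g2 [y2 [hg2 cl2 y2o y2L [y20 y2z]]]] :=
    @steer R delta delta_gt1 c t eta kap eta_gt0 kap_ge0 gap_gt0 g1 y1 L.+1 (X + D) (X + 2 * D) tau w2
    hg1 tau0 _ y1o y1L y1r.
- move=> g hg cl; apply: fgood => //; apply: (@close_le _ r r (tau + tau) _) => //; first by lra.
  by apply: close_trans cl1 cl; lra.
- by lra.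
- by apply: cr1; lra.
- by lra.
have {y1o y1L y1r} y2r j : (0 < j)%N -> |[y2 j]| <= X + 6 * D.
  by case: j => [//|j] _; have := cnorm_le_sub (y2 j.+1) (y1 j); have := y2z j; have := y1X j; lra.
have y2Y : X + 7 * D <= |[y2 0%N]| by have := cnorm_le_sub w2 (y2 0%N); rewrite cnormC; lra.
have cl12 : close r (tau + tau) f g2 by apply: close_trans cl1 cl2; lra.
have [||||g3 [y3 [hg3 cl3 y3o y3L [y30 y3z]]]] :=
    @steer R delta delta_gt1 c t eta kap eta_gt0 kap_ge0 gap_gt0 g2 y2 L.+2 (X + 6 * D) (X + 6 * D + D / 2) tau w1
    hg2 tau0 _ y2o y2L y2r.
- move=> g hg cl; apply: fgood => //; apply: (@close_le _ r r (tau + tau + tau) _) =>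
    //; first by lra.
  by apply: close_trans cl12 cl; lra.
- by lra.
- by apply: cr1; lra.
- by lra.
exists g3, y3; split=> //.
  rewrite (_ : 3 * tau = tau + tau + tau); last by ring.
  by apply: close_trans cl12 cl3; lra.
by split=> //; have := cnorm_tri (y2 0%N) (y3 1%N) w2; have := y3z 0%N; lra.
Qed.

(* Three steering steps join an orbit that starts near [(b0, a0)] and escapes to a
   stable orbit that comes from far away; [pullback] then returns to [(b0, a0)]. *)
Lemma density_step f (r e rho : R) a0 b0 : holo f -> 0 < e -> 0 < rho ->
  (forall g, holo g -> close r e f g -> good g) -> (forall x, in_disc x -> |[x]| <= r) ->
  exists g y L, [/\ holo g, close r e f g, horbit g y,
    forall n, (L <= n)%N -> in_disc (y n) &
    |[y 0%N - a0]| <= rho /\ |[y 1%N - b0]| <= rho].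
Proof.
move=> hf e0 rho0 fgood cr.
have gf : good f by apply: fgood => // x _; rewrite subrr cnorm0 ltW.
have r_ge0 : 0 <= r by apply: le_trans (cnorm_ge0 c) (cr c _); rewrite subrr cnorm0 ltW.
(* This disc contains that of the saddle and all starting values within [rho] of [a0] or [b0]; the
   escape therefore occurs at an index at least 2. *)
pose R1 := r + (|[a0]| + rho) + (|[b0]| + rho).
have := cnorm_ge0 a0; have := cnorm_ge0 b0 => b0_ge0 a0_ge0.
have [z' [L' [z'o z'L z'0]]] := stable_unbounded delta_gt1 eta_gt0 kap_ge0 gap_gt0 R1 hf gf.
have [m /= zm zlast] : exists2 m, (fun n => R1 < |[z' n]|) m & forall k, (m < k)%N ->
    ~~ (R1 < |[z' k]|).
  apply: (@last_exit (fun n => R1 < |[z' n]|) 0%N L' z'0) => k Lk.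
  by rewrite -leNgt; have := cr _ (z'L k Lk); rewrite /R1; lra.
pose z n := z' (n + m)%N.
have zo : horbit f z := orbit_shift m z'o.
have zL n : (L' <= n)%N ->
    in_disc (z n) by move=> Ln; apply: z'L; rewrite (leq_trans Ln)// leq_addr.
have zr n : (0 < n)%N ->
    |[z n]| <= R1 by move=> n0; rewrite leNgt; apply: zlast; rewrite -addn1 addnC leq_add2r.
set X := |[z 0%N]|; have RX : R1 < X by [].
have rho2 : 0 < rho / 2 by lra.
have X0 : 0 < X by rewrite /R1 in RX; lra.
have [a [b [n [ha hb hn hlt]]]] := generic_escape delta_gt1 a0 b0 hf rho2 X0.
have n2 : (1 < n)%N.
  rewrite ltnNge; apply/negP => n1; move: hn; apply/negP; rewrite -leNgt; move: n1.
  case: (n) => [ | [ | // ] ] _ /=.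
    by apply: le_trans (ltW RX); have := cnorm_le_sub a a0; rewrite /R1; lra.
  by apply: le_trans (ltW RX); have := cnorm_le_sub b b0; rewrite /R1; lra.
case: n n2 hn hlt => [// | [// | k] ] _ hn hlt.
pose q := forward f a b; rewrite -/q in hn hlt.
have [r1a [Rr1 r1X hr1]] := @finite_bound (fun j => |[q j]|) R1 X k.+2 RX hlt.
(* The escaping orbit before its exit and the stable orbit after its first term stay within [r1a];
   the powers are to be negligible up to [r1], which is still below [X]. *)
pose r1 := (r1a + X) / 2.
have r1ar1 : r1a < r1 by rewrite /r1; lra.
have r1X' : r1 < X by rewrite /r1; lra.
have [||Kp [ep [Kp1 ep0 Hp]]] := @pullback R delta delta_gt1 f q r1a r1 k.+1 hf r1ar1.
- by move=> j _; exact: orbit_forward.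
- by move=> j /andP[j0 jk]; exact: hr1.
pose Y := |[q k.+2]|; pose D := (Y - X) / 8.
have D0 : 0 < D by rewrite divr_gt0// subr_gt0.
have YD : Y = X + 8 * D by rewrite /D; lra.
have Kp0 : 0 < Kp by lra.
have [tau [tau0 tauD tau_e tau_ep tauK]] : exists tau : R, [/\ 0 < tau, tau <= D,
    3 * tau <= e, 3 * tau <= ep & Kp * (3 * tau) <= rho / 2].
  pose mm := Num.min (Num.min D (e / 3)) (Num.min (ep / 3) (rho / 2 / (3 * Kp))).
  exists mm; have q0 : 0 < rho / 2 / (3 * Kp) by rewrite !divr_gt0// mulr_gt0.
  have h1 : mm <= D by rewrite !ge_min lexx.
  have h2 : mm <= e / 3 by rewrite !ge_min lexx !orbT.
  have h3 : mm <= ep / 3 by rewrite !ge_min lexx !orbT.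
  have h4 : mm <= rho / 2 / (3 * Kp) by rewrite !ge_min lexx !orbT.
  split; [|exact: h1|lra|lra|].
  - by rewrite !lt_min D0 q0 !divr_gt0.
  - by move: h4; rewrite ler_pdivlMr ?mulr_gt0//; lra.
have rr1 : r <= r1 by rewrite /R1 in Rr1; lra.
have [|g3 [y3 [hg3 cl3 y3o y3L [y30 y31]]]] := @steer_thrice f z L' R1 r1 D tau (q k.+1) (q k.+2)
    hf tau0 tauD _ zo zL zr (le_lt_trans Rr1 r1ar1) (fun x xc => le_trans (cr x xc) rr1) r1X' YD.
  by move=> g hg cl; apply: fgood => //; apply: close_le cl.
have [||y [yo yk yq]] := Hp (3 * tau) g3 y3 tau_ep y3o cl3.
- by lra.
- by lra.
(* Three indices for the prepended terms, [k.+1] for the pullback. *)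
exists g3, y, (L'.+3 + k.+1)%N; split=> //.
- by apply: close_le cl3.
- move=> j Lj; have kj : (k.+1 <= j)%N by apply: leq_trans Lj; rewrite leq_addl.
  by rewrite -(subnK kj) yk; apply: y3L; rewrite ltn_subRL addnC; exact: Lj.
split.
  have := yq 0%N isT; rewrite -[q 0%N]/a => h; have := cnorm_tri a (y 0%N) a0; lra.
have := yq 1%N isT; rewrite -[q 1%N]/b => h; have := cnorm_tri b (y 1%N) b0; lra.
Qed.

End Saddle.

End Density.

(** * Creation of saddles by perturbation *)

Section SaddleCreation.
Variable R : realType.
Local Notation C := (R[i]).
Variable delta : C.
Hypothesis delta_gt1 : 1 < |[delta]|.
Implicit Types (f g h : C -> C) (a b c t x w : C).

(** Half of the excess [G] is spent on [kap], the other half is the gap. Near [c] the function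
    [f x - t * x] is constant to first order, so [h] is at most [kap / 16 * rho] on the disc of
    radius [rho] for every [g] close to [f]; [cauchy_lip] turns this into the Lipschitz constant
    [kap] on the half disc. *)
Lemma good_near_saddle f c t : holo f -> cdiff f c t -> f c = (1 + delta) * c ->
  1 + |[delta]| < |[t]| -> exists eta kap r1 e1 : R,
  [/\ 0 < eta, 0 <= kap, 0 < gap delta t kap, 0 < e1 &
    forall g, holo g -> close r1 e1 f g -> good delta c eta t kap g].
Proof.
move=> hf hd fc ht; set G := |[t]| - 1 - |[delta]|; have G0 : 0 < G by rewrite /G; lra.
pose kap := G / 2; have k32 : 0 < kap / 32 by rewrite /kap; lra.
have [rho rho0 hrho] := hd _ k32.
exists (rho / 2), kap, (|[c]| + rho), (Num.min (kap / 32 * rho) (G / 16 * rho)); split.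
- by rewrite divr_gt0.
- by rewrite /kap; lra.
- by rewrite /gap /kap -/G; lra.
- by rewrite lt_min (mulr_gt0 k32 rho0) mulr_gt0// divr_gt0.
move=> g hg cl; split=> [x w xc wc|].
  pose h y := g y - t * y - (f c - t * c).
  have hh : holo h.
    exact: holoB (holoB hg (holoM (holo_cst _) (@holo_id R))) (holo_cst _).
  have := @cauchy_lip R h c x w rho (kap / 16 * rho) hh rho0.
  rewrite (_ : h x - h w = g x - t * x - (g w - t * w)); last by rewrite /h; ring.
  rewrite (_ : 16 * (kap / 16 * rho) / rho = kap); last by field; rewrite gt_eqF.
  apply=> // y yc; have yr : |[y]| <= |[c]| + rho by have := cnorm_le_sub y c; lra.
  have := cl y yr; rewrite le_min => /andP[h1 _].
  have := hrho _ yc; rewrite [c + _]addrC subrK => h2.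
  rewrite (_ : h y = (f y - f c - t * (y - c)) + (g y - f y)); last by rewrite /h; ring.
  have := cnormD (f y - f c - t * (y - c)) (g y - f y).
  have := ler_wpM2l (ltW k32) yc; lra.
have cr : |[c]| <= |[c]| + rho by lra.
have := cl c cr; rewrite le_min fc => /andP[_ h].
by apply: le_trans h _; rewrite /gap /kap -/G; lra.
Qed.

(** The saddle is created at [c] outside the disc where [f] has to be preserved: an affine factor
    times [(x / c) ^ N] prescribes the value, making [(c, c)] fixed, and the derivative. The
    coefficient [be N] compensates the derivative of the power and grows linearly in [N], which
    [th ^ N] outweighs. *)
Lemma make_saddle f (r e : R) : holo f -> 0 < e -> exists g c t,
  [/\ holo g, close r e f g, cdiff g c t, g c = (1 + delta) * c & 1 + |[delta]| < |[t]|].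
Proof.
move=> hf e0; pose r' := `|r| + 1; have r0 : 0 <= `|r| := normr_ge0 r.
pose c : C := (r' + 1)%:C.
have nc : |[c]| = r' + 1 by rewrite cnorm_real ger0_norm// /r'; lra.
have c0 : c != 0 by rewrite -cnorm_gt0 nc /r'; lra.
have cp : 0 < |[c]| by rewrite cnorm_gt0.
pose t : C := (|[delta]| + 2)%:C.
have nt : |[t]| = |[delta]| + 2 by rewrite cnorm_real ger0_norm//; have := delta_gt1; lra.
have [f' hf'] := hf c.
pose al := (1 + delta) * c - f c.
pose be N : C := t - f' - al * N%:R / c.
pose th := r' / |[c]|.
have th01 : 0 <= th < 1 by rewrite /th nc divr_ge0 ?ltr_pdivrMr /r' ?mul1r//; lra.
pose K := |[al]| + (|[t]| + |[f']| + |[al]| / |[c]|) * (2 * |[c]|).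
have ac0 : 0 <= |[al]| / |[c]| by rewrite divr_ge0 ?cnorm_ge0.
have K0 : 0 <= K.
  by rewrite /K addr_ge0 ?cnorm_ge0// mulr_ge0// ?addr_ge0 ?cnorm_ge0// mulr_ge0// cnorm_ge0.
have K1 : 0 < K + 1 by lra.
have [N0 hN0] := natX_small th01 (divr_gt0 e0 K1).
pose N := N0.+1; have := hN0 N (leqnSn _); rewrite ler_pdivlMr// => hN.
pose p x := (al + be N * (x - c)) * (x / c) ^+ N.
have hX : cdiff (fun x => (x / c) ^+ N) c (N%:R / c).
  suff H n : cdiff (fun x => (x / c) ^+ n) c (n%:R / c) by exact: H.
  elim: n => [|n IH]; first by rewrite mul0r; exact: cdiff_cst.
  have hq : cdiff (fun x => x / c) c (c^-1).
    have := cdiff_scale c^-1 (cdiff_id c); rewrite mulr1.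
    by congr cdiff; apply/funext => x; rewrite mulrC.
  have := cdiffM hq IH; rewrite divff// expr1n.
  rewrite (_ : c^-1 * 1 + 1 * (n%:R / c) = n.+1%:R / c); last by rewrite -natr1; ring.
  by congr cdiff; apply/funext => x; rewrite exprS.
have hp : cdiff p c (be N + al * (N%:R / c)).
  have h1 := cdiffD (cdiff_cst al c) (cdiff_scale (be N) (cdiffB (cdiff_id c) (cdiff_cst c c))).
  have := cdiffM h1 hX; rewrite divff// expr1n subrr mulr0 addr0 subr0 add0r !mulr1.
  exact.
exists (fun x => f x + p x), c, t; split.
- apply: holoD => //; apply: holoM.
    exact: holoD (holo_cst _) (holoM (holo_cst _) (holoB (@holo_id R) (holo_cst _))).
  by apply: holoX; exact: holoM (@holo_id R) (holo_cst _).
- move=> x xr; have xr' : |[x]| <= r' by have := ler_norm r; rewrite /r'; lra.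
  rewrite addrC addKr /p cnormM cnormX.
  have q1 : |[x / c]| ^+ N <= th ^+ N.
    have tp : 0 <= th by case/andP: th01.
    by rewrite lerXn2r ?nnegrE ?cnorm_ge0// cnormM cnormV ler_wpM2r// invr_ge0 ltW.
  have N1 : 1 <= N%:R :> R by rewrite ler1n.
  have xc : |[x - c]| <= 2 * |[c]| by have := cnormB x c; rewrite nc; lra.
  have nb : |[be N]| <= (|[t]| + |[f']| + |[al]| / |[c]|) * N%:R.
    rewrite /be; apply: le_trans (cnormB _ _) _; rewrite !cnormM cnormV cnorm_nat.
    have := cnormB t f'; have := cnorm_ge0 t; have := cnorm_ge0 f'.
    rewrite (_ : |[al]| * N%:R / |[c]| = |[al]| / |[c]| * N%:R); last by rewrite mulrAC.
    move=> h1 h2 h3.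
    have := ler_wpM2l h1 N1; have := ler_wpM2l h2 N1; lra.
  have q2 : |[al + be N * (x - c)]| <= K * N%:R.
    apply: le_trans (cnormD _ _) _; rewrite cnormM.
    have := ler_pM (cnorm_ge0 _) (cnorm_ge0 _) nb xc; have := ler_wpM2l (cnorm_ge0 al) N1.
    by rewrite /K; lra.
  apply: le_trans (ler_pM (cnorm_ge0 _) _ q2 q1) _; first by rewrite exprn_ge0// cnorm_ge0.
  have : 0 <= N%:R * th ^+ N by rewrite mulr_ge0// exprn_ge0//; case/andP: th01.
  by lra.
- have := cdiffD hf' hp; congr cdiff; rewrite /be; ring.
- by rewrite /p subrr mulr0 addr0 divff// expr1n mulr1 /al; ring.
- by rewrite nt; lra.
Qed.

End SaddleCreation.

(** * Locally uniform limits *)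

Section Weierstrass.
Variable R : realType.
Local Notation C := (R[i]).
Implicit Types (f g : C -> C) (z d : C).

(** Weierstrass's theorem: Cauchy's estimates applied to [g m - g n] make the derivatives converge
    and bound the difference of the increments linearly in [h]. *)
Lemma holo_limit f :
  (forall r e : R, 0 < e -> exists2 g, holo g & close r e f g) -> holo f.
Proof.
move=> H z.
have half01 : 0 <= (2^-1 : R) < 1 by lra.
pose r := |[z]| + 1.
have e0 n : 0 < 2^-1 ^+ n :> R by rewrite exprn_gt0// invr_gt0.
have [g hg] := choice (fun n => let: ex_intro2 g h1 h2 := H r _ (e0 n) in ex_intro (fun g =>
    holo g /\ close r (2^-1 ^+ n) f g) g (conj h1 h2)).
have [d hd] := choice (fun n => (hg n).1 z).
have zr w : |[w - z]| <= 1 -> |[w]| <= r by move=> wz; have := cnorm_le_sub w z; rewrite /r; lra.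
have gg m n w : |[w - z]| <= 1 -> |[g m w - g n w]| <= 2^-1 ^+ m + 2^-1 ^+ n.
  move=> /zr wr; have := (hg m).2 w wr; have := (hg n).2 w wr.
  by have := cnorm_tri (f w) (g m w) (g n w); rewrite [|[f w - _]|]cnormC; lra.
have hB m n : holo (fun w => g m w - g n w) by apply: holoB; [exact: (hg m).1 | exact: (hg n).1].
have dd m n : |[d m - d n]| <= 8 * (2^-1 ^+ m + 2^-1 ^+ n).
  have := @cauchy_deriv R _ z _ 1 (2^-1 ^+ m + 2^-1 ^+ n) (hB m n) (cdiffB (hd m) (hd n)) ltr01.
  by rewrite divr1; apply => w; exact: gg.
have lipg m n h : |[h]| <= 1 / 2 ->
    |[(g m (z + h) - g n (z + h)) - (g m z - g n z)]| <= 16 * (2^-1 ^+ m + 2^-1 ^+ n) * |[h]|.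
  move=> h2; have := @cauchy_lip R _ z (z + h) z 1 (2^-1 ^+ m + 2^-1 ^+ n) (hB m n) ltr01 (fun w => gg m n w).
  rewrite divr1 [z + h - z]addrC addKr; apply => //.
  by rewrite subrr cnorm0; lra.
have [|d0 hd0] := @geo_lim R d 12 2^-1 half01.
  move=> n; apply: le_trans (dd _ _) _; rewrite exprS; have := e0 n; lra.
(* [65 = 16 + 1 + 48]: the Lipschitz bound for [f - g n], the differentiability of [g n], and the
   distance from [d n] to [d0]. *)
exists d0 => e e_gt0; have e6 : 0 < e / 65 by rewrite divr_gt0.
have [n /(_ n (leqnn _))] := geo_small 1 half01 e6; rewrite mul1r => hn.
have dn : |[d n - d0]| <= 48 * 2^-1 ^+ n.
  by apply: le_trans (hd0 n) _; rewrite (_ : 2 * _ = 48)//; field.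
have [s s0 hs] := hd n _ e6.
exists (Num.min s (1 / 2)) => [|h]; first by rewrite lt_min s0 divr_gt0.
rewrite le_min => /andP[hs1 h2].
have fg : |[(f (z + h) - g n (z + h)) - (f z - g n z)]| <= 16 * 2^-1 ^+ n * |[h]|.
  apply/ler_addgt0Pr => a a0.
  have a4 : 0 < a / 18 by rewrite divr_gt0.
  have [m /(_ m (leqnn _))] := geo_small 1 half01 a4; rewrite mul1r => hm.
  have z1 : |[z - z]| <= 1 by rewrite subrr cnorm0.
  have zh1 : |[z + h - z]| <= 1 by rewrite addrC addKr; lra.
  have := (hg m).2 _ (zr _ z1); have := (hg m).2 _ (zr _ zh1); have := lipg m n h h2.
  have := ler_wpM2l (ltW (e0 m)) h2.
  have -> : f (z + h) - g n (z + h) - (f z - g n z) = (g m (z + h) - g n (z + h) - (g m z - g n z))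
    - (g m (z + h) - f (z + h)) + (g m z - f z) by ring.
  have := cnormD (g m (z + h) - g n (z + h) - (g m z - g n z) - (g m (z + h) - f (z + h))) (g m z - f z).
  have := cnormB (g m (z + h) - g n (z + h) - (g m z - g n z)) (g m (z + h) - f (z + h)).
  lra.
have -> : f (z + h) - f z - d0 * h = ((f (z + h) - g n (z + h)) - (f z - g n z)) +
  (g n (z + h) - g n z - d n * h) + (d n - d0) * h by ring.
apply: le_trans (cnormD _ _) _; rewrite cnormM.
have := cnormD ((f (z + h) - g n (z + h)) - (f z - g n z)) (g n (z + h) - g n z - d n * h).
have := hs _ hs1; have := ler_wpM2r (cnorm_ge0 h) dn; have := ler_wpM2r (cnorm_ge0 h) hn.
by lra.
Qed.

Lemma close_sequence_limit (u : nat -> C -> C) (r e : nat -> R) :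
  (forall n, holo (u n)) -> (forall n, r n + 1 <= r n.+1) ->
  (forall n, 0 < e n) -> (forall n, e n.+1 <= e n / 2) ->
  (forall n, close (r n) (e n / 2) (u n) (u n.+1)) ->
  exists2 f, holo f & forall n, close (r n) (e n) (u n) f.
Proof.
move=> hu hr e0 he hcl.
have half01 : 0 <= (2^-1 : R) < 1 by lra.
have rm m k : r m <= r (m + k)%N.
  elim: k => [|k IH]; first by rewrite addn0.
  by rewrite addnS; apply: le_trans IH _; apply: le_trans (hr _); lra.
have ek m k : e (m + k)%N <= e m * 2^-1 ^+ k.
  elim: k => [|k IH]; first by rewrite addn0 expr0 mulr1.
  by rewrite addnS exprS; apply: le_trans (he _) _; lra.
have step m k z : |[z]| <= r m -> |[u (m + k).+1 z - u (m + k)%N z]| <= e m / 2 * 2^-1 ^+ k.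
  move=> zr; apply: le_trans (hcl (m + k)%N z (le_trans zr (rm m k))) _.
  by have := ek m k; lra.
have sum m k z : |[z]| <= r m -> |[u (m + k)%N z - u m z]| <= e m * (1 - 2^-1 ^+ k).
  move=> zr; elim: k => [|k IH]; first by rewrite addn0 subrr cnorm0 expr0 subrr mulr0.
  rewrite addnS; apply: le_trans (cnorm_tri (u (m + k)%N z) _ _) _.
  by have := step m k z zr; rewrite exprS; lra.
have large z : exists m, |[z]| <= r m.
  have rn n : r 0%N + n%:R <= r n.
    elim: n => [|n IH]; first by rewrite addr0.
    by rewrite -natr1; have := hr n; lra.
  have [n hn] := natr_unbounded (|[z]| - r 0%N); exists n; have := rn n; lra.
have lim z : exists l, forall a : R, 0 < a -> exists N, forall n, (N <= n)%N -> |[u n z - l]| <= a.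
  have [m zm] := large z.
  have [|l hl] := @geo_lim R (fun k => u (m + k)%N z) (e m / 2) 2^-1 half01.
    by move=> k; rewrite addnS; exact: step.
  exists l => a a0; have [N hN] := geo_small (2 * (e m / 2 / (1 - 2^-1))) half01 a0.
  exists (m + N)%N => n mn; have mn' : (m <= n)%N by apply: leq_trans mn; rewrite leq_addr.
  rewrite -(subnKC mn'); apply: le_trans (hl _) (hN _ _).
  by rewrite leq_subRL.
have [f hf] := choice lim.
have clf m : close (r m) (e m) (u m) f.
  move=> z zr; apply/ler_addgt0Pr => a a0; have [N hN] := hf z a a0.
  have := hN (m + N)%N (leq_addl _ _); rewrite cnormC => h1.
  have h2 := sum m N z zr; have h3 : 0 <= e m * 2^-1 ^+ N.
    by rewrite mulr_ge0 ?(ltW (e0 m))// exprn_ge0//; case/andP: half01.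
  by have := cnorm_tri (u (m + N)%N z) (f z) (u m z); lra.
exists f => //; apply: holo_limit => r0 a a0.
have [m hm] := large (r0%:C); rewrite cnorm_real in hm.
have [N hN] := geo_small (e m) half01 a0.
exists (u (m + N)%N) => // z zr; rewrite cnormC.
have zrm : |[z]| <= r (m + N)%N.
  by apply: le_trans (rm m N); apply: le_trans hm; apply: le_trans (ler_norm r0).
by apply: le_trans (clf _ _ zrm) _; apply: le_trans (ek _ _) (hN _ (leqnn _)).
Qed.

End Weierstrass.

(** * The space of Henon maps *)

Section HenonTopology.
Variable K : numClosedFieldType.
Implicit Types (f g : K -> K) (z w d : K).

Lemma diff_quotientP f z d :
  (h^-1 *: (f (h *: (1 : K) + z) - f z) @[h --> 0^'] --> d) <->
  (forall e : K, 0 < e -> exists2 r : K, 0 < r &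
    forall h, `|h| < r -> `|f (z + h) - f z - d * h| <= e * `|h|).
Proof.
have E h : h != 0 -> `|f (z + h) - f z - d * h| = `|d - h^-1 *: (f (h *: (1:K) + z) - f z)| * `|h|.
  move=> h0; rewrite -normrM -normrN; congr `|_|; rewrite /GRing.scale /= mulr1 [h + z]addrC.
  by field.
rewrite cvgrPdist_le; split=> H e /H.
  rewrite near_withinE => /nbhs_ballP[r /= r0 hr]; exists r => // h hlt.
  have [->|h0] := eqVneq h 0; first by rewrite addr0 subrr mulr0 subr0 normr0 mulr0.
  have := hr h _ h0; rewrite -ball_normE /= sub0r normrN => /(_ hlt) h1.
  by rewrite E// ler_wpM2r.
move=> [r r0 hr]; rewrite near_withinE; apply/nbhs_ballP; exists r => //= h.
rewrite -ball_normE /= sub0r normrN => hlt h0.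
by have := hr h hlt; rewrite E// ler_pM2r ?normr_gt0.
Qed.

Lemma derivable_quotient f z : derivable f z 1 <-> exists d, forall e : K, 0 < e ->
  exists2 r : K, 0 < r & forall h, `|h| < r -> `|f (z + h) - f z - d * h| <= e * `|h|.
Proof.
split=> [/cvg_ex[d hd] | [d hd]]; first by exists d; apply/diff_quotientP.
by apply/cvg_ex; exists d; apply/diff_quotientP.
Qed.

Lemma entire_continuous f : entire f -> continuous f.
Proof. by move=> hf z; apply/differentiable_continuous/derivable1_diffP. Qed.

Lemma henon_continuous delta f : entire f -> continuous (henon delta f).
Proof.
move=> /entire_continuous hf q.
have h1 : p.1 @[p --> q] --> q.1 by exact: cvg_fst.
have h2 : p.2 @[p --> q] --> q.2 by exact: cvg_snd.
have h3 : (f p.1 - delta * p.2) @[p --> q] --> f q.1 - delta * q.2.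
  apply: cvgB; last by apply: cvgM => //; exact: cvg_cst.
  by apply: (@cvg_comp _ _ _ fst f _ (nbhs q.1)) => //; exact: hf.
exact: (cvg_pair h3 h1).
Qed.

Lemma nbhs_pair_ball (q : K * K) (A : set (K * K)) : nbhs q A <->
  exists2 r : K, 0 < r & forall z w, `|z - q.1| < r -> `|w - q.2| < r -> A (z, w).
Proof.
rewrite nbhs_ballP; split=> -[r /= r0 hr]; exists r => //.
  move=> z w hz hw; apply: hr; split; rewrite -ball_normE /= distrC //.
move=> [z w] [/= hz hw]; rewrite -ball_normE /= in hz hw.
by apply: hr; rewrite distrC.
Qed.

Lemma compact_norm_bounded (V : normedModType K) (A : set V) : compact A ->
  exists2 r : K, 0 <= r & forall x, A x -> `|x| <= r.
Proof.
pose F : set_system K := filter_from [set r : K | 0 <= r] (fun r => [set s | r <= s]).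
have FF : Filter F.
  apply: filter_from_filter; first by exists 0; rewrite /= lexx.
  move=> r r' /= r0 r'0; exists (r + r'); first by rewrite /= addr_ge0.
  by move=> s /= rs; split; apply: le_trans rs; rewrite ?lerDl ?lerDr.
move=> /compact_near_coveringP/(_ _ F (fun r x => `|x| <= r) FF)[].
  move=> x Ax; exists (ball x 1, [set s | `|x| + 1 <= s]) => /=.
    by split; [exact: nbhsx_ballx | exists (`|x| + 1) => //=; rewrite addr_ge0].
  move=> [y s] /= [xy xs]; apply: le_trans xs; rewrite -ball_normE /= in xy.
  rewrite -[y](subrK x) addrC (le_trans (ler_normD _ _))// lerD2l.
  by rewrite distrC ltW.
by move=> r r0 hr; exists r => // x Ax; apply: hr => //=; rewrite lexx.
Qed.

(** The sets of Henon maps whose functions are uniformly close to [f] on a disc generate a filter;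
    it converges uniformly on compact sets, hence in the compact-open topology, so every
    neighbourhood contains one of these sets. *)
Lemma nbhs_henon_close delta f (A : set {compact-open, (K * K)%type -> (K * K)%type}) :
  entire f -> nbhs (henon delta f : {compact-open, _ -> _}) A ->
  exists2 e : K, 0 < e & exists r : K,
    forall g, (forall z, `|z| <= r -> `|g z - f z| < e) -> A (henon delta g).
Proof.
move=> hf hA.
pose B (re : K * K) := [set G : K * K -> K * K | exists2 g, G = henon delta g &
  forall z, `|z| <= re.1 -> `|g z - f z| < re.2].
pose D := [set re : K * K | 0 < re.2 /\ 0 <= re.1].
pose F : set_system (K * K -> K * K) := filter_from D B.
have FF : Filter F.
  apply: filter_from_filter; first by exists (0, 1); split => /=.
  move=> [r e] [r' e'] [/= e0 r0] [/= e'0 r'0].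
  have er : e \is Num.real by rewrite realE ltW.
  have e'r : e' \is Num.real by rewrite realE ltW.
  exists (r + r', Num.min e e');
    first by split=> /=; [rewrite comparable_lt_min ?e0// real_comparable | rewrite addr_ge0].
  move=> G [g -> hg]; split; exists g => // z zr;
    have := hg z; rewrite /= comparable_lt_min ?real_comparable//.
    by move=> /(_ (le_trans zr _))/andP[]//; rewrite lerDl.
  by move=> /(_ (le_trans zr _))/andP[]//; rewrite lerDr.
have : {compact-open, F --> henon delta f}.
  have H := @compact_open_fam_compactP ((K * K)%type : normedModType K) ((K *
      K)%type : normedModType K) _ F (henon_continuous (delta := delta) hf) FF.
  apply: (proj2 H).
  apply/fam_cvgP => Q cQ P /uniform_nbhs[E [entE hE]].
  move: entE; rewrite -entourage_ballE => -[e /= e0 he].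
  have [M M0 hM] := compact_norm_bounded cQ.
  exists (M, e); first by split.
  move=> G [g -> hg]; apply: hE => q Qq; apply: he; rewrite /henon /=; split => /=.
    rewrite -ball_normE /= distrC opprD opprK addrACA [- (_) + _]addrC subrr addr0.
    apply: hg; apply: le_trans (hM _ Qq); rewrite prod_normE /=.
    by rewrite comparable_le_max ?lexx// real_comparable.
  exact: ballxx.
move=> /(_ A hA)[[r e] [/= e0 r0] hB]; exists e => //; exists r => g hg.
by apply: hB; exists g.
Qed.

(** Uniform closeness is tested on the compact set [S] times [0], where the first coordinate of a
    Henon map is its function. Over the abstract field [K] a compact set containing the disc is
    assumed; [square_compact] supplies it. *)
Lemma henon_close_nbhs delta f (S : set K) (r e : K) : entire f -> compact S ->
  (forall z, `|z| <= r -> S z) -> 0 < e ->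
  nbhs (henon delta f : {compact-open, _ -> _})
    [set G | forall z, `|z| <= r -> `|(G (z, 0)).1 - f z| < e].
Proof.
move=> hf cS rS e0.
have cS0 : compact (S `*` [set (0 : K)]) by apply: compact_setX => //; exact: compact_set1.
have entE := entourage_ball (K * K)%type (PosNum e0).
have hid : {compact-open, nbhs (henon delta f : {compact-open, _ -> _}) --> henon delta f} by [].
have H := @compact_open_fam_compactP ((K * K)%type : normedModType K) ((K *
    K)%type : normedModType K) _ _ (henon_continuous (delta := delta) hf)
  (nbhs_filter (henon delta f : {compact-open, _ -> _})).
have {}hid := proj1 H hid.
have := hid _ (@fam_nbhs _ _ compact _ _ (henon delta f) entE cS0).
apply: filterS => G hG z zr; have /= [h _] := hG (z, 0) (conj (rS z zr) (erefl _)).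
by rewrite -ball_normE /= mulr0 subr0 distrC in h.
Qed.

End HenonTopology.

(** * Differential and eigenvalues of a Henon map *)

Section HenonDifferential.
Variable K : numClosedFieldType.

Lemma is_diff_fst (q : K * K) : is_diff q (fst : K * K -> K) fst.
Proof.
apply: DiffDef; first by apply: (@linear_differentiable _ _ _ fst) => x; exact: cvg_fst.
by rewrite (@diff_lin _ _ _ fst)// => x; exact: cvg_fst.
Qed.

Lemma is_diff_snd (q : K * K) : is_diff q (snd : K * K -> K) snd.
Proof.
apply: DiffDef; first by apply: (@linear_differentiable _ _ _ snd) => x; exact: cvg_snd.
by rewrite (@diff_lin _ _ _ snd)// => x; exact: cvg_snd.
Qed.

Lemma diff_henon (delta : K) (f : K -> K) (q v : K * K) : derivable f q.1 1 ->
  'd (henon delta f) q v = (derive1 f q.1 * v.1 - delta * v.2, v.1).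
Proof.
move=> df; have hf : is_diff (q.1) f (fun h => h *: derive1 f q.1).
  by apply: DiffDef; [exact/derivable1_diffP | exact/diff1E/derivable1_diffP].
have h1 := is_diff_comp (is_diff_fst q) hf.
have h2 := is_diffZ delta (is_diff_snd q).
have h3 := is_diff_pair (is_diffB h1 h2) (is_diff_fst q).
rewrite (@diff_val _ _ _ _ _ _ _ h3) /=; congr (_, _).
by rewrite /GRing.scale /= mulrC.
Qed.

Lemma henon_eigenvalue (delta : K) (f : K -> K) (x d l : K) :
  (forall e : K, 0 < e -> exists2 r : K, 0 < r &
    forall h, `|h| < r -> `|f (x + h) - f x - d * h| <= e * `|h|) ->
  l ^+ 2 - d * l + delta = 0 ->
  passmx.leigenvalue (linfun ('d (henon delta f) (x, x))) l.
Proof.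
move=> hd hl; have df : derivable f x 1 by apply/derivable_quotient; exists d.
have fd : derive1 f x = d.
  by rewrite derive1E /derive; apply: cvg_lim => //; exact/diff_quotientP.
rewrite /passmx.leigenvalue /passmx.leigenspace; apply/eqP => ker0.
(* The characteristic polynomial is [X ^ 2 - d * X + delta], and [(l, 1)] is an eigenvector for its
   root [l]. *)
have : (l, 1) \in lker (linfun ('d (henon delta f) (x, x)) - l *: \1%VF).
  rewrite memv_ker add_lfunE opp_lfunE scale_lfunE id_lfunE lfunE /= diff_henon//= fd.
  rewrite subr_eq0; apply/eqP; congr (_, _); rewrite /GRing.scale /= ?mulr1//.
  by apply/eqP; rewrite -subr_eq0 -oppr_eq0 -hl; apply/eqP; ring.
by rewrite ker0 memv0 => /eqP[_ /eqP]; rewrite oner_eq0.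
Qed.

End HenonDifferential.

(** * Neighbourhoods of Henon maps in terms of real bounds *)

Section ComplexBridge.
Variable R : realType.
Local Notation C := (R[i]).
Implicit Types (f g : C -> C) (z d : C).

Lemma ler_cnorm z (a : R) : (`|z| <= a%:C) = (|[z]| <= a).
Proof. by rewrite normcE lecR. Qed.

Lemma ltr_cnorm z (a : R) : (`|z| < a%:C) = (|[z]| < a).
Proof. by rewrite normcE ltcR. Qed.

Lemma gt0_complexP (e : C) : 0 < e -> exists2 a : R, 0 < a & e = a%:C.
Proof.
case: e => a b; rewrite ltcE /= => /andP[/eqP -> a0].
by exists a.
Qed.

Lemma cdiff_quotientP f z d : cdiff f z d <->
  (forall e : C, 0 < e -> exists2 r : C, 0 < r &
    forall h, `|h| < r -> `|f (z + h) - f z - d * h| <= e * `|h|).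
Proof.
split=> H e.
  move=> /gt0_complexP[a a0 ->]; have [r r0 hr] := H a a0.
  exists r%:C; first by rewrite ltcR.
  by move=> h; rewrite ltr_cnorm => /ltW/hr; rewrite !normcE -rmorphM lecR.
move=> e0; have [|r' /gt0_complexP[r r0 ->] hr] := H e%:C; first by rewrite ltcR.
exists (r / 2) => [|h hr2]; first by rewrite divr_gt0.
have := hr h; rewrite ltr_cnorm !normcE -rmorphM lecR; apply.
by apply: le_lt_trans hr2 _; lra.
Qed.

Lemma entire_holo f : entire f <-> holo f.
Proof.
split=> hf z; have := hf z.
  by move=> /derivable_quotient[d hd]; exists d; apply/cdiff_quotientP.
by move=> [d /cdiff_quotientP hd]; apply/derivable_quotient; exists d.
Qed.

Let K : numClosedFieldType := R[i].

Lemma square_compact (r : R) : exists2 S : set K, compact S & forall z : C, |[z]| <= r -> S z.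
Proof.
pose I : set R := [set` `[- r, r]].
have cI : compact (I `*` I) by apply: compact_setX; exact: segment_compact.
exists ((fun p : R * R => (p.1 +i* p.2 : K)) @` (I `*` I)); last first.
  case=> x y h; exists (x, y) => //; split; rewrite /I /= in_itv /= -ler_norml.
    exact: le_trans (cnorm_Re (x +i* y)) h.
  exact: le_trans (cnorm_Im (x +i* y)) h.
apply: continuous_compact cI; apply: continuous_subspaceT => -[x y].
apply/(@cvgrPdist_le K K) => e /gt0_complexP[a a0 ->].
have a2 : 0 < a / 2 by rewrite divr_gt0.
exists (ball x (a / 2), ball y (a / 2)) => /=; first by split; exact: nbhsx_ballx.
move=> [x' y'] [/= hx hy]; rewrite -ball_normE /= in hx hy; rewrite ler_cnorm.
by apply: le_trans (cnorm_ReIm _) _ => /=; lra.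
Qed.

Variable delta : C.
Local Notation H := (henon_maps delta).

Definition henon_fun (F : H) z := (set_val F (z, 0)).1.

Lemma henon_funE (F : H) : set_val F = henon delta (henon_fun F) /\ holo (henon_fun F).
Proof.
have [f hf E'] := set_mem (valP F); have E : set_val F = henon delta f := E'.
have Ef : henon_fun F = f by apply/funext => z; rewrite /henon_fun E /henon /= mulr0 subr0.
by rewrite Ef E; split=> //; exact/entire_holo.
Qed.

Lemma henon_exists f : holo f -> exists F : H, henon_fun F = f.
Proof.
move=> hf; have hF : henon delta f \in henon_maps delta.
  by apply/mem_set; exists f => //; exact/entire_holo.
exists (exist _ (henon delta f) hF); apply/funext => z.
by rewrite /henon_fun /= mulr0 subr0.
Qed.

Lemma nbhs_close (F : H) (A : set H) : nbhs F A -> exists r e : R,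
  0 < e /\ forall G : H, close r e (henon_fun F) (henon_fun G) -> A G.
Proof.
have [EF hF] := henon_funE F.
rewrite nbhsE => -[V [[W oW <-] /= WF] VA].
have nW : nbhs (henon delta (henon_fun F) : {compact-open, _ -> _}) W.
  by rewrite -EF; apply: open_nbhs_nbhs.
have [e' /gt0_complexP[e e0 ->] [r' hr]] := nbhs_henon_close ((entire_holo _).2 hF) nW.
exists |[r']|, (e / 2); split=> [|G hG]; first by rewrite divr_gt0.
apply: VA; rewrite /= (henon_funE G).1; apply: hr => z zr.
rewrite ltr_cnorm; apply: le_lt_trans (hG z _) _; last by lra.
have r'0 : 0 <= r' by apply: le_trans zr.
by rewrite -lecR -!normcE (ger0_norm r'0).
Qed.

Lemma close_nbhs (F : H) (r e : R) : 0 < e ->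
  nbhs F [set G : H | close r e (henon_fun F) (henon_fun G)].
Proof.
move=> e0; have [EF hF] := henon_funE F.
have [S cS rS] := square_compact r.
have eC : 0 < e%:C :> C by rewrite ltcR.
have := @henon_close_nbhs _ delta (henon_fun F) S r%:C e%:C ((entire_holo _).2 hF) cS _ eC.
rewrite -EF => hn.
have {}hn := hn (fun z zr => rS z ltac:(by rewrite -ler_cnorm)).
have hc := @initial_continuous H _ set_val F _ hn.
apply: (@filterS _ (nbhs F) _ _ _ _ hc) => G hG z zr; apply: ltW.
by rewrite -ltr_cnorm; apply: hG; rewrite ler_cnorm.
Qed.

End ComplexBridge.

(** * Genericity *)

Section Genericity.
Variable R : realType.
Local Notation C := (R[i]).
Variable delta : C.
Hypothesis delta_gt1 : 1 < |[delta]|.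
Local Notation H := (henon_maps delta).
Local Notation fn := (@henon_fun R delta).
Local Notation horbit := (horbit delta).
Implicit Types (F G : H) (A O : set H).

Lemma open_close A : (forall F, A F -> exists r e : R, 0 < e /\
    forall G, close r e (fn F) (fn G) -> A G) -> open A.
Proof.
move=> hA; rewrite openE => F /hA[r [e [e0 h]]].
by apply: (@filterS _ (nbhs F) _ _ _ h); exact: close_nbhs.
Qed.

(** The conditions [close], with radii growing by at least one and errors at least halved, play the
    role of nested balls; [close_sequence_limit] provides a map satisfying all of them. *)
Lemma henon_baire (O : nat -> set H) :
  (forall n, open (O n)) -> (forall n, dense (O n)) -> dense (\bigcap_n O n).
Proof.
move=> oO dO W [F0 WF0] oW.
have inner n F (r e : R) : 0 < e -> exists F' (r' e' : R), [/\ r + 1 <= r', 0 < e', e' <= e / 2,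
    close r (e / 2) (fn F) (fn F') & forall G, close r' e' (fn F') (fn G) -> O n G].
  move=> e0; have e2 : 0 < e / 2 by rewrite divr_gt0.
  have [|F' [BF' OF']] := dO n _ _ (@open_interior _ [set G | close r (e / 2) (fn F) (fn G)]).
    by exists F; exact: close_nbhs.
  have nO : nbhs F' (O n) by apply: open_nbhs_nbhs.
  have [r1 [e1 [e10 h]]] := nbhs_close nO.
  exists F', (Num.max r1 (r + 1)), (Num.min e1 (e / 2)); split.
  - by rewrite le_max lexx orbT.
  - by rewrite lt_min e10.
  - by rewrite ge_min lexx orbT.
  - exact: interior_subset BF'.
  - by move=> G; move/close_le => hG; apply: h; apply: hG; rewrite ?le_max ?ge_min lexx.
have nW : nbhs F0 W by apply: open_nbhs_nbhs.
have [r0 [e0 [e00 hW]]] := nbhs_close nW.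
pose state := (H * (R * R))%type.
have next (ns : nat * state) : exists s' : state, 0 < ns.2.2.2 ->
    [/\ ns.2.2.1 + 1 <= s'.2.1, 0 < s'.2.2, s'.2.2 <= ns.2.2.2 / 2,
    close ns.2.2.1 (ns.2.2.2 / 2) (fn ns.2.1) (fn s'.1) &
    forall G, close s'.2.1 s'.2.2 (fn s'.1) (fn G) -> O ns.1 G].
  (* A state without a positive error bound gets a default successor; none occurs in the
     sequence. *)
  case: ns => n [F [r e]] /=; have [e_gt0|e_le0] := ltP 0 e; last by exists (F, (r, e)).
  by have [F' [r' [e' h]]] := inner n F r e e_gt0; exists (F', (r', e')).
have [nx hnx] := choice next.
pose s := fix s n : state := if n is m.+1 then nx (m, s m) else (F0, (r0, e0)).
have spos n : 0 < (s n).2.2 by elim: n => [//|n IH]; have [] := hnx (n, s n) IH.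
have hs n := hnx (n, s n) (spos n).
have [|||||f hf hcl] := @close_sequence_limit R (fun n => fn (s n).1) (fun n =>
    (s n).2.1) (fun n => (s n).2.2).
- by move=> n; exact: (henon_funE (s n).1).2.
- by move=> n; have [] := hs n.
- exact: spos.
- by move=> n; have [] := hs n.
- by move=> n; have [] := hs n.
have [F hF] := henon_exists delta hf; rewrite -hF in hcl.
exists F; split; first exact: hW (hcl 0%N).
by move=> n _; have [_ _ _ _ h] := hs n; apply: h; exact: (hcl n.+1).
Qed.

(** Constants that locate a saddle for all maps of an open set at once. *)
Record datum := Datum { center : C; mult : C; radius : R; slack : R }.

Definition datum_good d (f : C -> C) :=
  [/\ 0 < radius d, 0 <= slack d, 0 < gap delta (mult d) (slack d) &
      good delta (center d) (radius d) (mult d) (slack d) f].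

Lemma near_good_map (W : set H) : W !=set0 -> open W -> exists d V,
  [/\ open V, V !=set0, V `<=` W & forall F, V F -> datum_good d (fn F)].
Proof.
move=> [F WF] oW; have nW : nbhs F W by apply: open_nbhs_nbhs.
have [r [e [e0 hW]]] := nbhs_close nW.
have [g [c [t [hg gcl gc gfix ht]]]] := make_saddle delta_gt1 r (henon_funE F).2 e0.
have [eta [kap [r1 [e1 [eta0 kap0 gap0 e10 hgood]]]]] := good_near_saddle hg gc gfix ht.
have [G hG] := henon_exists delta hg.
pose V := W `&` interior [set G' | close r1 e1 (fn G) (fn G')].
exists (Datum c t eta kap), V; split.
- by apply: openI => //; exact: open_interior.
- exists G; split; first by apply: hW; rewrite hG.
  exact: close_nbhs.
- by move=> G' [].
- move=> G' [_ /interior_subset /= h]; split=> //=.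
  by apply: hgood; [exact: (henon_funE G').2 | rewrite -hG].
Qed.

Definition cell (X : set H * datum) :=
  [/\ open X.1, X.1 !=set0 & forall F, X.1 F -> datum_good X.2 (fn F)].

(** A maximal disjoint family meets every nonempty open set, as otherwise [near_good_map] would
    yield one more cell. Disjointness is expressed by equality of pairs, so that a map determines
    its datum too. *)
Lemma maximal_cells : exists AA : set (set H * datum),
  [/\ forall X, AA X -> cell X,
      forall X Y F, AA X -> AA Y -> X.1 F -> Y.1 F -> X = Y &
      forall W : set H, W !=set0 -> open W -> exists2 X, AA X & X.1 `&` W !=set0].
Proof.
pose P (AA : set (set H * datum)) := (forall X, AA X -> cell X) /\
  forall X Y F, AA X -> AA Y -> X.1 F -> Y.1 F -> X = Y.
have [|AA [[cA dA] maxA]] := @Zorn_bigcup (set H * datum)%type P.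
  move=> FF FP tot; split=> [X [AA FA AX] | X Y F [AA FA AX] [BB FB BY] XF YF].
    exact: (FP AA FA).1.
  have [AB|BA] := tot _ _ FA FB.
    by apply: (FP BB FB).2 XF YF => //; exact: AB.
  by apply: (FP AA FA).2 XF YF => //; exact: BA.
exists AA; split=> // W W0 oW; apply: contrapT => nex.
have [d [V [oV V0 VW hV]]] := near_good_map W0 oW.
have disj X F : AA X -> X.1 F -> ~ V F.
  by move=> AX XF VF; apply: nex; exists X => //; exists F; split=> //; exact: VW.
apply: (maxA (AA `|` [set (V, d)])); last first.
  split=> [X [AX|->] | X Y F [AX|->] [AY|->] //]; first exact: cA.
  - by split.
  - exact: dA.
  - by move=> XF VF; have := disj X F AX XF VF.
  - by move=> VF YF; have := disj Y F AY YF VF.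
split; first by move=> X AX; left.
move=> sub; have [F VF] := V0.
by apply: (disj (V, d) F) => //; apply: sub; right.
Qed.

(** The point of the orbit is [(y 1, y 0)], near [(b, a)]. Staying eventually in the disc replaces
    convergence to the saddle: it implies convergence by [orbit_tends] and is easier to follow under
    perturbation. *)
Definition stable_meets d (f : C -> C) (a b : C) (rho : R) :=
  exists y L, [/\ horbit f y, forall n, (L <= n)%N -> |[y n - center d]| <= radius d,
    |[y 0%N - a]| < rho & |[y 1%N - b]| < rho].

Lemma bounded_orbit (y : nat -> C) c (r : R) L : (forall n, (L <= n)%N -> |[y n - c]| <= r) ->
  exists M : R, forall n, |[y n]| <= M.
Proof.
move=> hy; suff [M hM] : exists M : R, forall n, (n < L)%N -> |[y n]| <= M.
  exists (Num.max M (|[c]| + r)) => n; rewrite le_max; have [nL|Ln] := ltnP n L.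
    by rewrite hM.
  by have := hy n Ln; have := cnorm_le_sub (y n) c =>
      h1 h2; rewrite [_ <= _ + r](le_trans h1) ?orbT// lerD2l.
elim: L {hy} => [|L [M hM]]; first by exists 0.
exists (Num.max M |[y L]|) => n; rewrite ltnS leq_eqVlt le_max => /orP[/eqP ->|/hM ->//].
by rewrite lexx orbT.
Qed.

Lemma stable_meets_open d F (V : set H) a b (rho : R) : open V -> V F ->
  (forall G, V G -> datum_good d (fn G)) -> stable_meets d (fn F) a b rho ->
  exists r e : R, 0 < e /\ forall G, close r e (fn F) (fn G) ->
    V G /\ stable_meets d (fn G) a b rho.
Proof.
move=> oV VF hV [y [L [yo yL ya yb]]].
have nV : nbhs F V by apply: open_nbhs_nbhs.
have [r0 [e0 [e00 hr0]]] := nbhs_close nV.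
have [M hM] := bounded_orbit yL.
have [eta0 kap0 gap0 _] := hV F VF.
pose r := Num.max (Num.max r0 (M + 1)) (|[center d]| + radius d).
have Mr : M < r.
  have : M + 1 <= r by rewrite !le_max lexx !orbT.
  by lra.
have dr x : |[x - center d]| <= radius d -> |[x]| <= r.
  move=> xc; apply: (@le_trans _ _ (|[center d]| + radius d)); last by rewrite le_max lexx orbT.
  by have := cnorm_le_sub x (center d); lra.
have [K [e1 [K0 e10 hK]]] := @stable_continuity R delta delta_gt1 (center d) (mult d) (radius d) (slack d)
  eta0 kap0 gap0 (fn F) y L M r (henon_funE F).2 yo yL (fun n _ => hM n) Mr dr.
(* Room left by the strict inequalities, within which the displacement [K * e] has to stay. *)
pose m := Num.min (rho - |[y 0%N - a]|) (rho - |[y 1%N - b]|).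
have m0 : 0 < m by rewrite lt_min !subr_gt0 ya yb.
have K1 : 0 < K + 1 by lra.
pose e := Num.min (Num.min e0 e1) (m / (2 * (K + 1))).
have ep : 0 < e by rewrite !lt_min e00 e10 divr_gt0// mulr_gt0.
have ee0 : e <= e0 by rewrite !ge_min lexx.
have ee1 : e <= e1 by rewrite !ge_min lexx !orbT.
have Ke : K * e < m.
  have em : e <= m / (2 * (K + 1)) by rewrite !ge_min lexx !orbT.
  have E : m / (2 * (K + 1)) * (2 * (K + 1)) = m by rewrite divfK// gt_eqF// mulr_gt0.
  have := ler_wpM2l K0 em; set q := m / (2 * (K + 1)) in E *.
  have q0 : 0 < q by rewrite divr_gt0// mulr_gt0.
  lra.
exists r, e; split=> // G cl.
have VG : V G.
  by apply: hr0; apply: close_le cl => //; rewrite !le_max lexx.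
split=> //; have [_ _ _ gG] := hV G VG.
have [z [zo zL zy]] := hK e (fn G) ee1 (henon_funE G).2 gG cl.
have m1 : m <= rho - |[y 0%N - a]| by rewrite ge_min lexx.
have m2 : m <= rho - |[y 1%N - b]| by rewrite ge_min lexx orbT.
exists z, L; split=> //.
  by have := cnorm_tri (y 0%N) (z 0%N) a; have := zy 0%N; lra.
by have := cnorm_tri (y 1%N) (z 1%N) b; have := zy 1%N; lra.
Qed.

Lemma stable_meets_dense d (V W : set H) a b (rho : R) : open V -> open W -> V `&` W !=set0 ->
  0 < rho -> (forall G, V G -> datum_good d (fn G)) ->
  exists G, [/\ V G, W G & stable_meets d (fn G) a b rho].
Proof.
move=> oV oW [F [VF WF]] rho0 hV.
have nVW : nbhs F (V `&` W) by apply: open_nbhs_nbhs; split; [exact: openI | split].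
have [r0 [e [e0 hVW]]] := nbhs_close nVW.
have [eta0 kap0 gap0 _] := hV F VF.
pose r := Num.max r0 (|[center d]| + radius d).
have dr x : |[x - center d]| <= radius d -> |[x]| <= r.
  move=> xc; apply: (@le_trans _ _ (|[center d]| + radius d)); last by rewrite le_max lexx orbT.
  by have := cnorm_le_sub x (center d); lra.
have hVW' g : holo g -> close r e (fn F) g -> exists2 G, fn G = g & (V `&` W) G.
  move=> hg cl; have [G hG] := henon_exists delta hg; exists G => //.
  by apply: hVW; rewrite hG; apply: close_le cl => //; rewrite le_max lexx.
have rho2 : 0 < rho / 2 by rewrite divr_gt0.
have [|g [y [L [hg cl yo yL [ya yb]]]]] := @density_step R delta delta_gt1 (center d) (mult d) (radius d) (slack d)
  eta0 kap0 gap0 (fn F) r e (rho / 2) a b (henon_funE F).2 e0 rho2 _ dr.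
  by move=> g hg /(hVW' g hg)[G <- [VG _]]; have [] := hV G VG.
have [G hG [VG WG]] := hVW' g hg cl.
exists G; split=> //; rewrite hG; exists y, L; split=> //; lra.
Qed.

End Genericity.

(** * The generic map *)

Section FinalAssembly.
Variable R : realType.
Local Notation C := (R[i]).
Variable delta : C.
Hypothesis delta_gt1 : 1 < |[delta]|.
Local Notation H := (henon_maps delta).
Local Notation fn := (@henon_fun R delta).
Implicit Types (F G : H).

Definition rat_point (p : rat * rat) : C := ratr p.1 +i* ratr p.2.

Lemma rat_point_dense (z : C) (e : R) : 0 < e -> exists p, |[z - rat_point p]| < e.
Proof.
case: z => x y e0.
have rat1 (u : R) : exists s : rat, `|u - ratr s| < e / 2.
  have [|s] := @rat_in_itvoo R (u - e / 2) (u + e / 2); first by lra.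
  by rewrite in_itv /= => /andP[h1 h2]; exists s; rewrite ltr_norml; lra.
have [s hs] := rat1 x; have [t ht] := rat1 y; exists (s, t).
by apply: le_lt_trans (cnorm_ReIm _) _ => /=; lra.
Qed.

Lemma tends_cvg (z : nat -> C) (x : C) : tends z x ->
  (fun n => z n : (R[i] : numClosedFieldType)) @ \oo --> (x : (R[i] : numClosedFieldType)).
Proof.
move=> hz; apply/cvgrPdist_le => e /gt0_complexP[a a0 ->].
have [N hN] := hz a a0; exists N => // n /= Nn.
by rewrite ler_cnorm cnormC; exact: hN.
Qed.

(** As [p] is interior to the disc, the Lipschitz constant of [f x - mult d * x] bounds its
    derivative there. *)
Lemma mult_close d (f : C -> C) p t : datum_good delta d f -> |[p - center d]| <= radius d / 4 ->
  cdiff f p t -> |[t - mult d]| <= slack d.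
Proof.
move=> [eta0 kap0 _ [hlip _]] pc hd; apply/ler_addgt0Pr => e e0.
have [r r0 hr] := hd e e0.
pose s := Num.min r (radius d / 4); have s0 : 0 < s by rewrite lt_min r0 divr_gt0.
pose h : C := s%:C; have nh : |[h]| = s by rewrite cnorm_real ger0_norm// ltW.
have hr' : |[h]| <= r by rewrite nh ge_min lexx.
have hd4 : |[h]| <= radius d / 4 by rewrite nh ge_min lexx orbT.
have pc1 : |[p - center d]| <= radius d by lra.
have pc2 : |[p + h - center d]| <= radius d.
  by have := cnormD (p - center d) h; rewrite addrAC; lra.
have := hlip _ _ pc2 pc1; rewrite [p + h - p]addrC addKr => h1.
have := hr h hr' => h2.
rewrite -(ler_pM2r s0) -nh -cnormM.
rewrite (_ : _ * h = (f (p + h) - mult d * (p + h) - (f p - mult d * p)) - (f (p +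
    h) - f p - t * h)); last by ring.
by apply: le_trans (cnormB _ _) _; lra.
Qed.

(** The roots have sum [t] and product [delta]. If both moduli were at least 1, their sum would be
    at most [1 + |[delta]|]; so one is below 1, and the other exceeds 1 because the product does. *)
Lemma saddle_roots (t : C) : 1 + |[delta]| < |[t]| -> exists l m : C,
  [/\ l ^+ 2 - t * l + delta = 0, |[l]| < 1, m ^+ 2 - t * m + delta = 0 & 1 < |[m]|].
Proof.
move=> ht.
pose s : C := sqrtC (t ^+ 2 - 4 * delta).
have ss : s * s = t ^+ 2 - 4 * delta by rewrite -expr2 sqrtCK.
pose l := (t + s) / 2; pose m := (t - s) / 2.
have lm : l * m = delta.
  by rewrite (_ : l * m = (t ^+ 2 - s * s) / 4); [rewrite ss; field | rewrite /l /m; field].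
have lpm : l + m = t by rewrite /l /m; field.
have hl : l ^+ 2 - t * l + delta = 0 by rewrite -lpm -lm; ring.
have hm : m ^+ 2 - t * m + delta = 0 by rewrite -lpm -lm; ring.
have nlm : |[l]| * |[m]| = |[delta]| by rewrite -cnormM lm.
have nt : |[t]| <= |[l]| + |[m]| by rewrite -lpm; exact: cnormD.
have l0 := cnorm_ge0 l; have m0 := cnorm_ge0 m; have d1 := delta_gt1.
have [l1|l1] := ltP |[l]| 1.
  by exists l, m; split=> //; rewrite ltNge; apply/negP => m1; nra.
have [m1|m1] := ltP |[m]| 1; last by exfalso; nra.
by exists m, l; split=> //; rewrite ltNge; apply/negP => l2; nra.
Qed.

Lemma iter_henon (f : C -> C) y n : horbit delta f y ->
  iter n (henon delta f) (y 1%N, y 0%N) = (y n.+1, y n).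
Proof. by move=> yo; elim: n => [//|n IH]; rewrite iterS IH /henon /= -yo. Qed.

Lemma good_saddle d F : datum_good delta d (fn F) -> exists p : C,
  [/\ fixed_saddle (set_val F) (p, p), |[p - center d]| <= radius d &
    forall y L, horbit delta (fn F) y -> (forall n, (L <= n)%N -> |[y n - center d]| <= radius d) ->
      stable_manifold (set_val F) (p, p) (y 1%N, y 0%N)].
Proof.
move=> gd; have [eta0 kap0 gap0 gf] := gd; have [EF hf] := henon_funE F.
have [p fp pc] := fixed_point eta0 kap0 gap0 hf gf.
have pc1 : |[p - center d]| <= radius d by lra.
exists p; split=> //.
  split; first by rewrite EF /henon /= -fp.
  have [t ht] := hf p; have tm := mult_close gd pc ht.
  have [|l [m [hl l1 hm m1]]] := @saddle_roots t.
    by have := cnorm_le_sub (mult d) t; rewrite cnormC; move: gap0; rewrite /gap; lra.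
  exists l, m; rewrite EF; split.
  - by apply: (@henon_eigenvalue R[i] _ _ _ t) hl; exact/cdiff_quotientP.
  - by rewrite normcE -[1]/(1%:C) ltcR.
  - by apply: (@henon_eigenvalue R[i] _ _ _ t) hm; exact/cdiff_quotientP.
  - by rewrite normcE -[1]/(1%:C) ltcR.
move=> y L yo yL; rewrite /stable_manifold /= EF.
have yt : tends y p.
  have zc n : |[y (n + L)%N - center d]| <= radius d by apply: yL; rewrite leq_addl.
  have ht := orbit_tends eta0 kap0 gap0 gf fp pc1 (orbit_shift L yo) zc.
  move=> e /ht[N hN]; exists (N + L)%N => n nNL.
  have Ln : (L <= n)%N by apply: leq_trans nNL; rewrite leq_addl.
  by rewrite -(subnK Ln); apply: hN; rewrite leq_subRL// addnC.
have yt1 : tends (fun n => y n.+1) p.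
  by move=> e /yt[N hN]; exists N => n Nn; apply: hN; exact: leqW.
rewrite (_ : (fun n => _) = (fun n => (y n.+1, y n))); last by apply/funext => n; exact: iter_henon.
exact: (cvg_pair (tends_cvg yt1) (tends_cvg yt)).
Qed.

Lemma generic_dense_stable_manifold : exists U : set H,
  [/\ dense U, Gdelta U & forall F, U F -> exists p : C * C,
    fixed_saddle (set_val F) p /\ dense (stable_manifold (set_val F) p)].
Proof.
have [AA [cA dA denseA]] := maximal_cells delta_gt1.
pose O (i : (rat * rat) * (rat * rat) * nat) := [set F : H | exists2 X, AA X & X.1 F /\
  stable_meets delta X.2 (fn F) (rat_point i.1.1) (rat_point i.1.2) (i.2.+1%:R^-1)].
have oO i : open (O i).
  apply: open_close => F [X AX [XF hX]]; have [oX _ gX] := cA X AX.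
  have [r [e [e0 h]]] := stable_meets_open delta_gt1 oX XF gX hX.
  by exists r, e; split=> // G /h[XG hG]; exists X.
have dO i : dense (O i).
  move=> W W0 oW; have [X AX XW] := denseA W W0 oW; have [oX _ gX] := cA X AX.
  have i0 : 0 < i.2.+1%:R^-1 :> R by rewrite invr_gt0 ltr0n.
  have [G [XG WG hG]] := stable_meets_dense delta_gt1 (rat_point i.1.1) (rat_point i.1.2) oX oW XW i0 gX.
  by exists G; split=> //; exists X.
(* Enumeration of the countably many triples; a number that codes none contributes the full set. *)
pose O' n := if unpickle n is Some i then O i else setT.
exists (\bigcap_n O' n); split.
- apply: henon_baire => n; rewrite /O'; case: (unpickle n) => [i|] //.
    exact: openT.
  by move=> W W0 _; rewrite setIT.
- by exists O' => // n; rewrite /O'; case: (unpickle n) => [i|] //; exact: openT.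
move=> F UF; have OF i : O i F by have := UF (pickle i) I; rewrite /O' pickleK.
have [X AX [XF _]] := OF ((0, 0), (0, 0), 0%N).
have [_ _ gX] := cA X AX; have [p [sp _ hp]] := good_saddle (gX F XF).
exists (p, p); split=> // B [q Bq] oB.
have nB := open_nbhs_nbhs (conj oB Bq).
have [e' /gt0_complexP[e e0 ->] hB] := (@nbhs_pair_ball R[i] q B).1 nB.
have e2 : 0 < e / 2 by rewrite divr_gt0.
(* The order is reversed because [stable_meets] compares [a] with [y 0], the second coordinate. *)
have [a ha] := rat_point_dense q.2 e2; have [b hb] := rat_point_dense q.1 e2.
have [k hk] := natr_unbounded (2 / e).
have ke : k.+1%:R^-1 <= e / 2.
  rewrite -[e / 2]invrK lef_pV2 ?posrE ?invr_gt0 ?ltr0n// invf_div.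
  by apply: le_trans hk _; rewrite ler_nat.
have [Y AY [YF [y [L [yo yL ya yb]]]]] := OF (a, b, k).
(* Disjointness of the cells: the orbit found for this ball is attached to the saddle that was fixed
   before the ball was given. *)
have XY := dA _ _ F AX AY XF YF; rewrite -XY in yL.
exists (y 1%N, y 0%N); split; last exact: hp yo yL.
have {}ya := lt_le_trans ya ke; have {}yb := lt_le_trans yb ke; rewrite /= in ya yb.
rewrite cnormC in ha; rewrite cnormC in hb.
apply: hB; rewrite ltr_cnorm.
  by have := cnorm_tri (rat_point b) (y 1%N) q.1; lra.
by have := cnorm_tri (rat_point a) (y 0%N) q.2; lra.
Qed.

End FinalAssembly.

Theorem theorem4p1 (R : realType) (delta : R[i]) (hdelta : 1 < `|delta|) :
  exists U : set (henon_maps delta),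
    [/\ dense U, Gdelta U &
        forall F : henon_maps delta, U F ->
          exists p : R[i] * R[i],
            fixed_saddle (set_val F) p /\
            dense (stable_manifold (set_val F) p)].
Proof.
by apply: generic_dense_stable_manifold; rewrite -ltcR -normcE.
Qed.
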